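(* Let $k\ge3$ be an integer, $s_c=1-\frac1k$, and let $\tau_0\subseteq[0,1]$ be a time interval. There exist $\delta>0$ and a constant $c>0$ such that for all $\phi_1,\dots,\phi_{k+1}\in L^2(\mathbb{T}^2)$ and all dyadic numbers $N_1\ge\dots\ge N_{k+1}\ge1$, $$\Big\|\prod_{j=1}^{k+1}P_{N_j}e^{it\Delta}\phi_j\Big\|_{L^2(\tau_0\times\mathbb{T}^2)}\le c\Big(\frac{N_{k+1}}{N_1}+\frac1{N_2}\Big)^{\delta}\|P_{N_1}\phi_1\|_{L^2(\mathbb{T}^2)}\prod_{j=2}^{k+1}N_j^{s_c}\|P_{N_j}\phi_j\|_{L^2(\mathbb{T}^2)}.$$
   Context: $\mathbb{T}^2=\mathbb{R}^2/\mathbb{Z}^2$, $\widehat f(n)=\int_{[0,1]^2}e^{-2\pi ix\cdot n}f(x)\,dx$ for $n\in\mathbb{Z}^2$. Fix $C>1$ and $\alpha_1,\alpha_2\in(\frac1C,C)$, and put $Q(n)=\alpha_1n_1^2+\alpha_2n_2^2$. The linear Schrödinger evolution is $(e^{it\Delta}f)(x)=\sum_{n\in\mathbb{Z}^2}\widehat f(n)e^{2\pi i(n\cdot x+Q(n)t)}$. A dyadic number is a number $2^m$ with $m\in\mathbb{Z}_{\ge0}$. Fix a non-negative even $\psi\in C_0^\infty((-2,2))$ with $\psi(s)=1$ for $|s|\le1$; set $\psi_N(\xi)=\psi(|\xi|/N)-\psi(2|\xi|/N)$ for dyadic $N\ge2$ and $\psi_1(\xi)=\psi(|\xi|)$. $P_N$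 is the Fourier multiplier with symbol $\psi_N$, i.e. $\widehat{P_Nf}(n)=\psi_N(n)\widehat f(n)$. The constant $c$ may depend on $C$, $k$ and $\tau_0$, but not on the $\phi_j$ or $N_j$. *)

(* Defs.v *)
(* Functions on T^2 = R^2/Z^2 are represented by their
   restriction to the fundamental domain [0,1]^2: a function on T^2 is any
   f : R * R -> R[i], of which only the values on [0,1]^2 matter. *)
From HB Require Import structures.
From mathcomp Require Import all_boot all_order all_algebra finmap.
From mathcomp Require Import complex.
From mathcomp Require Import all_classical all_reals all_analysis.
From mathcomp.analysis.showcase Require Import summability.

Set Implicit Arguments.
Unset Strict Implicit.
Unset Printing Implicit Defensive.

Import Order.TTheory GRing.Theory Num.Theory.
Import numFieldNormedType.Exports.

Local Open Scope classical_set_scope.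
Local Open Scope ring_scope.

Section L2.
Context {d : measure_display} {T : measurableType d} {R : realType}.
Variables (mu : {measure set T -> \bar R}) (D : set T).

Definition L2norm (f : T -> R[i]) : \bar R :=
  ((\int[mu]_(x in D) (ComplexField.Normc.normc (f x) ^+ 2)%:E) `^ 2^-1)%E.

Definition inL2 (f : T -> R[i]) : Prop :=
  [/\ measurable_fun D (fun x => complex.Re (f x)),
      measurable_fun D (fun x => complex.Im (f x)) & (L2norm f < +oo)%E].

(* The series \sum_(i : I) u i converges to g unconditionally in L^2. *)
Definition L2_sum {I : choiceType} (u : I -> T -> R[i]) (g : T -> R[i]) : Prop :=
  inL2 g /\
  L2norm (fun x => g x - \sum_(i <- (F : {fset I})) u i x) @[F --> totally]
    --> 0%E.

End L2.

Section Torus.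
Context {R : realType}.

Local Notation rT := (measurableTypeR R).

Definition leb2 : set (rT * rT)%type -> \bar R :=
  ((@lebesgue_measure R) \x (@lebesgue_measure R))%E.

HB.instance Definition _ := Measure.on leb2.

Let leb2_sigma_finite : sigma_finite setT leb2.
Proof.
have /sigma_finiteP[F [TF ndF Foo]] := sigma_finiteT (@lebesgue_measure R).
exists (fun n => F n `*` F n).
  rewrite -setXTT TF predeqE => -[x y]; split.
    move=> [/= [n _ Fnx] [m _ Fmy]]; exists (maxn n m) => //; split.
    - by move: x Fnx; exact/subsetPset/ndF/leq_maxl.
    - by move: y Fmy; exact/subsetPset/ndF/leq_maxr.
  by move=> [n _ []/= ? ?]; split; exists n.
move=> m; have [? ?] := Foo m.
split; first exact: measurableX.
by rewrite /leb2 product_measure1E// lte_mul_pinfty// ge0_fin_numE.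
Qed.

HB.instance Definition _ :=
  Measure_isSigmaFinite.Build _ _ _ leb2 leb2_sigma_finite.

Definition leb3 : set (rT * (rT * rT))%type -> \bar R :=
  ((@lebesgue_measure R) \x leb2)%E.

HB.instance Definition _ := Measure.on leb3.

Definition torus : set (R * R) := `[0, 1] `*` `[0, 1].

Definition dot (n : int * int) (x : R * R) : R := n.1%:~R * x.1 + n.2%:~R * x.2.

(* e^{2 pi i s} *)
Definition expi (s : R) : R[i] := Complex (cos (2 * pi * s)) (sin (2 * pi * s)).

Definition fourier (f : R * R -> R[i]) (n : int * int) : R[i] :=
  Complex (\int[leb2]_(x in torus) complex.Re (expi (- dot n x) * f x))
          (\int[leb2]_(x in torus) complex.Im (expi (- dot n x) * f x)).

Definition Q (a1 a2 : R) (n : int * int) : R :=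
  a1 * n.1%:~R ^+ 2 + a2 * n.2%:~R ^+ 2.

(* e^{it Delta} f: the sum in L^2(T^2) of its Fourier series, which determines
   it up to a null set; xget picks a representative. *)
Definition schrodinger (a1 a2 t : R) (f : R * R -> R[i]) : R * R -> R[i] :=
  xget (fun=> 0)
    [set g | L2_sum leb2 torus
       (fun n x => fourier f n * expi (dot n x + Q a1 a2 n * t)) g].

Definition dyadic (N : R) : Prop := exists m : nat, N = 2 ^+ m.

(* Non-negative even psi in C_0^oo((-2,2)) with psi = 1 on [-1,1]; the closed
   support is compact as soon as it is contained in ]-2,2[. *)
Definition cutoff (psi : R -> R) : Prop :=
  [/\ forall (m : nat) (s : R), derivable (derive1n m psi) s 1,
      closure [set s | psi s != 0] `<=` `](-2), 2[,
      forall s, 0 <= psi s,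
      forall s, psi (- s) = psi s
    & forall s, `|s| <= 1 -> psi s = 1].

Definition norm2 (n : int * int) : R :=
  Num.sqrt (n.1%:~R ^+ 2 + n.2%:~R ^+ 2).

Definition LP_symbol (psi : R -> R) (N : R) (n : int * int) : R :=
  if N == 1 then psi (norm2 n)
  else psi (norm2 n / N) - psi (2 * norm2 n / N).

(* P_N f; the symbol has finite support in Z^2, so the sum is finite and
   defined pointwise. *)
Definition LP (psi : R -> R) (N : R) (f : R * R -> R[i]) (x : R * R) : R[i] :=
  \sum_(n \in [set: int * int])
    (Complex (LP_symbol psi N n) 0 * fourier f n * expi (dot n x)).

End Torus.

(* Main.v *)
(* After squaring, the claim bounds the space-time integral of prod |u_j|^2, where
   u_j is a finite exponential sum with frequencies in a box of side about N_j.
   (If the L^2 sum defining the evolution does not exist, [schrodinger] is 0 and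
   so is the left-hand side; hence no Riesz-Fischer theorem is needed.)
   Cut [0,1] into N_2^2 time slabs of length N_2^-2.

   Transversality. If N_1 >= 12 N_2, some coordinate of every frequency of u_1 is
   of size N_1. Freezing the other coordinate of the frequencies of u_2, the
   phases of two resonant pairs differ by at least N_1 |m - m'| / (3C), and a
   Schur test on one slab bounds the integral of |u_1 u_2|^2 by
   (N_2/N_1 + 1/N_2) ||phi_1||^2 ||phi_2||^2.

   Large values. Weyl differencing and a pigeonhole argument show that the kernel
   of the evolution is large only near times at which alpha_1 t or alpha_2 t has a
   rational approximation of small denominator. By the Halasz-Montgomery
   duality argument, the suprema H_j(i) <= 1 of |u_j| over the slabs, normalised by
   the trivial bound 5 N_j ||phi_j||, satisfy sum_i H_j(i)^p <= K (N_2/N_j)^2 for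
   p > 5; we take p = 21/4, so that p/k < 2.

   Combination. Interpolating the bilinear bound with |u_2| <= 5 N_2 ||phi_2|| H_2
   leaves the sum over the slabs of H_2^(2-2e) prod_(j>=3) H_j^2, which weighted
   AM-GM reduces to the moments sum_i H_j(i)^p. *)

Require Import Defs.
From HB Require Import structures.
From mathcomp Require Import all_boot all_order all_algebra finmap.
From mathcomp Require Import complex.
From mathcomp Require Import all_classical all_reals all_analysis.
From mathcomp Require Import measurable_realfun zify ring lra.
From mathcomp.analysis.showcase Require Import summability.

Set Implicit Arguments.
Unset Strict Implicit.
Unset Printing Implicit Defensive.

Import Order.TTheory GRing.Theory Num.Theory.
Import numFieldNormedType.Exports.

Local Open Scope ring_scope.

(** The powers N_j^s_c leave no room for a loss N^eps, so every large-value bound has to be scale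
    invariant. This shapes the Weyl part: the logarithm produced by differencing is truncated at a
    height depending on the level 4^-l, where it costs l + 1 <= 2^l; losses depend on l and never on
    N. The price is in the exponent: about 32^(2l) = 4^(5l) times (N_2/N_j)^2 slabs reach level
    4^-l, a weak moment of order 5, whereas 4 is the Strichartz exponent in dimension 2. The
    hypothesis k >= 3 pays for it: k squared factors with weights near 1/k need p/k < 2, and 5 < p <
    6 is possible.

    The power s_c comes from the same weights: the trivial bounds give N_j^2, and a share 1/k of the
    j-th moment gives N_j^(-2/k).

    The form Q is diagonal, so the kernel of the evolution is a product of two sums in one variable.
    Each alpha_i t is approximated separately, and no arithmetic relation between alpha_1 and
    alpha_2 matters. *)

Notation nc := ComplexField.Normc.normc.

(** * Complex numbers and exponential sums *)

Section Complex.
Context {R : realType}.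
Implicit Types (z w : R[i]) (s t : R).

Lemma expiD s t : expi (s + t) = expi s * expi t :> R[i].
Proof.
rewrite /expi mulrDr cosD sinD; apply/eqP; rewrite eq_complex /=.
by rewrite eqxx /= addrC [X in _ == X]addrC mulrC [X in _ + X]mulrC; apply/eqP; ring.
Qed.

Lemma expi0 : expi 0 = 1 :> R[i].
Proof. by rewrite /expi mulr0 cos0 sin0. Qed.

Lemma expiN s : expi (- s) = (expi s)^*%C :> R[i].
Proof. by rewrite /expi mulrN cosN sinN. Qed.

Lemma nc_ge0 z : 0 <= nc z.
Proof. by case: z => a b; rewrite sqrtr_ge0. Qed.

Lemma nc_sqr z : nc z ^+ 2 = complex.Re z ^+ 2 + complex.Im z ^+ 2.
Proof. by case: z => a b; rewrite sqr_sqrtr// addr_ge0// sqr_ge0. Qed.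

Lemma nc_sqrE z : nc z ^+ 2 = complex.Re (z * z^*%C).
Proof. by rewrite nc_sqr; case: z => a b /=; ring. Qed.

Lemma ncM z w : nc (z * w) = nc z * nc w.
Proof. exact: ComplexField.Normc.normcM. Qed.

Lemma ncJ z : nc (z^*%C) = nc z.
Proof. by case: z => a b /=; rewrite sqrrN. Qed.

Lemma conjcM z w : (z * w)^*%C = z^*%C * w^*%C.
Proof. exact: (rmorphM (@conjc R)). Qed.

Lemma nc_real (r : R) : nc (Complex r 0) = `|r|.
Proof. by rewrite /= expr0n addr0 sqrtr_sqr. Qed.

Lemma nc_expi s : nc (expi s) = 1.
Proof. by rewrite /expi /= cos2Dsin2 sqrtr1. Qed.

Lemma nc0 : nc (0 : R[i]) = 0.
Proof. exact: ComplexField.Normc.normc0. Qed.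

Lemma nc1 : nc (1 : R[i]) = 1.
Proof. exact: ComplexField.Normc.normc1. Qed.

Lemma nc_eq0 z : nc z = 0 -> z = 0.
Proof. exact: ComplexField.Normc.eq0_normc. Qed.

Lemma ler_ncD z w : nc (z + w) <= nc z + nc w.
Proof. exact: le_normcD. Qed.

Lemma nc_sum I (r : seq I) (P : pred I) (f : I -> R[i]) :
  nc (\sum_(i <- r | P i) f i) <= \sum_(i <- r | P i) nc (f i).
Proof.
elim/big_rec2 : _ => [|i y1 y2 _ le]; first by rewrite nc0.
by apply: (le_trans (ler_ncD _ _)); rewrite lerD2l.
Qed.

Lemma nc_prod I (r : seq I) (P : pred I) (f : I -> R[i]) :
  nc (\prod_(i <- r | P i) f i) = \prod_(i <- r | P i) nc (f i).
Proof. by elim/big_rec2 : _ => [|i y1 y2 _ <-]; rewrite ?nc1 ?ncM. Qed.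

Lemma Re_le_nc z : `|complex.Re z| <= nc z.
Proof.
rewrite -(@ler_pXn2r _ 2) ?nnegrE ?nc_ge0//.
by rewrite nc_sqr real_normK ?num_real// lerDl sqr_ge0.
Qed.

Lemma Im_le_nc z : `|complex.Im z| <= nc z.
Proof.
rewrite -(@ler_pXn2r _ 2) ?nnegrE ?nc_ge0//.
by rewrite nc_sqr real_normK ?num_real// lerDr sqr_ge0.
Qed.

Lemma Re_sum I (r : seq I) (P : pred I) (f : I -> R[i]) :
  complex.Re (\sum_(i <- r | P i) f i) = \sum_(i <- r | P i) complex.Re (f i).
Proof. exact: (raddf_sum (@complex.Re R)). Qed.

Lemma Im_sum I (r : seq I) (P : pred I) (f : I -> R[i]) :
  complex.Im (\sum_(i <- r | P i) f i) = \sum_(i <- r | P i) complex.Im (f i).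
Proof. exact: (raddf_sum (@complex.Im R)). Qed.

Lemma nc_sqr_sum (I : finType) (P : pred I) (f : I -> R[i]) :
  nc (\sum_(i | P i) f i) ^+ 2 = \sum_(i | P i) \sum_(j | P j) complex.Re (f i * (f j)^*%C).
Proof.
rewrite nc_sqrE rmorph_sum mulr_suml Re_sum; apply: eq_bigr => i _.
by rewrite mulr_sumr Re_sum.
Qed.

Lemma cauchy_schwarz (I : finType) (P : pred I) (a b : I -> R) :
  (\sum_(i | P i) a i * b i) ^+ 2 <=
  (\sum_(i | P i) a i ^+ 2) * (\sum_(i | P i) b i ^+ 2).
Proof.
set A := \sum_(i | P i) a i ^+ 2; set B := \sum_(i | P i) b i ^+ 2.
set C := \sum_(i | P i) a i * b i.
have : 0 <= \sum_(i | P i) (B * a i - C * b i) ^+ 2 by apply: sumr_ge0 => i _; exact: sqr_ge0.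
have -> : \sum_(i | P i) (B * a i - C * b i) ^+ 2 = B * (A * B - C ^+ 2).
  transitivity (\sum_(i | P i) (B ^+ 2 * a i ^+ 2 - 2 * B * C * (a i * b i) + C ^+ 2 * b i ^+ 2)).
    by apply: eq_bigr => i _; ring.
  rewrite big_split sumrB/= -!mulr_sumr -/A -/B -/C; ring.
have : 0 <= B by apply: sumr_ge0 => i _; exact: sqr_ge0.
rewrite le_eqVlt => /orP[/eqP B0 _|B0]; last by rewrite pmulr_rge0// subr_ge0.
suff -> : C = 0 by rewrite expr0n/= -B0 mulr0.
have b0 i : P i -> b i = 0.
  move=> Pi; apply/eqP; rewrite -sqrf_eq0; apply/eqP.
  by apply: (psumr_eq0P _ (esym B0) Pi) => j _; exact: sqr_ge0.
by rewrite /C big1// => i Pi; rewrite b0// mulr0.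
Qed.

Lemma cauchy_schwarz_nc (I : finType) (P : pred I) (a b : I -> R[i]) :
  nc (\sum_(i | P i) a i * b i) ^+ 2 <=
  (\sum_(i | P i) nc (a i) ^+ 2) * (\sum_(i | P i) nc (b i) ^+ 2).
Proof.
apply: le_trans (cauchy_schwarz _ _ _).
rewrite ler_pXn2r ?nnegrE ?nc_ge0//; last by apply: sumr_ge0 => i _; rewrite mulr_ge0 ?nc_ge0.
by apply: le_trans (nc_sum _ _ _) _; apply: ler_sum => i _; rewrite ncM.
Qed.

Lemma cauchy_schwarz_card (I : finType) (P : pred I) (a : I -> R[i]) :
  nc (\sum_(i | P i) a i) ^+ 2 <= #|P|%:R * \sum_(i | P i) nc (a i) ^+ 2.
Proof.
have -> : \sum_(i | P i) a i = \sum_(i | P i) 1 * a i by apply: eq_bigr => i _; rewrite mul1r.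
apply: le_trans (cauchy_schwarz_nc _ _ _) _; rewrite le_eqVlt; apply/orP; left; apply/eqP.
by congr (_ * _); rewrite nc1 expr1n sumr_const.
Qed.

(** With z = y/2, the mean value theorem gives sin z >= z cos z, hence sin y = 2 sin z cos z >= 2 z
    cos^2 z = z (1 + cos y) >= z. *)
Lemma sin_ge_half (y : R) : 0 <= y <= pi / 2 -> y / 2 <= sin y.
Proof.
move=> /andP[y0 yp]; have [->|yn0] := eqVneq y 0; first by rewrite sin0 mul0r.
have y_gt0 : 0 < y by rewrite lt_def yn0.
set z := y / 2.
have z0 : 0 < z by rewrite divr_gt0.
have p0 := @pi_gt0 R.
have yz : y = z *+ 2 by rewrite /z -mulr_natr divfK.
have zp : z <= pi by rewrite /z; lra.
have dsin x : x \in `]0, z[ -> is_derive x 1 (@sin R) (cos x) by move=> _; exact: is_derive_sin.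
have csin : {within `[0, z], continuous (@sin R)}%classic.
  by apply: continuous_subspaceT => x; exact: continuous_sin.
have [c] := MVT_segment (ltW z0) dsin csin.
rewrite in_itv/= => /andP[c0 cz]; rewrite sin0 !subr0 => sz.
have czc : cos z <= cos c.
  have [->//|nwz] := eqVneq c z.
  rewrite ltW// ltr_cos ?in_itv/= ?(ltW z0) ?c0//; last exact: le_trans zp.
  by rewrite lt_neqAle nwz.
have cz0 : 0 <= cos z by apply: cos_ge0_pihalf; apply/andP; split; rewrite /z; lra.
have : 0 <= cos y by apply: cos_ge0_pihalf; apply/andP; split; lra.
rewrite [in cos _]yz [in sin _]yz cos_mulr2n sin_mulr2n sz => cy.
have h : cos z * z <= cos c * z by rewrite ler_wpM2r// ltW.
have : cos z * (cos z * z) <= cos z * (cos c * z) by rewrite ler_wpM2l.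
have : 0 <= z * (cos z ^+ 2 *+ 2 - 1) by rewrite mulr_ge0// ltW.
lra.
Qed.

Lemma expi_int (z : int) : expi z%:~R = 1 :> R[i].
Proof.
have H n : expi n%:R = 1 :> R[i].
  elim: n => [|n IH]; first exact: expi0.
  rewrite -addn1 natrD expiD IH mul1r /expi mulr1 mulr_natl cos2pi sin2pi//.
case: z => n; first exact: H.
by rewrite NegzE rmorphN/= expiN -pmulrn H /= oppr0.
Qed.

(** Multiplied by 1 - e(t), the geometric sum telescopes to modulus at most 2, while |1 - e(t)| = 2
    sin(pi f) is at least twice the distance from f to {0, 1}. The product form covers integral t
    without a case distinction. *)
Lemma geom_expi (L : nat) (t f : R) (z : int) : t = z%:~R + f -> 0 <= f <= 1 ->
  nc (\sum_(m < L) expi (m%:R * t)) * Num.min f (1 - f) <= 1.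
Proof.
move=> tE /andP[f0 f1].
have H : (1 - expi t) * (\sum_(m < L) expi (m%:R * t)) = 1 - expi (L%:R * t) :> R[i].
  elim: L => [|L IH]; first by rewrite big_ord0 mulr0 mul0r expi0 subrr.
  rewrite big_ord_recr/= mulrDr IH mulrBl mul1r -[in RHS]addn1 natrD [in RHS]mulrDl mul1r.
  by rewrite [in RHS]addrC -[in RHS]addrC expiD mulrC [expi t * _]mulrC addrA subrK.
have n1 : nc (1 - expi t) ^+ 2 = (2 * sin (pi * f)) ^+ 2.
  have -> : expi t = expi f.
    by rewrite tE expiD expi_int mul1r.
  rewrite nc_sqr /expi/= -mulrA mulr_natl cos_mulr2n sin_mulr2n.
  have := cos2Dsin2 (pi * f); set c := cos _; set s := sin _ => cs.
  have -> : c ^+ 2 = 1 - s ^+ 2 by rewrite -cs addrK.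
  rewrite sub0r.
  have -> : (- ((c * s) *+ 2)) ^+ 2 = 4 * (c ^+ 2) * s ^+ 2 by ring.
  have -> : c ^+ 2 = 1 - s ^+ 2 by rewrite -cs addrK.
  by ring.
have p0 := @pi_gt0 R.
have p2 := @pi_ge2 R.
have sf : Num.min f (1 - f) <= sin (pi * f).
  have [fh|fh] := leP f (2^-1).
    rewrite ge_min; apply/orP; left.
    apply: le_trans (sin_ge_half _); last by apply/andP; split; nra.
    nra.
  rewrite ge_min; apply/orP; right.
  have -> : sin (pi * f) = sin (pi * (1 - f)) by rewrite mulrBr mulr1 sinB sinpi cospi mul0r sub0r mulN1r opprK.
  apply: le_trans (sin_ge_half _); last by apply/andP; split; nra.
  nra.
have m0 : 0 <= Num.min f (1 - f) by rewrite le_min f0 subr_ge0.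
have n2 : nc (1 - expi t) = 2 * sin (pi * f).
  apply/eqP; rewrite -(@eqrXn2 _ 2) ?nc_ge0 ?n1// mulr_ge0// (le_trans m0)//.
have : nc (1 - expi t) * nc (\sum_(m < L) expi (m%:R * t)) <= 2.
  rewrite -ncM H; apply: le_trans (ler_ncD _ _) _; rewrite nc1.
  by rewrite -mulN1r ncM nc_expi mulr1 normcN nc1.
rewrite n2; have := nc_ge0 (\sum_(m < L) expi (m%:R * t)); nra.
Qed.

End Complex.

(** * Large values of quadratic Weyl sums *)

(* [q] is the least gap between two elements of [A], [d] the diameter of [A]. *)
Lemma min_gap (K : nat) (A : {set 'I_K}) : (1 < #|A|)%N ->
  exists q d h0 h1 m0 M0 : nat, exists H0 H1 H2 H3,
   [/\ (@Ordinal K h0 H0) \in A, (@Ordinal K h1 H1) \in A,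
      (@Ordinal K m0 H2) \in A & (@Ordinal K M0 H3) \in A] /\
   [/\ (0 < q)%N, h1 = (h0 + q)%N, M0 = (m0 + d)%N & (q * (#|A|.-1) <= d)%N].
Proof.
move=> A1.
have [x xA] : exists x, x \in A by apply/card_gt0P; lia.
pose m0 := [arg min_(i < x in A) (i : nat)].
pose M0 := [arg max_(i > x in A) (i : nat)].
have [m0A m0P] : m0 \in A /\ forall i, i \in A -> (m0 <= i)%N.
  by rewrite /m0; case: arg_minnP.
have [M0A M0P] : M0 \in A /\ forall i, i \in A -> (i <= M0)%N.
  by rewrite /M0; case: arg_maxnP.
clearbody m0 M0.
pose p q := (0 < q)%N && [exists h0 : 'I_K, exists h1 : 'I_K,
   [&& h0 \in A, h1 \in A & (h1 == h0 + q :> nat)%N]].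
have exq : exists q, p q.
  have /card_gt1P[u [v [uA vA uv]]] := A1.
  wlog uv' : u v uA vA uv / (u < v)%N.
    move=> H; have [lt|lt|e] := ltngtP u v; first exact: (H u v).
      by apply: (H v u) => //; rewrite eq_sym.
    by move: uv; rewrite (val_inj e) eqxx.
  exists (v - u)%N; apply/andP; split; first lia.
  by apply/existsP; exists u; apply/existsP; exists v; rewrite uA vA /=; lia.
case: (ex_minnP exq) => q /andP[q0 /existsP[h0 /existsP[h1 /and3P[h0A h1A /eqP h01]]]] qmin.
exists q, (M0 - m0)%N, h0, h1, m0, M0, (ltn_ord h0), (ltn_ord h1), (ltn_ord m0), (ltn_ord M0).
have E (i : 'I_K) : Ordinal (ltn_ord i) = i by apply: val_inj.
rewrite !E; split => //; split => //; first by rewrite subnKC// m0P.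
have F1 (h : 'I_K) : (((h - m0) %/ q) < ((M0 - m0) %/ q).+1)%N || (h \notin A).
  have [hA|_] := boolP (h \in A); last by rewrite orbT.
  by rewrite ltnS leq_div2r// leq_sub2r// M0P.
(* Cut [m0, M0] into blocks of length q. Two elements of A in one block would be closer than the
   least gap, so there are at least #|A| blocks. *)
pose f (h : 'I_K) : 'I_((M0 - m0) %/ q).+1 := inord ((h - m0) %/ q).
have finj : {in A &, injective f}.
  move=> u v uA vA fuv; apply/eqP/negPn/negP => uv.
  have : ((u - m0) %/ q = (v - m0) %/ q)%N.
    have := congr1 (@nat_of_ord _) fuv; rewrite /f !inordK //.
      by have := F1 v; rewrite vA orbF.
    by have := F1 u; rewrite uA orbF.
  clear fuv; wlog uv' : u v uA vA uv / (u < v)%N.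
    move=> H; have [lt|lt|e] := ltngtP u v; first exact: (H u v).
      by move=> e; apply: (H v u) => //; rewrite eq_sym.
    by move: uv; rewrite (val_inj e) eqxx.
  move=> e.
  have pvu : p (v - u)%N.
    apply/andP; split; first by rewrite subn_gt0.
    by apply/existsP; exists u; apply/existsP; exists v; rewrite uA vA /= subnKC// ltnW.
  have := qmin _ pvu; have := m0P _ uA.
  have := divn_eq (u - m0) q; have := divn_eq (v - m0) q; rewrite e.
  have := ltn_pmod (u - m0) q0; have := ltn_pmod (v - m0) q0.
  move: (_ %/ q * q)%N (_ %% q)%N (_ %% q)%N => X r1 r2.
  clear -uv'; lia.
have := card_in_imset finj => <-.
have : (#|f @: A| <= ((M0 - m0) %/ q).+1)%N.
  by rewrite -[X in (_ <= X)%N]card_ord; apply: max_card.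
move=> H; have := leq_trunc_div (M0 - m0) q; rewrite mulnC.
apply: leq_trans; rewrite leq_mul2l; apply/orP; right.
by move: H; case: #|_|.
Qed.

(* With [q] and [d] from [min_gap], both [q s] and [d s] are close to integers [b] and
   [b'], and [d b - q b'] is an integer below 1 in absolute value, hence 0; so the error
   at [q] is [q / d] times the error at [d]. *)
Lemma rational_approx (R : realType) (P : nat) (s f0 : R) (A : {set 'I_(2 * P)}) (a : 'I_(2 * P) -> int) :
  (forall h, h \in A -> 0 <= h%:R * s - (a h)%:~R - f0 < (8 * P%:R)^-1) ->
  (1 < #|A|)%N ->
  exists (q : nat) (b : int), [/\ (0 < q)%N, (q * #|A|.-1 <= 2 * P)%N &
     `|q%:R * s - b%:~R| * #|A|.-1%:R <= (8 * P%:R)^-1].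
Proof.
move=> Ha A1; have [q [d [h0 [h1 [m0 [M0 [H0 [H1 [H2 [H3 [[]]]]]]]]]]]] := min_gap A1.
move=> /Ha /= B0 /Ha /= B1 /Ha /= B2 /Ha /= B3 [q0 e1 e2 qd].
set a0 := a _ in B0; set a1 := a _ in B1; set a2 := a _ in B2; set a3 := a _ in B3.
clearbody a0 a1 a2 a3.
have P0 : (0 < P)%N by move: (leq_ltn_trans (leq0n _) H0); rewrite muln_gt0.
have dA : (d < 2 * P)%N by apply: leq_ltn_trans H3; rewrite e2 leq_addl.
have PR : 0 < P%:R :> R by rewrite ltr0n.
set e := (8 * P%:R)^-1 in B0 B1 B2 B3 *.
have eP : e * (8 * P%:R) = 1 by rewrite mulVf // gt_eqF// mulr_gt0.
have e0 : 0 < e by rewrite invr_gt0 mulr_gt0.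
exists q, (a1 - a0)%R; rewrite q0; split => //; first exact: leq_trans qd (ltnW dA).
have n1 : `|q%:R * s - (a1 - a0)%:~R| < e.
  rewrite rmorphB/= ltr_norml; move: B0 B1; rewrite e1 natrD.
  by move=> /andP[? ?] /andP[? ?]; apply/andP; split; lra.
have n2 : `|d%:R * s - (a3 - a2)%:~R| < e.
  rewrite rmorphB/= ltr_norml; move: B2 B3; rewrite e2 natrD.
  by move=> /andP[? ?] /andP[? ?]; apply/andP; split; lra.
have d0 : (0 < d)%N by apply: leq_trans qd; rewrite muln_gt0 q0 -subn1 subn_gt0.
have qd' : (q <= d)%N by apply: leq_trans qd; rewrite leq_pmulr// -subn1 subn_gt0.
have dR : 0 < d%:R :> R by rewrite ltr0n.
have qR : 0 < q%:R :> R by rewrite ltr0n.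
have qdR : q%:R <= d%:R :> R by rewrite ler_nat.
have dPR : d%:R <= 2 * P%:R :> R by rewrite -natrM ler_nat ltnW.
(* The window length e = 1/(8P) is chosen for this: q and d are at most 2P, so the integer is at
   most (q + d) e <= 1/2. *)
have coll : d%:R * (a1 - a0)%:~R = q%:R * (a3 - a2)%:~R :> R.
  have : `|d%:Z * (a1 - a0) - q%:Z * (a3 - a2)| < 1.
    rewrite -(@ltr_int R) intr_norm rmorphB !rmorphM/= -!pmulrn.
    have -> : d%:R * (a1 - a0)%:~R - q%:R * (a3 - a2)%:~R =
      q%:R * (d%:R * s - (a3 - a2)%:~R) - d%:R * (q%:R * s - (a1 - a0)%:~R) :> R.
      by clear; move: (d%:R) (q%:R) ((a1 - a0)%:~R) ((a3 - a2)%:~R) => *; ring.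
    apply: le_lt_trans (ler_normB _ _) _; rewrite !normrM !normr_nat.
    have : q%:R * `|d%:R * s - (a3 - a2)%:~R| <= q%:R * e by rewrite ler_wpM2l// ltW.
    have : d%:R * `|q%:R * s - (a1 - a0)%:~R| <= d%:R * e by rewrite ler_wpM2l// ltW.
    have : q%:R * e <= 2 * P%:R * e by rewrite ler_wpM2r ?(ltW e0)// (le_trans qdR).
    have : d%:R * e <= 2 * P%:R * e by rewrite ler_wpM2r ?(ltW e0).
    lra.
  have -> : d%:R * (a1 - a0)%:~R = ((d%:Z * (a1 - a0))%:~R : R) by rewrite rmorphM/= -pmulrn.
  have -> : q%:R * (a3 - a2)%:~R = ((q%:Z * (a3 - a2))%:~R : R) by rewrite rmorphM/= -pmulrn.
  move: (_ * _) (_ * _) => X Y; clear => H; congr (_%:~R); lia.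
have dq : `|q%:R * s - (a1 - a0)%:~R| * d%:R <= q%:R * e.
  rewrite -[X in _ * X <= _]normr_nat -normrM.
  have -> : (q%:R * s - (a1 - a0)%:~R) * d%:R = q%:R * (d%:R * s - (a3 - a2)%:~R) by rewrite mulrBl [_%:~R * _]mulrC coll; ring.
  by rewrite normrM normr_nat ler_pM2l// ltW.
rewrite -(ler_pM2l qR); apply: le_trans dq.
rewrite mulrCA ler_wpM2l// -natrM ler_nat//.
Qed.

(** Off-diagonal pairs are grouped by their difference [h.+1], the order of summation used in Weyl
    differencing. *)
Lemma sum_square_diag (R : realType) (K : nat) (F : nat -> nat -> R) :
  \sum_(i < K.+1) \sum_(j < K.+1) F i j = \sum_(i < K.+1) F i i +
  \sum_(h < K) \sum_(m < K - h) (F (m + h.+1)%N m + F m (m + h.+1)%N).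
Proof.
elim: K => [|K IH].
  by rewrite !big_ord1 big_ord0 addr0.
rewrite big_ord_recr/= [X in _ + X]big_ord_recr/=.
under eq_bigr do rewrite big_ord_recr/=.
rewrite big_split/= IH [X in _ = X + _]big_ord_recr/=.
have -> : \sum_(h < K.+1) \sum_(m < K.+1 - h) (F (m + h.+1)%N m + F m (m + h.+1)%N) =
   \sum_(h < K) \sum_(m < K - h) (F (m + h.+1)%N m + F m (m + h.+1)%N) +
   \sum_(m < K.+1) (F K.+1 m + F m K.+1).
  transitivity (\sum_(h < K.+1) (\sum_(m < K - h) (F (m + h.+1)%N m + F m (m + h.+1)%N) +
      (F K.+1 (K - h)%N + F (K - h)%N K.+1))).
    apply: eq_bigr => h _; rewrite subSn; last by rewrite -ltnS.
    rewrite big_ord_recr/= addnS subnK//; by rewrite -ltnS.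
  rewrite big_split/= big_ord_recr/= subnn big_ord0 addr0; congr (_ + _).
  rewrite [RHS](reindex_inj rev_ord_inj)/=; apply: eq_bigr => i _.
  by rewrite subSS.
rewrite [X in _ = _ + (_ + X)]big_split/=; lra.
Qed.

Section Weyl.
Context {R : realType}.

Definition weyl (P : nat) (s x : R) : R[i] :=
  \sum_(n < (2 * P).+1) expi ((n%:R - P%:R) * x + (n%:R - P%:R) ^+ 2 * s).

(** The geometric sum left at difference [h.+1]; the factor 2 of the differenced square goes into
    the argument, so it is used at [2 * s]. *)
Definition weyl_inner (P : nat) (s : R) (h : nat) : R :=
  nc (\sum_(m < 2 * P - h) expi (m%:R * (h.+1%:R * s))).

Lemma weyl_differencing (P : nat) (s x : R) :
  nc (weyl P s x) ^+ 2 <=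
  (2 * P).+1%:R + 2 * \sum_(h < 2 * P) weyl_inner P (2 * s) h.
Proof.
rewrite nc_sqr_sum.
pose f (n : nat) : R[i] := expi ((n%:R - P%:R) * x + (n%:R - P%:R) ^+ 2 * s).
rewrite (sum_square_diag _ (fun i j => complex.Re (f i * (f j)^*%C))).
apply: lerD.
  rewrite -[X in X%:R]card_ord -sumr_const; apply: ler_sum => i _.
  by rewrite -nc_sqrE nc_expi expr1n.
rewrite mulr_sumr; apply: ler_sum => h _.
have -> : \sum_(m < 2 * P - h) (complex.Re (f (m + h.+1)%N * (f m)^*%C) +
     complex.Re (f m * (f (m + h.+1)%N)^*%C)) =
   2 * complex.Re (\sum_(m < 2 * P - h) (f (m + h.+1)%N * (f m)^*%C)).
  rewrite Re_sum mulr_sumr; apply: eq_bigr => m _.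
  by case: (f _) => a b; case: (f _) => c d /=; ring.
rewrite ler_wpM2l//; apply: le_trans (ler_norm _) _; apply: le_trans (Re_le_nc _) _.
have -> : \sum_(m < 2 * P - h) (f (m + h.+1)%N * (f m)^*%C) =
  expi (h.+1%:R * x + h.+1%:R ^+ 2 * s - 2 * P%:R * h.+1%:R * s) *
  \sum_(m < 2 * P - h) expi (m%:R * (h.+1%:R * (2 * s))).
  rewrite mulr_sumr; apply: eq_bigr => m _; rewrite /f -expiN -!expiD.
  by congr expi; rewrite natrD; ring.
by rewrite ncM nc_expi mul1r.
Qed.

End Weyl.

(** Each dyadic block of 2^m terms contributes at most 1. *)
Lemma harmonic_dyadic (R : realType) (m : nat) :
  \sum_(1 <= v < 2 ^ m) (v%:R : R)^-1 <= m%:R.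
Proof.
elim: m => [|m IH]; first by rewrite expn0 big_geq.
rewrite (@big_cat_nat _ _ _ (2 ^ m))/= ?expn_gt0 ?leq_exp2l//.
rewrite -[leRHS]natr1 lerD//.
apply: (@le_trans _ _ (\sum_(2 ^ m <= v < 2 ^ m.+1) ((2 ^ m)%:R : R)^-1)).
  apply: ler_sum_nat => v /andP[v1 _].
  have p0 : (0 < 2 ^ m)%N by rewrite expn_gt0.
  by rewrite lef_pV2 ?posrE ?ltr0n ?ler_nat// (leq_trans p0).
by rewrite sumr_const_nat expnS mul2n -addnn addnK -[X in X <= _]mulr_natr mulVf// pnatr_eq0 expn_eq0.
Qed.

Section ArcSum.
Context {R : realType}.

(** Indices with [l h] >= 2^m contribute at most 8P / 2^m each; the others are sorted by the value v
    of [l h], and the sum of 1/v over v < 2^m is at most m. Truncating at a free height 2^m, instead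
    of at the largest possible value 8P, replaces log P by m. *)
Lemma arc_sum (n P nu m : nat) (T : 'I_n -> R) (l : 'I_n -> nat) :
  (forall h, 0 <= T h) -> (forall h, T h <= 2 * P%:R) ->
  (forall h, T h * (l h)%:R <= 8 * P%:R) ->
  (forall v, (#|[set h | l h == v]| <= 2 * nu)%N) ->
  \sum_h T h <= 8 * n%:R * P%:R / 2 ^+ m + 2 * nu%:R * (2 * P%:R + 8 * P%:R * m%:R).
Proof.
move=> T0 T1 T2 Tc.
have e0 : 0 < 2 ^+ m :> R by rewrite exprn_gt0.
rewrite (bigID (fun h => (2 ^ m <= l h)%N))/=; apply: lerD.
  apply: (@le_trans _ _ (\sum_(h < n) 8 * P%:R / 2 ^+ m)).
    rewrite [X in X <= _]big_mkcond/=; apply: ler_sum => h _; case: ifPn => [H|_].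
      rewrite ler_pdivlMr//; apply: le_trans (T2 h); rewrite ler_wpM2l//.
      by rewrite -natrX ler_nat.
    by rewrite divr_ge0 ?(ltW e0)// mulr_ge0.
  rewrite sumr_const card_ord -[X in X <= _]mulr_natr; lra.
have -> : \sum_(h < n | ~~ (2 ^ m <= l h)%N) T h =
   \sum_(0 <= v < 2 ^ m) \sum_(h < n | l h == v) T h.
  rewrite big_mkord (exchange_big_dep xpredT)//= big_mkcond/=; apply: eq_bigr => h _.
  rewrite -ltnNge; case: ifPn => H.
    by rewrite (big_pred1 (Ordinal H))//= => v.
  rewrite big_pred0// => v; apply/negP => /eqP e; move: H; rewrite e.
  by rewrite ltn_ord.
have bd v : \sum_(h < n | l h == v) T h <= 2 * nu%:R * (if v is 0 then 2 * P%:R else 8 * P%:R * v%:R^-1).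
  set c := if v is 0 then _ else _.
  have c0 : 0 <= c by rewrite /c; case: v {c Tc} => [|v]; rewrite !mulr_ge0.
  apply: (@le_trans _ _ (\sum_(h < n | l h == v) c)).
    apply: ler_sum => h /eqP hv; rewrite /c; case: v hv {c c0} => [//|v] hv.
    by rewrite ler_pdivlMr ?ltr0n// -hv.
  rewrite sumr_const -[X in X <= _]mulr_natl ler_wpM2r// -natrM ler_nat.
  by apply: leq_trans (Tc v); rewrite cardsE.
apply: le_trans (ler_sum _ (fun v _ => bd v)) _.
rewrite -mulr_sumr ler_wpM2l ?mulr_ge0//.
rewrite big_ltn ?expn_gt0// lerD2l.
apply: (@le_trans _ _ (8 * P%:R * \sum_(1 <= v < 2 ^ m) (v%:R : R)^-1)).
  by rewrite mulr_sumr; apply: ler_sum_nat => -[|v].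
by rewrite ler_wpM2l ?mulr_ge0// harmonic_dyadic.
Qed.

End ArcSum.

Section Inverse.
Context {R : realType}.
Implicit Types (s : R).

Definition fpart s : R := s - (Num.floor s)%:~R.

Lemma fpart_itv s : 0 <= fpart s < 1.
Proof. by rewrite /fpart subr_ge0 ge_floor/= ltrBlDl -intrD1 lt_succ_floor. Qed.

Lemma weyl_inner_ge0 P s h : 0 <= weyl_inner P s h.
Proof. exact: nc_ge0. Qed.

Lemma weyl_inner_le P s h : weyl_inner P s h <= 2 * P%:R.
Proof.
apply: le_trans (nc_sum _ _ _) _; under eq_bigr do rewrite nc_expi.
by rewrite sumr_const card_ord -natrM ler_nat leq_subr.
Qed.

(** The circle is cut into 8P arcs of length 1/(8P), the window that [rational_approx] accepts. *)
Definition arc (P : nat) s (h : nat) : nat := Num.truncn (8 * P%:R * fpart (h.+1%:R * s)).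

Lemma arcP P s h : (0 < P)%N ->
  [/\ (arc P s h)%:R <= 8 * P%:R * fpart (h.+1%:R * s),
      8 * P%:R * fpart (h.+1%:R * s) < (arc P s h).+1%:R & (arc P s h < 8 * P)%N].
Proof.
move=> P0; have PR : 0 < P%:R :> R by rewrite ltr0n.
have /andP[f0 f1] := fpart_itv (h.+1%:R * s).
have /andP[t0 t1] : (arc P s h)%:R <= 8 * P%:R * fpart (h.+1%:R * s) < (arc P s h).+1%:R.
  by apply: truncn_itv; rewrite !mulr_ge0.
split => //; rewrite -(@ltr_nat R) natrM; apply: le_lt_trans t0 _.
by rewrite gtr_pMr// mulr_gt0.
Qed.

(** A point of the arc numbered v is at distance at least min(v, 8P - v - 1) / (8P) from the
    integers; [geom_expi] converts this into decay. *)
Lemma weyl_inner_arc P s h : (0 < P)%N ->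
  weyl_inner P s h * (minn (arc P s h) (8 * P - (arc P s h).+1))%:R <= 8 * P%:R.
Proof.
move=> P0; have PR : 0 < P%:R :> R by rewrite ltr0n.
have [b1 b2 b3] := arcP s h P0; have /andP[f0 f1] := fpart_itv (h.+1%:R * s).
have tE : h.+1%:R * s = (Num.floor (h.+1%:R * s))%:~R + fpart (h.+1%:R * s) by rewrite /fpart addrC subrK.
have := @geom_expi R (2 * P - h) _ _ _ tE; rewrite f0 ltW// => /(_ isT).
rewrite -/(weyl_inner P s h) => H.
have W0 := weyl_inner_ge0 P s h.
set f := fpart _ in H b1 b2 f0 f1 *.
have : (minn (arc P s h) (8 * P - (arc P s h).+1))%:R <= 8 * P%:R * Num.min f (1 - f).
  rewrite minEle; case: ifPn => _.
    by apply: le_trans b1; rewrite ler_nat geq_minl.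
  apply: (@le_trans _ _ (8 * P - (arc P s h).+1)%:R); first by rewrite ler_nat geq_minr.
  rewrite natrB// natrM; move: b2; lra.
move=> /(ler_wpM2l W0) /le_trans; apply.
rewrite mulrCA ler_piMr ?mulr_ge0//.
Qed.

(** If the Weyl sum is at least P / 4^l, the inner sums cannot all be small, so some arc contains nu
    >= P / (464 * 32^l) of the points (h + 1) 2s. Many multiples of 2s in one short arc force a
    rational approximation of 2s with denominator about P / nu. *)
Lemma weyl_inverse (P l : nat) s x : (0 < P)%N ->
  P%:R ^+ 2 <= 16 ^+ l * nc (weyl P s x) ^+ 2 ->
  (P <= 928 * 32 ^ l)%N \/ exists (q : nat) (b : int),
   [/\ (0 < q)%N, (q <= 1856 * 32 ^ l)%N &
    `|q%:R * (2 * s) - b%:~R| * P%:R ^+ 2 <= 116 * 32 ^+ l].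
Proof.
move=> P0 H; have PR : 0 < P%:R :> R by rewrite ltr0n.
have [?|PL] := leqP P (928 * 32 ^ l)%N; [by left|right].
pose A (b : 'I_(8 * P)) := [set h : 'I_(2 * P) | arc P (2 * s) h == b].
have I0 : (0 < #|'I_(8 * P)|)%N by rewrite card_ord; lia.
have [b0 b0E] := @bigop.eq_bigmax _ (fun b => #|A b|) I0.
set nu := #|A b0| in b0E.
have Ab (b : 'I_(8 * P)) : (#|A b| <= nu)%N.
  by rewrite -b0E (@bigop.leq_bigmax _ (fun b => #|A b|)).
(* Height 2^(4l + 7) = 128 * 16^l makes the truncated part at most P^2 / (8 * 16^l), which the
   hypothesis absorbs. *)
have S := @arc_sum R (2 * P) P nu (4 * l + 7) (weyl_inner P (2 * s))
  (fun h => minn (arc P (2 * s) h) (8 * P - (arc P (2 * s) h).+1)).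
have {}S := S (fun h => weyl_inner_ge0 _ _ _) (fun h => weyl_inner_le _ _ _)
  (fun h => weyl_inner_arc _ _ P0).
(* Only the arcs v and 8P - v - 1, symmetric about 0, are at this distance; hence the factor 2. *)
have Sc v : (#|[set h : 'I_(2 * P) | minn (arc P (2 * s) h) (8 * P - (arc P (2 * s) h).+1) == v]| <= 2 * nu)%N.
  have [v8|v8] := ltnP v (8 * P); last first.
    rewrite (_ : [set _ | _] = finset.set0) ?cards0//; apply/setP => h; rewrite !inE.
    have [_ _ h8] := arcP (2 * s) h P0; apply/negbTE; lia.
  have v8' : (8 * P - v.+1 < 8 * P)%N by lia.
  apply: (@leq_trans #|A (Ordinal v8) :|: A (Ordinal v8')|); last first.
    by rewrite (leq_trans (leq_card_setU _ _))//; have := Ab (Ordinal v8); have := Ab (Ordinal v8'); lia.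
  apply: subset_leq_card; apply/fintype.subsetP => h; rewrite !inE /=.
  have [_ _ h8] := arcP (2 * s) h P0; lia.
have {Sc}S := S Sc.
have W := weyl_differencing P s x.
have e16 : 0 < 16 ^+ l :> R by rewrite exprn_gt0.
have e32 : 0 < 32 ^+ l :> R by rewrite exprn_gt0.
have e2 : 1 + l%:R <= 2 ^+ l :> R by rewrite -natrX nat1r ler_nat ltn_expl.
have E32 : 32 ^+ l = 16 ^+ l * 2 ^+ l :> R by rewrite -exprMn -natrM.
have PL' : 928 * 32 ^+ l < P%:R :> R by rewrite -natrX -natrM ltr_nat.
have E2 : 2 ^+ (4 * l + 7) = 128 * 16 ^+ l :> R.
  by rewrite exprD exprM -!natrX mulrC.
(* The hypothesis gives P^2 <= 3 * 16^l P + P^2 / 4 + 2 * 16^l nu P (116 + 64 l). The first term is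
   at most P^2 / 4 since P > 928 * 32^l, and 16^l (116 + 64 l) <= 116 * 32^l; what remains is P^2 /
   2 <= 232 * 32^l nu P. *)
have nuP : P%:R <= 464 * 32 ^+ l * nu%:R :> R.
  move: S; rewrite E2 [(4 * l + 7)%:R]natrD [(4 * l)%:R]natrM [(2 * P)%:R]natrM.
  set Sg := \sum_h _ => S.
  set n := nu%:R : R in S *; have n0 : 0 <= n by rewrite /n.
  have {S} : 16 ^+ l * Sg <= P%:R ^+ 2 / 8 + 16 ^+ l * n * P%:R * (4 + 16 * (4 * l%:R + 7)).
    apply: (@le_trans _ _ (16 ^+ l * (8 * (2 * P%:R) * P%:R / (128 * 16 ^+ l) + 2 * n * (2 * P%:R + 8 * P%:R * (4 * l%:R + 7))))).
      by rewrite ler_wpM2l// ltW.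
    rewrite mulrDr; apply: lerD; last by lra.
    rewrite le_eqVlt; apply/orP; left; apply/eqP; field; lra.
  have : 16 ^+ l * nc (weyl P s x) ^+ 2 <= 16 ^+ l * ((2 * P).+1%:R + 2 * Sg) by rewrite ler_wpM2l// ltW.
  have : (2 * P).+1%:R <= 3 * P%:R :> R by rewrite -natrM ler_nat; clear -P0; lia.
  move=> /(ler_wpM2l (ltW e16)).
  have h1 : 16 ^+ l <= 32 ^+ l :> R by rewrite lerXn2r ?nnegrE// ler_nat.
  have : 12 * 16 ^+ l * P%:R <= P%:R ^+ 2 :> R by rewrite expr2 ler_wpM2r ?(ltW PR)//; lra.
  have : 16 ^+ l * n * (4 + 16 * (4 * l%:R + 7)) <= 116 * 32 ^+ l * n.
    have k : 4 + 16 * (4 * l%:R + 7) <= 116 * 2 ^+ l :> R by have := ler0n R l; lra.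
    have := ler_wpM2l (mulr_ge0 (ltW e16) n0) k; rewrite E32; lra.
  move=> /(ler_wpM2r (ltW PR)).
  move: (16 ^+ l) (32 ^+ l) (nc _) (2 * P).+1%:R H {E32 E2 e2 PL' e16 e32 h1} => a c w p H.
  rewrite !expr2 in H * => ? ? ? ? ?.
  rewrite -(ler_pM2l PR); lra.
have nu2 : (1 < nu)%N.
  rewrite ltnNge; apply/negP; rewrite -(ler_nat R) => h.
  have := ler_wpM2l (ltW e32) h; lra.
pose f0 : R := b0%:R / (8 * P%:R).
(* The sample points are (h + 1) 2s, not h 2s; the extra 2s is moved into the origin of the
   window. *)
have [|q [b [q0 qD qb]]] := @rational_approx R P (2 * s) (f0 - 2 * s) (A b0) (fun h => Num.floor (h.+1%:R * (2 * s))) _ nu2.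
  move=> h; rewrite inE => /eqP hb; have [] := arcP (2 * s) h P0; rewrite hb.
  rewrite /fpart; set z := (Num.floor _)%:~R => h1 h2 _.
  have -> : h%:R * (2 * s) - z - (f0 - 2 * s) = (h.+1%:R * (2 * s) - z) - f0.
    by rewrite -natr1; ring.
  have P8 : 0 < 8 * P%:R :> R by rewrite mulr_gt0.
  have u : (8 * P%:R) * f0 = b0%:R by rewrite mulrC divfK// gt_eqF.
  apply/andP; split; first by rewrite subr_ge0 -(ler_pM2l P8) u.
  by rewrite ltrBlDr -(ltr_pM2l P8) [ltRHS]mulrDr u divff ?gt_eqF// nat1r.
have nuN : (nu <= 2 * nu.-1)%N by move: nu2; clearbody nu; clear; case: nu => [|[|n]] //; lia.
have nuR : nu%:R <= 2 * nu.-1%:R :> R by rewrite -natrM ler_nat.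
have nuR0 : 0 < nu%:R :> R by rewrite ltr0n ltnW.
exists q, b; rewrite q0; split => //.
  have : (q * nu <= 4 * P)%N.
    apply: (@leq_trans (q * (2 * nu.-1))); first by rewrite leq_mul2l nuN orbT.
    by rewrite mulnCA -[4%N]/(2 * 2)%N -mulnA leq_mul2l qD.
  rewrite -!(@ler_nat R) !natrM natrX => h.
  rewrite -(ler_pM2r nuR0); lra.
have : `|q%:R * (2 * s) - b%:~R| * (nu%:R * P%:R) <= 4^-1.
  have : `|q%:R * (2 * s) - b%:~R| * nu.-1%:R * P%:R <= 8^-1.
    move: qb => /(ler_wpM2r (ltW PR)) /le_trans; apply; rewrite invfM -mulrA mulVf ?mulr1//.
    by rewrite gt_eqF.
  have : `|q%:R * (2 * s) - b%:~R| * nu%:R <= `|q%:R * (2 * s) - b%:~R| * (2 * nu.-1%:R) by rewrite ler_wpM2l.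
  move=> /(ler_wpM2r (ltW PR)); lra.
set e := `|_| => h.
have e0 : 0 <= e by rewrite /e.
have c0 : 0 <= 464 * 32 ^+ l :> R by apply: mulr_ge0; [exact: ler0n|exact: ltW].
have : e * P%:R * P%:R <= e * P%:R * (464 * 32 ^+ l * nu%:R) by rewrite ler_wpM2l ?mulr_ge0.
have := ler_wpM2r c0 h.
lra.
Qed.

Lemma weyl_inverse_const : exists A : nat, (0 < A)%N /\
  forall (P l : nat) (s x : R), (0 < P)%N ->
  P%:R ^+ 2 <= 16 ^+ l * nc (weyl P s x) ^+ 2 ->
  (P <= A * 32 ^ l)%N \/ exists (q : nat) (b : int),
   [/\ (0 < q)%N, (q <= A * 32 ^ l)%N &
    `|q%:R * (2 * s) - b%:~R| * P%:R ^+ 2 <= A%:R * 32 ^+ l].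
Proof.
exists 1856%N; split => // P l s x P0 /(weyl_inverse P0) [H|[q [b [q0 qA qb]]]].
  by left; apply: leq_trans H _; rewrite leq_mul2r; apply/orP; right.
right; exists q, b; split => //; apply: le_trans qb _.
by apply: ler_wpM2r; [exact: exprn_ge0|rewrite ler_nat].
Qed.

End Inverse.

Lemma card_diam (R : realType) (n : nat) (A : {set 'I_n}) (d : R) : 0 <= d ->
  (forall i j : 'I_n, i \in A -> j \in A -> (i < j)%N -> (j - i)%:R <= d) ->
  #|A|%:R <= d + 1.
Proof.
move=> d0 H; have [->|[x xA]] := set_0Vmem A; first by rewrite cards0 addr_ge0.
pose m0 := [arg min_(i < x in A) (i : nat)].
have [m0A m0P] : m0 \in A /\ forall i, i \in A -> (m0 <= i)%N.
  by rewrite /m0; case: arg_minnP.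
clearbody m0.
have lt i : i \in A -> (i - m0 < (Num.truncn d).+1)%N.
  move=> iA; rewrite ltnS truncn_ge_nat//.
  have [e|ne] := eqVneq i m0; first by rewrite e subnn.
  by rewrite H// ltn_neqAle eq_sym ne m0P.
pose f (i : 'I_n) : 'I_(Num.truncn d).+1 := inord (i - m0).
have finj : {in A &, injective f}.
  move=> i j iA jA /(congr1 (@nat_of_ord _)); rewrite /f !inordK ?lt// => e.
  by apply: val_inj => /=; rewrite -(subnK (m0P _ iA)) e subnK ?m0P.
rewrite -(card_in_imset finj).
apply: (@le_trans _ _ (Num.truncn d).+1%:R).
  by rewrite ler_nat -[X in (_ <= X)%N]card_ord max_card.
by rewrite -natr1 lerD2r truncn_le.
Qed.

Lemma shift_index (z : int) (n b : nat) : (absz z <= n)%N ->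
  (absz (z + n%:Z)%R < (2 * n).+1)%N /\ (absz (z + n%:Z)%R == b) = (z == b%:Z - n%:Z).
Proof. by move=> H; split; [lia|apply/eqP/eqP; lia]. Qed.

Section LevelCount.
Context {R : realType}.

(** By [weyl_inverse], each counted time lies near a point determined by a fraction b/q. One
    fraction accounts for O(32^l M^2 / (q N^2)) slabs, up to O(1); there are O(q) numerators, so q
    cancels, and the O(32^l) denominators give the second factor 32^l. *)
Lemma level_count (C : R) : 1 < C -> exists K : R, 0 < K /\
  forall (alpha : R) (N M l : nat) (t : 'I_(M ^ 2) -> R) (t0 : R) (x : 'I_(M ^ 2) -> R),
  C^-1 < alpha < C -> (0 < N <= M)%N -> 0 <= t0 <= 1 ->
  (forall i : 'I_(M ^ 2), i%:R / M%:R ^+ 2 <= t i <= i.+1%:R / M%:R ^+ 2) ->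
  #|[set i | (2 * N)%:R ^+ 2 <= 16 ^+ l * nc (weyl (2 * N) (alpha * (t i - t0)) (x i)) ^+ 2]|%:R
    * N%:R ^+ 2 <= K * M%:R ^+ 2 * (32 ^+ l) ^+ 2.
Proof.
move=> C1; have [A [A0 weyl_inverse]] := @weyl_inverse_const R; pose Cn := (Num.truncn C).+1.
have CCn : C < Cn%:R by rewrite /Cn; apply: truncnS_gt.
have C0 : 0 < C by apply: lt_trans C1.
have Cn1 : 1 < Cn%:R :> R by apply: lt_trans CCn.
exists (A%:R ^+ 2 + 7 * (A%:R + 1) * Cn%:R * (2 * A%:R + A%:R * C)); split.
  by rewrite addr_gt0 ?exprn_gt0 ?mulr_gt0 ?addr_gt0// ?mulr_gt0// ltr0n.
move=> alpha N M l t t0 x /andP[aC1 aC2] /andP[N0 NM] /andP[t00 t01] ht.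
have [E [E1024 E0]] : exists E : R, (32 ^+ l) ^+ 2 = E /\ 0 <= E.
  by exists ((32 ^+ l) ^+ 2); split; [exact: erefl|exact: sqr_ge0].
rewrite E1024.
set S := [set i | _].
have SP i : (i \in S) = ((2 * N)%:R ^+ 2 <= 16 ^+ l * nc (weyl (2 * N) (alpha * (t i - t0)) (x i)) ^+ 2).
  by rewrite inE.
clearbody S.
have NR : 0 < N%:R :> R by rewrite ltr0n.
have MR : 0 < M%:R :> R by rewrite ltr0n; exact: leq_trans NM.
have NMR : N%:R <= M%:R :> R by rewrite ler_nat.
have M2 : 0 < M%:R ^+ 2 :> R by rewrite exprn_gt0.
have N2 : 0 < N%:R ^+ 2 :> R by rewrite exprn_gt0.
have e32 : 1 <= 32 ^+ l :> R by apply: exprn_ege1; rewrite ler1n.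
have a0 : 0 < alpha by rewrite (lt_trans _ aC1)// invr_gt0.
have cardS : #|S|%:R <= M%:R ^+ 2 :> R.
  by rewrite -natrX ler_nat -[X in (_ <= X)%N]card_ord max_card.
have A0R : 0 < A%:R :> R by rewrite ltr0n.
have S2p : 0 <= 7 * (A%:R + 1) * Cn%:R * (2 * A%:R + A%:R * C) * M%:R ^+ 2 * E.
  by do ?[exact: sqr_ge0 | exact: E0 | exact: ler0n | exact: ltW | apply: mulr_ge0 | apply: addr_ge0].
have S1p : 0 <= A%:R ^+ 2 * M%:R ^+ 2 * E.
  by do ?[exact: sqr_ge0 | exact: E0 | apply: mulr_ge0].
rewrite [in leRHS]mulrDl [leRHS]mulrDl.
(* For small N the trivial count M^2 suffices, since N^2 <= A^2 (32^l)^2. *)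
have [PL|PL] := leqP (2 * N) (A * 32 ^ l)%N.
  rewrite -[leLHS]addr0; apply: lerD => //.
  have h : N%:R <= A%:R * 32 ^+ l :> R.
    by rewrite -natrX -natrM ler_nat; apply: leq_trans PL; rewrite leq_pmull.
  apply: (@le_trans _ _ (M%:R ^+ 2 * (A%:R * 32 ^+ l) ^+ 2)).
    apply: ler_pM => //.
    by rewrite ler_pXn2r// nnegrE; [exact: ltW|apply: mulr_ge0; [exact: ler0n|exact: exprn_ge0]].
  by rewrite -E1024 exprMn le_eqVlt; apply/orP; left; apply/eqP; ring.
rewrite -[leLHS]add0r; apply: lerD => //.
have PLR : A%:R * 32 ^+ l < 2 * N%:R :> R by rewrite -natrX -!natrM ltr_nat.
have PR : 1 <= N%:R :> R by rewrite ler1n.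
pose Q := (A * 32 ^ l)%N.
have bt i : 0 <= t i <= 1.
  have /andP[h1 h2] := ht i; apply/andP; split.
    by apply: le_trans h1; rewrite divr_ge0// ltW.
  apply: le_trans h2 _; rewrite ler_pdivrMr// mul1r -natrX ler_nat.
  exact: ltn_ord.
(* The numerator is bounded by 2 q C + 1 because |t - t0| <= 1 and the approximation error is at
   most 1. *)
have ex i : exists p : nat * int, i \in S ->
   [/\ (0 < p.1)%N, (p.1 <= Q)%N, `|p.1%:R * (2 * (alpha * (t i - t0))) - p.2%:~R| * (2 * N)%:R ^+ 2 <= A%:R * 32 ^+ l
   & (`|p.2| <= 3 * p.1 * Cn)%N].
  have [iS|iS] := boolP (i \in S); last by exists (0%N, 0).
  move: (iS); rewrite SP => /weyl_inverse []; first by rewrite muln_gt0.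
    by rewrite leqNgt PL.
  move=> [q [b [q0 qQ qb]]]; exists (q, b); move=> _; split => //.
  rewrite -(ler_nat R) natr_absz intr_norm !natrM.
  have qb1 : `|q%:R * (2 * (alpha * (t i - t0))) - b%:~R| <= 1.
    have P2 : 0 < (2 * N)%:R ^+ 2 :> R by rewrite exprn_gt0// natrM mulr_gt0.
    rewrite -(ler_pM2r P2); apply: le_trans qb _.
    rewrite mul1r natrM exprMn expr2 -mulrA.
    have : N%:R <= N%:R ^+ 2 :> R by rewrite expr2 ler_peMr// ltW.
    lra.
  have qR : 1 <= q%:R :> R by rewrite ler1n.
  have : `|q%:R * (2 * (alpha * (t i - t0)))| <= q%:R * (2 * Cn%:R).
    rewrite !normrM !normr_nat ler_wpM2l// ler_wpM2l//.
    rewrite (ger0_norm (ltW a0)) -[leRHS]mulr1; apply: ler_pM => //; first exact: ltW.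
      by rewrite ltW// (lt_trans aC2).
    have /andP[? ?] := bt i; rewrite ler_norml; apply/andP; split; lra.
  have : q%:R <= q%:R * Cn%:R :> R by rewrite ler_peMr// ltW.
  move: qb1; rewrite !ler_norml => /andP[h1 h2] h3 /andP[h4 h5].
  by apply/andP; split; lra.
have [f Hf] := choice ex => {ex}.
pose fq i : 'I_Q.+1 := inord (f i).1.
pose K1 := (2 * A%:R + A%:R * C) * 32 ^+ l * M%:R ^+ 2.
have K10 : 0 <= K1.
  by rewrite /K1; do ?[exact: sqr_ge0 | exact: exprn_ge0 | exact: ler0n | exact: ltW | apply: mulr_ge0 | apply: addr_ge0].
have Sqb (q : nat) (b : int) : (0 < q)%N ->
   #|[set i in S | ((f i).1 == q) && ((f i).2 == b)]|%:R * (q%:R * N%:R ^+ 2) <= K1.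
  move=> q0; set Aq := [set i in S | _].
  have [->|[i0 i0A]] := set_0Vmem Aq; first by rewrite cards0 mul0r.
  have qR : 0 < q%:R :> R by rewrite ltr0n.
  have qN : 0 < q%:R * N%:R ^+ 2 :> R by rewrite mulr_gt0.
  have qQ : q%:R <= A%:R * 32 ^+ l :> R.
    move: i0A; rewrite inE => /andP[i0S /andP[/eqP e1 _]].
    have [_ + _ _] := Hf i0 i0S.
    by rewrite e1 /Q -(ler_nat R) natrM natrX.
  (* Two times with the same fraction differ by O(32^l / (q N^2)). The 1 is there because slabs i <
     j only guarantee t_j - t_i >= (j - i - 1) / M^2. *)
  pose d : R := 1 + A%:R * 32 ^+ l * C * M%:R ^+ 2 / (q%:R * N%:R ^+ 2).
  have dq0 : 0 <= A%:R * 32 ^+ l * C * M%:R ^+ 2 / (q%:R * N%:R ^+ 2).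
    apply: divr_ge0; last exact: ltW.
    by do ?[exact: sqr_ge0 | exact: exprn_ge0 | exact: ler0n | exact: ltW | apply: mulr_ge0 | apply: addr_ge0].
  have d0 : 0 <= d by apply: addr_ge0.
  have /(ler_wpM2r (ltW qN)) : #|Aq|%:R <= d + 1.
    apply: card_diam => // i j iA jA ij.
    move: iA jA; rewrite !inE => /andP[iS /andP[/eqP ei1 /eqP ei2]] /andP[jS /andP[/eqP ej1 /eqP ej2]].
    have [_ _ hi _] := Hf i iS; have [_ _ hj _] := Hf j jS.
    rewrite ei1 ei2 in hi; rewrite ej1 ej2 in hj.
    have {hi hj} h : q%:R * (2 * (alpha * (t j - t i))) * (4 * N%:R ^+ 2) <= 2 * A%:R * 32 ^+ l.
      have n2E : (2 * N)%:R ^+ 2 = 4 * N%:R ^+ 2 :> R by rewrite natrM; ring.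
      move: hi hj; rewrite n2E; set n2 := 4 * _.
      have n20 : 0 <= n2 by apply: mulr_ge0 => //; exact: ltW.
      have := ler_norm (q%:R * (2 * (alpha * (t j - t0))) - b%:~R).
      have := lerNnormlW (lexx `|q%:R * (2 * (alpha * (t i - t0))) - b%:~R|).
      move=> /(ler_wpM2r n20) h1 /(ler_wpM2r n20) h2 h3 h4.
      clearbody n2; lra.
    have /andP[_ t1] := ht i; have /andP[t2 _] := ht j.
    have tji : (j%:R - i.+1%:R) / M%:R ^+ 2 <= t j - t i by rewrite mulrBl; lra.
    rewrite natrB ?(ltnW ij)// -lerBlDl.
    have -> : j%:R - i%:R - 1 = j%:R - i.+1%:R :> R by rewrite -[i.+1%:R]natr1; ring.
    have [neg|pos] := lerP (j%:R - i.+1%:R) (0 : R).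
      exact: le_trans neg dq0.
    rewrite ler_pdivlMr//.
    move: tji; rewrite ler_pdivrMr// => tji.
    have aC : 1 <= alpha * C by rewrite -ler_pdivrMr// div1r ltW.
    have tp : 0 <= t j - t i.
      by rewrite -(pmulr_lge0 _ M2); apply: le_trans tji; exact: ltW.
    apply: (@le_trans _ _ ((t j - t i) * M%:R ^+ 2 * (q%:R * N%:R ^+ 2))).
      by apply: ler_wpM2r => //; exact: ltW.
    have : (t j - t i) * (q%:R * N%:R ^+ 2) <= A%:R * 32 ^+ l * C.
      apply: (@le_trans _ _ ((t j - t i) * (q%:R * N%:R ^+ 2) * (alpha * C))).
        by rewrite ler_peMr// mulr_ge0// ltW.
      have : 0 <= A%:R * 32 ^+ l * C by do ?[exact: exprn_ge0 | exact: ler0n | exact: ltW | apply: mulr_ge0].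
      by move: h => /(ler_wpM2r (ltW C0)); lra.
    by move=> /(ler_wpM2r (ltW M2)); lra.
  move/le_trans; apply; rewrite /d /K1.
  have -> : (1 + A%:R * 32 ^+ l * C * M%:R ^+ 2 / (q%:R * N%:R ^+ 2) + 1) * (q%:R * N%:R ^+ 2) =
     2 * (q%:R * N%:R ^+ 2) + A%:R * 32 ^+ l * C * M%:R ^+ 2.
    by field; rewrite !gt_eqF.
  have : q%:R * N%:R ^+ 2 <= A%:R * 32 ^+ l * M%:R ^+ 2 :> R.
    by apply: ler_pM => //; rewrite ?ler_pXn2r// ?nnegrE ltW.
  lra.
have Sq (q : 'I_Q.+1) : #|[set i in S | fq i == q]|%:R * N%:R ^+ 2 <= 7 * Cn%:R * K1.
  have fqE i : i \in S -> (fq i == q) = ((f i).1 == q).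
    move=> iS; have [_ iQ _ _] := Hf i iS.
    by rewrite -val_eqE /= /fq inordK// ltnS.
  have [q0|q0] := posnP q.
    rewrite (_ : [set _ in _ | _] = finset.set0); last first.
      apply/finset.setP => i; rewrite !inE; apply/negbTE; apply/negP => /andP[iS].
      by rewrite fqE// => /eqP e; have [] := Hf i iS; rewrite e q0.
    have p2 := mulr_ge0 (ler0n R Cn) K10.
    rewrite cards0 mul0r; lra.
  (* The numerators are shifted to 0..B; there are B + 1 <= 7 q Cn of them, each responsible for at
     most K1 / q. *)
  pose B := (2 * (3 * q * Cn))%N.
  pose fb i : 'I_B.+1 := inord (absz ((f i).2 + (3 * q * Cn)%N%:Z)).
  have -> : #|[set i in S | fq i == q]|%:R = \sum_(b < B.+1) #|[set i in S | ((f i).1 == q) && ((f i).2 == b%:Z - (3 * q * Cn)%N%:Z)]|%:R :> R.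
    rewrite -natr_sum; congr (_%:R).
    rewrite -sum1_card (partition_big fb xpredT)//=; apply: eq_bigr => b _.
    rewrite -sum1_card; apply: eq_bigl => i; rewrite !inE.
    have [iS|//] := boolP (i \in S); rewrite /=.
    rewrite fqE//; have [e|//] := eqVneq (f i).1 q; rewrite /=.
    have [_ _ _ hb] := Hf i iS; rewrite e in hb.
    have [h1 h2] := shift_index b hb.
    by rewrite -val_eqE /= /fb inordK.
  rewrite mulr_suml.
  have qR : 0 < q%:R :> R by rewrite ltr0n.
  apply: (@le_trans _ _ (\sum_(b < B.+1) K1 / q%:R)).
    by apply: ler_sum => b _; rewrite ler_pdivlMr// -mulrA [_ ^+ 2 * _]mulrC Sqb.
  rewrite sumr_const card_ord -[leLHS]mulr_natr mulrAC ler_pdivrMr//.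
  rewrite mulrC [leRHS]mulrAC; apply: ler_wpM2r => //.
  rewrite /B -natr1 !natrM.
  have : 1 <= q%:R * Cn%:R :> R by rewrite -natrM ler1n muln_gt0 q0.
  lra.
have -> : #|S|%:R = \sum_(q < Q.+1) #|[set i in S | fq i == q]|%:R :> R.
  rewrite -natr_sum; congr (_%:R); rewrite -sum1_card (partition_big fq xpredT)//=.
  apply: eq_bigr => q _; rewrite -sum1_card; apply: eq_bigl => i.
  by rewrite !inE.
rewrite mulr_suml; apply: le_trans (ler_sum _ (fun q _ => Sq q)) _.
rewrite sumr_const card_ord -[leLHS]mulr_natl.
have : Q.+1%:R <= (A%:R + 1) * 32 ^+ l :> R.
  by rewrite -natr1 /Q natrM natrX; lra.
have k0 : 0 <= 7 * Cn%:R * K1 by have p2 := mulr_ge0 (ler0n R Cn) K10; lra.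
move=> /(ler_wpM2r k0) /le_trans; apply.
by rewrite -E1024 /K1 le_eqVlt; apply/orP; left; apply/eqP; ring.
Qed.

End LevelCount.

(** * Large values of the evolution *)

(** Values below 16^-l are charged to S itself, the others to their level sets: level m costs (16 /
    16^m) D 1024^m = 16 D 64^m, and the last level dominates the geometric sum. The cut at l lets
    the first term be absorbed in [large_values]. *)
Lemma dyadic_sum (R : realType) (I : finType) (S : {set I}) (g : I -> R) (D : R) (l : nat) :
  (forall i, g i <= 16) -> 0 <= D ->
  (forall m, #|[set i | 1 <= 16 ^+ m * g i]|%:R <= D * (32 ^+ m) ^+ 2) ->
  \sum_(i in S) g i <= #|S|%:R / 16 ^+ l + 32 * D * 64 ^+ l.
Proof.
move=> g16 D0 gc.
have p16 m : 0 < 16 ^+ m :> R by rewrite exprn_gt0.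
have pw i : g i <= (16 ^+ l)^-1 + \sum_(m < l.+1) (1 <= 16 ^+ m * g i)%R%:R * (16 / 16 ^+ m).
  elim: l => [|l IH].
    rewrite big_ord1 /= !expr0 invr1 mul1r mulr1.
    by have [h|h] := lerP 1 (g i); rewrite ?mul1r ?mul0r ?addr0 ?(ltW h)// (le_trans (g16 i))// lerDr.
  rewrite big_ord_recr/=; set s := \sum_(m < _) _ in IH *.
  have s0 : 0 <= s by apply: sumr_ge0 => m _; rewrite mulr_ge0// divr_ge0// ltW.
  have e : 16 / 16 ^+ l.+1 = (16 ^+ l)^-1 :> R by rewrite exprS invfM mulrA divff ?mul1r.
  have q0 : 0 <= (16 ^+ l.+1)^-1 :> R by rewrite invr_ge0 ltW.
  have [h|h] := lerP 1 (16 ^+ l.+1 * g i).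
    by rewrite mul1r e; lra.
  rewrite mul0r addr0; apply: (@le_trans _ _ (16 ^+ l.+1)^-1); last by lra.
  by rewrite -div1r ler_pdivlMr// mulrC ltW.
apply: le_trans (ler_sum _ (fun i _ => pw i)) _.
rewrite big_split/= sumr_const -[(_^-1) *+ _]mulr_natl lerD2l exchange_big/=.
have bd (m : 'I_l.+1) : \sum_(i in S) (1 <= 16 ^+ m * g i)%R%:R * (16 / 16 ^+ m) <= 16 * D * 64 ^+ m.
  rewrite -mulr_suml.
  have h : \sum_(i in S) (1 <= 16 ^+ m * g i)%R%:R <= D * (32 ^+ m) ^+ 2.
    apply: le_trans (gc m); rewrite -natr_sum ler_nat -sum1_card [leqRHS]big_mkcond/= big_mkcond/=.
    by apply: leq_sum => i _; rewrite inE; case: ifP => // _; case: (1 <= _).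
  apply: le_trans (ler_wpM2r _ h) _; first by rewrite divr_ge0// ltW.
  have -> : (32 ^+ m) ^+ 2 = 16 ^+ m * 64 ^+ m :> R by rewrite -exprM mulnC exprM -exprMn -natrX -natrM.
  rewrite le_eqVlt; apply/orP; left; apply/eqP; field.
  by rewrite gt_eqF.
apply: le_trans (ler_sum _ (fun i _ => bd i)) _.
rewrite -mulr_sumr.
have geo : \sum_(m < l.+1) 64 ^+ m <= 2 * 64 ^+ l :> R.
  elim: (l) => [|k IH]; first by rewrite big_ord1 !expr0; lra.
  rewrite big_ord_recr/= exprS; have : 0 <= 64 ^+ k :> R by rewrite exprn_ge0.
  lra.
have k0 : 0 <= 16 * D by rewrite mulr_ge0.
have := ler_wpM2l k0 geo; lra.
Qed.

Section Halasz.
Context {R : realType}.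

(* Frequencies in {-2N,...,2N}^2, which contains the support of the symbol of P_N. *)
Definition boxT (N : nat) := ('I_(2 * (2 * N)).+1 * 'I_(2 * (2 * N)).+1)%type.

Definition freq N (n : boxT N) : int * int :=
  (n.1%:Z - (2 * N)%N%:Z, n.2%:Z - (2 * N)%N%:Z).

Definition wave (a1 a2 : R) (n : int * int) (t : R) (x : R * R) : R[i] :=
  expi (dot n x + Q a1 a2 n * t).

Definition evol (a1 a2 : R) N (b : boxT N -> R[i]) (t : R) (x : R * R) : R[i] :=
  \sum_n b n * wave a1 a2 (freq n) t x.

Lemma wave_conj a1 a2 n t x t' x' :
  wave a1 a2 n t x * (wave a1 a2 n t' x')^*%C = wave a1 a2 n (t - t') (x.1 - x'.1, x.2 - x'.2).
Proof.
rewrite /wave -expiN -expiD; congr expi; rewrite /dot /=; ring.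
Qed.

(** Both the form Q and the box split into coordinates. *)
Lemma kernel_weyl a1 a2 N t x : \sum_(n : boxT N) wave a1 a2 (freq n) t x =
  weyl (2 * N) (a1 * t) x.1 * weyl (2 * N) (a2 * t) x.2.
Proof.
rewrite /weyl mulr_suml -(pair_bigA _ (fun i j => wave a1 a2 (freq (i, j)) t x))/=.
apply: eq_bigr => i _; rewrite mulr_sumr; apply: eq_bigr => j _.
rewrite -expiD /wave; congr expi.
by rewrite /dot /Q /freq /= !rmorphB/= -!pmulrn; ring.
Qed.

Lemma weyl_le P s x : nc (weyl P s x) <= (2 * P).+1%:R :> R.
Proof.
apply: le_trans (nc_sum _ _ _) _; under eq_bigr do rewrite nc_expi.
by rewrite sumr_const card_ord.
Qed.

(** Duality bounds (|S| v)^2, with v^2 = 25 N^2 B2 / 16^l, by B2 times the sum of the kernel over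
    pairs in S. Each row of that sum is at most 4 N^2 (|S| / 16^l + 32 D 64^l). Since 4 < 25 the
    first term is absorbed, leaving 21 |S| <= 128 D 1024^l. *)
Lemma large_values (C : R) : 1 < C -> exists K : R, 0 < K /\
  forall (a1 a2 : R) (N M l : nat) (b : boxT N -> R[i])
    (t : 'I_(M ^ 2) -> R) (x : 'I_(M ^ 2) -> R * R),
  C^-1 < a1 < C -> C^-1 < a2 < C -> (0 < N <= M)%N ->
  0 < \sum_n nc (b n) ^+ 2 ->
  (forall i : 'I_(M ^ 2), i%:R / M%:R ^+ 2 <= t i <= i.+1%:R / M%:R ^+ 2) ->
  #|[set i | 25 * N%:R ^+ 2 * \sum_n nc (b n) ^+ 2 <= 16 ^+ l * nc (evol a1 a2 b (t i) (x i)) ^+ 2]|%:R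
    * N%:R ^+ 2 <= K * M%:R ^+ 2 * (32 ^+ l) ^+ 2.
Proof.
move=> C1; have [K [K0 HK]] := level_count C1.
exists (7 * K); split; first by rewrite mulr_gt0.
move=> a1 a2 N M l b t x ha1 ha2 NM B0 ht.
set B2 := \sum_n _ in B0 *; set S := [set i | _].
have SP i : i \in S -> 25 * N%:R ^+ 2 * B2 <= 16 ^+ l * nc (evol a1 a2 b (t i) (x i)) ^+ 2.
  by rewrite inE.
clearbody S.
have /andP[N0 NMl] := NM.
have NR : 0 < N%:R :> R by rewrite ltr0n.
have N2 : 0 < N%:R ^+ 2 :> R by rewrite exprn_gt0.
have M2 : 0 < M%:R ^+ 2 :> R by rewrite exprn_gt0// ltr0n; exact: leq_trans NMl.
have e16 : 0 < 16 ^+ l :> R by rewrite exprn_gt0.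
have t01 i : 0 <= t i <= 1.
  have /andP[h1 h2] := ht i; apply/andP; split.
    by apply: le_trans h1; rewrite divr_ge0// ltW.
  apply: le_trans h2 _; rewrite ler_pdivrMr// mul1r -natrX ler_nat.
  exact: ltn_ord.
pose D := K * M%:R ^+ 2 / N%:R ^+ 2.
have D0 : 0 <= D by rewrite divr_ge0 ?(ltW N2)// mulr_ge0// ltW.
have WS a (y : 'I_(M ^ 2) -> R) j : C^-1 < a < C ->
   \sum_(i in S) nc (weyl (2 * N) (a * (t i - t j)) (y i)) ^+ 2 <=
   (4 * N%:R ^+ 2) * (#|S|%:R / 16 ^+ l + 32 * D * 64 ^+ l).
  move=> ha; have P2 : 0 < (2 * N)%:R ^+ 2 :> R by rewrite exprn_gt0// natrM mulr_gt0.
  have E4 : (2 * N)%:R ^+ 2 = 4 * N%:R ^+ 2 :> R by rewrite natrM; ring.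
  rewrite -E4 -ler_pdivrMl// mulr_sumr; apply: dyadic_sum => //.
    move=> i; rewrite ler_pdivrMl//.
    apply: (@le_trans _ _ ((4 * (2 * N)%:R) ^+ 2)).
      rewrite ler_pXn2r ?nnegrE ?nc_ge0//.
      by apply: le_trans (weyl_le _ _ _) _; rewrite -natrM ler_nat; clear -N0; lia.
    by rewrite exprMn mulrC le_eqVlt; apply/orP; left; apply/eqP; ring.
  move=> m; have := HK a N M m t (t j) y ha NM (t01 j) ht.
  rewrite -ler_pdivlMr// => h; apply: (le_trans _ (le_trans h _)).
    rewrite ler_nat; apply: subset_leq_card; apply/fintype.subsetP => i; rewrite !inE.
    by rewrite mulrCA ler_pdivlMl// mulr1.
  by rewrite /D le_eqVlt; apply/orP; left; apply/eqP; ring.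
pose u i := evol a1 a2 b (t i) (x i).
(* Unimodular z_i with z_i u_i = |u_i|, which turn the sum of the |u_i| over S into a
   linear functional of b. *)
pose z i : R[i] := if u i == 0 then 1 else (u i)^*%C / Complex (nc (u i)) 0.
have zu i : z i * u i = Complex (nc (u i)) 0.
  rewrite /z; case: eqVneq => [->|ui0]; first by rewrite mulr0 nc0.
  have n0 : nc (u i) != 0 by apply: contra_neq ui0 => /nc_eq0.
  have -> : (u i)^*%C / Complex (nc (u i)) 0 * u i = u i * (u i)^*%C / Complex (nc (u i)) 0.
    by rewrite mulrAC [_^*%C * _]mulrC.
  have -> : u i * (u i)^*%C = Complex (nc (u i)) 0 * Complex (nc (u i)) 0.
    have := nc_sqr (u i); case: (u i) => p q /=; set w := Num.sqrt _ => w2.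
    by apply/eqP; rewrite eq_complex /=; apply/andP; split; apply/eqP; [transitivity (w ^+ 2); [rewrite w2|]|]; ring.
  by rewrite mulfK//; apply: contra_neq n0 => -[].
have z1 i : nc (z i) = 1.
  have := congr1 (fun w : R[i] => nc w) (zu i); rewrite ncM nc_real ger0_norm ?nc_ge0//.
  have [u0 _|ui0] := eqVneq (u i) 0; first by rewrite /z u0 eqxx nc1.
  have n0 : nc (u i) != 0 by apply: contra_neq ui0 => /nc_eq0.
  by move=> h; apply: (mulIf n0); rewrite h mul1r.
pose v := 5 * N%:R * Num.sqrt B2 / 4 ^+ l.
have v0 : 0 <= v by rewrite divr_ge0 ?exprn_ge0// mulr_ge0 ?sqrtr_ge0// mulr_ge0.
have E16 : 16 ^+ l = (4 ^+ l) ^+ 2 :> R by rewrite exprAC; congr (_ ^+ _); rewrite expr2 -natrM.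
have v2 : v ^+ 2 = 25 * N%:R ^+ 2 * B2 / 16 ^+ l.
  rewrite /v !exprMn sqr_sqrtr ?(ltW B0)// exprVn -E16; ring.
have lower : (#|S|%:R * v) ^+ 2 <= (\sum_(i in S) nc (u i)) ^+ 2.
  rewrite ler_pXn2r ?nnegrE//; first last.
  - by apply: sumr_ge0 => i _; exact: nc_ge0.
  - by rewrite mulr_ge0.
  rewrite mulr_natl -sumr_const; apply: ler_sum => i iS.
  rewrite -(@ler_pXn2r _ 2) ?nnegrE ?nc_ge0// v2 ler_pdivrMr//.
  by rewrite [leRHS]mulrC SP.
have upper : (\sum_(i in S) nc (u i)) ^+ 2 <=
    B2 * \sum_(j in S) \sum_(i in S) nc (\sum_(n : boxT N) wave a1 a2 (freq n) (t i - t j) ((x i).1 - (x j).1, (x i).2 - (x j).2)).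
  have -> : \sum_(i in S) nc (u i) = nc (\sum_(n : boxT N) b n * \sum_(i in S) z i * wave a1 a2 (freq n) (t i) (x i)).
    have -> : \sum_(n : boxT N) b n * (\sum_(i in S) z i * wave a1 a2 (freq n) (t i) (x i)) =
       Complex (\sum_(i in S) nc (u i)) 0.
      transitivity (\sum_(i in S) z i * u i).
        rewrite /u /evol; under [RHS]eq_bigr do rewrite mulr_sumr.
        rewrite exchange_big/=; apply: eq_bigr => n _; rewrite mulr_sumr.
        by apply: eq_bigr => i _; rewrite mulrCA.
      under eq_bigr do rewrite zu.
      by apply/eqP; rewrite eq_complex Re_sum Im_sum /= eqxx big1 ?eqxx.
    by rewrite nc_real ger0_norm//; apply: sumr_ge0 => i _; exact: nc_ge0.
  apply: le_trans (cauchy_schwarz_nc _ _ _) _; rewrite ler_wpM2l ?(ltW B0)//.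
  under eq_bigr do rewrite nc_sqr_sum.
  rewrite exchange_big/=; under eq_bigr do rewrite exchange_big/=.
  rewrite exchange_big/=; apply: ler_sum => j _; apply: ler_sum => i _.
  rewrite -Re_sum.
  have -> : \sum_(n : boxT N) (z i * wave a1 a2 (freq n) (t i) (x i) * (z j * wave a1 a2 (freq n) (t j) (x j))^*%C) =
     (z i * (z j)^*%C) * (\sum_(n : boxT N) wave a1 a2 (freq n) (t i - t j) ((x i).1 - (x j).1, (x i).2 - (x j).2)).
    rewrite mulr_sumr; apply: eq_bigr => n _.
    by rewrite rmorphM/= mulrACA wave_conj.
  apply: le_trans (ler_norm _) _; apply: le_trans (Re_le_nc _) _.
  by rewrite !ncM ncJ !z1 !mul1r.
have {upper} upper : (\sum_(i in S) nc (u i)) ^+ 2 <= B2 * (#|S|%:R * ((4 * N%:R ^+ 2) * (#|S|%:R / 16 ^+ l + 32 * D * 64 ^+ l))).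
  apply: le_trans upper _; rewrite ler_wpM2l ?(ltW B0)//.
  rewrite mulr_natl -sumr_const; apply: ler_sum => j _.
  have h1 := WS a1 (fun i => (x i).1 - (x j).1) j ha1.
  have h2 := WS a2 (fun i => (x i).2 - (x j).2) j ha2.
  (* AM-GM separates the two coordinates, so only squares of sums in one variable have to be
     counted. *)
  apply: (@le_trans _ _ (\sum_(i in S) 2^-1 * (nc (weyl (2 * N) (a1 * (t i - t j)) ((x i).1 - (x j).1)) ^+ 2 + nc (weyl (2 * N) (a2 * (t i - t j)) ((x i).2 - (x j).2)) ^+ 2))).
    apply: ler_sum => i _; rewrite kernel_weyl /= ncM.
    set p := nc _; set q := nc _; have := sqr_ge0 (p - q); rewrite sqrrB; lra.
  rewrite -mulr_sumr big_split/=; lra.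
have [S0|S0] := posnP #|S|.
  by rewrite S0 mul0r; do ?[exact: sqr_ge0 | exact: ltW | exact: ler0n | apply: mulr_ge0].
have SR : 0 < #|S|%:R :> R by rewrite ltr0n.
pose c := #|S|%:R * (N%:R ^+ 2 * B2).
have c0 : 0 < c by rewrite mulr_gt0// mulr_gt0.
have e1 : (#|S|%:R * v) ^+ 2 = (#|S|%:R * (25 / 16 ^+ l)) * c by rewrite exprMn v2 /c; ring.
have e2 : B2 * (#|S|%:R * ((4 * N%:R ^+ 2) * (#|S|%:R / 16 ^+ l + 32 * D * 64 ^+ l))) =
   (4 * (#|S|%:R / 16 ^+ l + 32 * D * 64 ^+ l)) * c by rewrite /c; ring.
have := le_trans lower upper; rewrite e1 e2 ler_pM2r// {e1 e2}.
move=> /(ler_wpM2r (ltW e16)) h.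
have {}h : #|S|%:R <= 7 * (D * (32 ^+ l) ^+ 2).
  have E : (32 ^+ l) ^+ 2 = 16 ^+ l * 64 ^+ l :> R by rewrite -exprM mulnC exprM -exprMn -natrX -natrM.
  rewrite E.
  have e1 : #|S|%:R * (25 / 16 ^+ l) * 16 ^+ l = 25 * #|S|%:R :> R by field; rewrite gt_eqF.
  have e2 : 4 * (#|S|%:R / 16 ^+ l + 32 * D * 64 ^+ l) * 16 ^+ l = 4 * #|S|%:R + 128 * (D * (16 ^+ l * 64 ^+ l)) :> R.
    by field; rewrite gt_eqF.
  move: h; rewrite e1 e2.
  have : 0 <= D * (16 ^+ l * 64 ^+ l) by rewrite mulr_ge0// mulr_ge0 ?exprn_ge0.
  lra.
have := ler_wpM2r (ltW N2) h.
have -> : 7 * (D * (32 ^+ l) ^+ 2) * N%:R ^+ 2 = 7 * K * M%:R ^+ 2 * (32 ^+ l) ^+ 2.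
  by rewrite /D; field; rewrite gt_eqF.
by [].
Qed.

End Halasz.

Section Moment.
Context {R : realType}.

Lemma geom_sum_le (r : R) (n : nat) : 0 <= r < 1 -> \sum_(l < n) r ^+ l <= (1 - r)^-1.
Proof.
move=> /andP[r0 r1]; have h : 0 < 1 - r by rewrite subr_gt0.
rewrite -div1r ler_pdivlMr//.
have -> : (\sum_(l < n) r ^+ l) * (1 - r) = 1 - r ^+ n.
  by rewrite -[in RHS](expr1n _ n) subrXX mulrC; congr (_ * _); apply: eq_bigr => i _; rewrite expr1n mul1r.
by rewrite gerBl exprn_ge0.
Qed.

(** As 32^2 = 4^5, the hypothesis is a weak moment of order 5. For p > 5 the level sets sum to a
    geometric series of ratio 4^5 / 4^p, with a bound independent of how many levels occur. *)
Lemma weak_to_strong (p : R) : 5 < p -> exists K : R, 0 < K /\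
  forall (I : finType) (H : I -> R) (D : R), 0 <= D -> (forall i, 0 <= H i <= 1) ->
  (forall l, #|[set i | 1 <= 4 ^+ l * H i]|%:R <= D * (32 ^+ l) ^+ 2) ->
  \sum_i (H i `^ p) <= K * D.
Proof.
move=> p5; pose q : R := 4 `^ p.
have q0 : 0 < q by rewrite powR_gt0.
have q1024 : 32 ^+ 2 < q.
  have -> : 32 ^+ 2 = 4 `^ 5 :> R.
    rewrite powR_mulrn//; transitivity ((2 ^+ 5) ^+ 2 : R); last by rewrite exprAC; congr (_ ^+ _); rewrite expr2 -natrM.
    by congr (_ ^+ _); rewrite -natrX.
  by rewrite /q /powR !gt_eqF// ltr_expR ltr_pM2r// ln_gt0// ltr1n.
pose r := 32 ^+ 2 / q.
have r01 : 0 <= r < 1 by rewrite divr_ge0 ?(ltW q0) ?exprn_ge0//= ltr_pdivrMr// mul1r.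
have r1 : 0 < 1 - r by rewrite subr_gt0; case/andP: r01.
exists (q * (1 - r)^-1); split; first by rewrite mulr_gt0// invr_gt0.
move=> I H D D0 H01 cnt.
have p0 : p != 0 by rewrite gt_eqF// (lt_trans _ p5).
have ex i : exists l : nat, H i != 0 -> 1 <= 4 ^+ l * H i /\ H i `^ p <= q / q ^+ l.
  have [->|Hi0] := eqVneq (H i) 0; first by exists 0%N.
  have /andP[h0 h1] := H01 i; have Hp : 0 < H i by rewrite lt_def Hi0.
  have exl : exists l : nat, 1 <= 4 ^+ l * H i.
    exists (Num.truncn (H i)^-1).+1; rewrite -ler_pdivrMr// div1r.
    apply: le_trans (ltW (truncnS_gt _)) _; rewrite -natrX ler_nat.
    by apply: leq_trans (ltnW (ltn_expl _ (isT : (1 < 4)%N))).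
  (* By minimality 4^l H <= 4 as well, so H^p is at most (4 / 4^l)^p = q / q^l. *)
  case: (ex_minnP exl) => l hl lmin; exists l => _; split => //.
  have lt : 4 ^+ l * H i <= 4.
    case: l hl lmin => [|l] hl lmin; first by rewrite mul1r (le_trans h1)// ler1n.
    rewrite exprS -mulrA ler_piMr// leNgt; apply/negP => h.
    by have := lmin l (ltW h); rewrite ltnn.
  have e4 : 0 < 4 ^+ l :> R by rewrite exprn_gt0.
  rewrite ler_pdivlMr ?exprn_gt0// mulrC.
  have -> : q ^+ l = (4 ^+ l) `^ p.
    by rewrite /q -powR_mulrn ?powR_ge0// -powRrM mulrC powRrM powR_mulrn.
  rewrite -powRM ?exprn_ge0//; apply: ge0_ler_powR => //.
  - by rewrite (le_trans _ (ltW p5)).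
  - by rewrite nnegrE mulr_ge0// ltW.
  - by rewrite nnegrE.
have [f Hf] := choice ex.
pose L := \max_i f i.
have pw i : H i `^ p <= \sum_(l < L.+1) (1 <= 4 ^+ l * H i)%R%:R * (q / q ^+ l).
  have [->|Hi0] := eqVneq (H i) 0.
    rewrite powR0//; apply: sumr_ge0 => l _.
    by rewrite mulr_ge0// divr_ge0 ?exprn_ge0// ltW.
  have [h1 h2] := Hf i Hi0.
  have fL : (f i < L.+1)%N by rewrite ltnS (@bigop.leq_bigmax _ f).
  rewrite (bigD1 (Ordinal fL))//= h1 mul1r -[leLHS]addr0; apply: lerD => //.
  by apply: sumr_ge0 => l _; rewrite mulr_ge0// divr_ge0 ?exprn_ge0// ltW.
apply: le_trans (ler_sum _ (fun i _ => pw i)) _; rewrite exchange_big/=.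
have bd (l : 'I_L.+1) : \sum_i (1 <= 4 ^+ l * H i)%R%:R * (q / q ^+ l) <= D * q * r ^+ l.
  rewrite -mulr_suml -natr_sum.
  have -> : (\sum_i (1 <= 4 ^+ l * H i)%R = #|[set i | (1 <= 4 ^+ l * H i)%R]|)%N.
    by rewrite -sum1_card [RHS]big_mkcond/=; apply: eq_bigr => i _; rewrite inE; case: (1 <= _).
  have qq : 0 <= q / q ^+ l by rewrite divr_ge0 ?exprn_ge0// ltW.
  apply: le_trans (ler_wpM2r qq (cnt l)) _.
  rewrite le_eqVlt; apply/orP; left; apply/eqP.
  by rewrite /r expr_div_n exprAC; ring.
apply: le_trans (ler_sum _ (fun i _ => bd i)) _.
rewrite -mulr_sumr [leRHS]mulrC mulrA ler_wpM2l ?mulr_ge0 ?(ltW q0)//.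
exact: geom_sum_le.
Qed.

Lemma evol_le (a1 a2 : R) N (b : boxT N -> R[i]) t x : (0 < N)%N ->
  nc (evol a1 a2 b t x) <= 5 * N%:R * Num.sqrt (\sum_n nc (b n) ^+ 2).
Proof.
move=> N0; set B2 := \sum_n _.
have B0 : 0 <= B2 by apply: sumr_ge0 => n _; exact: sqr_ge0.
rewrite -(@ler_pXn2r _ 2) ?nnegrE ?nc_ge0// ?mulr_ge0 ?sqrtr_ge0//.
rewrite exprMn sqr_sqrtr//; apply: le_trans (cauchy_schwarz_nc _ _ _) _.
rewrite mulrC ler_wpM2r//.
under eq_bigr do rewrite nc_expi expr1n.
rewrite sumr_const cardT -cardT card_prod card_ord -natrM -natrX ler_nat.
by rewrite -mulnn leq_mul//; lia.
Qed.

(** H i is the supremum over slab i of the normalised modulus. In [large_values] the point of each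
    slab is arbitrary, so it may be chosen almost extremal. *)
Lemma sup_norm_moment (C : R) : 1 < C -> exists K : R, 0 < K /\
  forall (a1 a2 : R) (N M : nat) (b : boxT N -> R[i]),
  C^-1 < a1 < C -> C^-1 < a2 < C -> (0 < N <= M)%N ->
  0 < \sum_n nc (b n) ^+ 2 ->
  exists H : 'I_(M ^ 2) -> R, [/\ forall i, 0 <= H i <= 1,
    forall (i : 'I_(M ^ 2)) t x, i%:R / M%:R ^+ 2 <= t <= i.+1%:R / M%:R ^+ 2 ->
     nc (evol a1 a2 b t x) <= 5 * N%:R * Num.sqrt (\sum_n nc (b n) ^+ 2) * H i &
    \sum_i (H i `^ (21 / 4)) <= K * M%:R ^+ 2 / N%:R ^+ 2].
Proof.
move=> C1; have [K1 [K10 HK1]] := large_values C1.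
have [|K2 [K20 HK2]] := @weak_to_strong (21 / 4); first by lra.
exists (K2 * K1 * 32 ^+ 2); split; first by rewrite mulr_gt0 ?mulr_gt0// exprn_gt0.
move=> a1 a2 N M b ha1 ha2 NM B0; set B2 := \sum_n _ in B0 *.
have /andP[N0 NMl] := NM.
have NR : 0 < N%:R :> R by rewrite ltr0n.
have M2 : 0 < M%:R ^+ 2 :> R by rewrite exprn_gt0// ltr0n; exact: leq_trans NMl.
pose v : R := 5 * N%:R * Num.sqrt B2.
have v0 : 0 < v by rewrite mulr_gt0 ?sqrtr_gt0// mulr_gt0.
have v2 : v ^+ 2 = 25 * N%:R ^+ 2 * B2 by rewrite /v !exprMn sqr_sqrtr ?(ltW B0)//; ring.
pose V (i : 'I_(M ^ 2)) : set R := [set y | exists t x,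
   i%:R / M%:R ^+ 2 <= t <= i.+1%:R / M%:R ^+ 2 /\ y = nc (evol a1 a2 b t x) / v]%classic.
have itv (i : 'I_(M ^ 2)) : i%:R / M%:R ^+ 2 <= (i%:R / M%:R ^+ 2 : R) <= i.+1%:R / M%:R ^+ 2.
  by rewrite lexx/= ler_pM2r ?invr_gt0// ler_nat.
have Vub i y : V i y -> y <= 1.
  move=> [t [x [_ ->]]]; rewrite ler_pdivrMr// mul1r; exact: evol_le.
have Vsup i : has_sup (V i).
  split; first by exists (nc (evol a1 a2 b (i%:R / M%:R ^+ 2) (0, 0)) / v), (i%:R / M%:R ^+ 2), (0, 0).
  by exists 1 => y; exact: Vub.
have Vle (i : 'I_(M ^ 2)) t x : i%:R / M%:R ^+ 2 <= t <= i.+1%:R / M%:R ^+ 2 -> nc (evol a1 a2 b t x) / v <= sup (V i).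
  by move=> ht; apply: ub_le_sup; [exact: (Vsup i).2|exists t, x].
have H01 i : 0 <= sup (V i) <= 1.
  apply/andP; split.
    by apply: le_trans (Vle i _ (0, 0) (itv i)); rewrite divr_ge0 ?nc_ge0// ltW.
  by apply: ge_sup; [exact: (Vsup i).1|move=> y; exact: Vub].
exists (fun i => sup (V i)); split => //.
  by move=> i t x ht; rewrite -/v mulrC -ler_pdivrMr//; exact: Vle.
have -> : K2 * K1 * 32 ^+ 2 * M%:R ^+ 2 / N%:R ^+ 2 = K2 * (K1 * 32 ^+ 2 * M%:R ^+ 2 / N%:R ^+ 2) by ring.
apply: HK2 => //.
  by do ?[exact: sqr_ge0 | exact: ltW | apply: divr_ge0 | apply: mulr_ge0].
move=> l.
(* The supremum is only approached: the chosen point loses a factor 4, hence level [l.+1] and the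
   extra 32^2 in the constant. *)
have ex (i : 'I_(M ^ 2)) : exists tx : R * (R * R), i%:R / M%:R ^+ 2 <= tx.1 <= i.+1%:R / M%:R ^+ 2 /\
   (1 <= 4 ^+ l * sup (V i) -> v <= 4 ^+ l.+1 * nc (evol a1 a2 b tx.1 tx.2)).
  have [h|h] := lerP 1 (4 ^+ l * sup (V i)); last by exists (i%:R / M%:R ^+ 2, (0, 0)).
  have e4 : 0 < 4 ^+ l :> R by rewrite exprn_gt0.
  have : (4 ^+ l.+1)^-1 < sup (V i).
    rewrite -div1r ltr_pdivrMr ?exprn_gt0// exprS mulrC -mulrA; lra.
  move=> /(sup_gt (Vsup i).1) [y [t [x [ht ->]]] hy].
  exists (t, x); split => // _ /=.
  move: hy; rewrite ltr_pdivlMr// -ltr_pdivlMl ?invr_gt0 ?exprn_gt0// invrK.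
  exact: ltW.
have [tx Htx] := choice ex.
have := HK1 a1 a2 N M l.+1 b (fun i => (tx i).1) (fun i => (tx i).2) ha1 ha2 NM B0 (fun i => (Htx i).1).
rewrite -ler_pdivlMr ?exprn_gt0// => h; apply: le_trans (le_trans h _).
  rewrite ler_nat; apply: subset_leq_card; apply/fintype.subsetP => i; rewrite !inE.
  move=> /(proj2 (Htx i)) hv.
  have E16 : 16 ^+ l.+1 = (4 ^+ l.+1) ^+ 2 :> R by rewrite exprAC; congr (_ ^+ _); rewrite expr2 -natrM.
  rewrite -v2 E16 -exprMn ler_pXn2r// ?nnegrE ?(ltW v0)// mulr_ge0 ?nc_ge0// exprn_ge0//.
rewrite le_eqVlt; apply/orP; left; apply/eqP; rewrite [32 ^+ l.+1]exprS; ring.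
Qed.

End Moment.

Local Open Scope classical_set_scope.
Local Open Scope ring_scope.

(** * Integrals of trigonometric polynomials *)

Section Integral.
Local Open Scope ereal_scope.

(* [schrodinger] is a choice of representative for each time, so the left-hand
   integrand of the theorem need not be measurable in space-time. *)
Lemma ge0_le_integral_nonmeasurable d (T : measurableType d) (R : realType)
  (mu : {measure set T -> \bar R}) (D E : set T) (f g : T -> \bar R) :
  (forall x, D x -> 0 <= f x) -> (forall x, E x -> 0 <= g x) ->
  (forall x, D x -> E x /\ f x <= g x) ->
  \int[mu]_(x in D) f x <= \int[mu]_(x in E) g x.
Proof.
move=> f0 g0 fg; rewrite !ge0_integralE//; apply: le_ereal_sup => _ [h /= hf <-].
exists h => //= x; apply: le_trans (hf x) _; rewrite /patch.
case: ifPn => [/set_mem Dx|_]; first by have [Ex le] := fg x Dx; rewrite mem_set.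
by case: ifPn => // /set_mem /g0.
Qed.

Lemma tonelli_setX d1 d2 (T1 : measurableType d1) (T2 : measurableType d2) (R : realType)
  (m1 : {sigma_finite_measure set T1 -> \bar R}) (m2 : {sigma_finite_measure set T2 -> \bar R})
  (A : set T1) (B : set T2) (f : T1 * T2 -> \bar R) :
  measurable A -> measurable B -> measurable_fun [set: T1 * T2] f ->
  (forall z, 0 <= f z) ->
  \int[m1 \x m2]_(z in A `*` B) f z = \int[m1]_(x in A) \int[m2]_(y in B) f (x, y).
Proof.
move=> mA mB mf f0; rewrite integral_mkcond fubini_tonelli1; first last.
- by move=> z; rewrite /patch; case: ifP.
- apply/(measurable_restrictT _ _).1; first exact: measurableX.
  exact: measurable_funTS.
rewrite [RHS]integral_mkcond; apply: eq_integral => x _.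
rewrite /fubini_F /patch; case: ifPn => xA.
  rewrite [RHS]integral_mkcond; apply: eq_integral => y _.
  by rewrite /patch in_setX xA.
by rewrite integral0_eq// => y _; rewrite in_setX (negbTE xA).
Qed.

End Integral.

Section TrigIntegral.
Context {R : realType}.
Local Notation mu := (@lebesgue_measure R).

Lemma FTC_is_derive (F f : R -> R) (a b : R) : a < b ->
  (forall x, is_derive x (1 : R) F (f x)) -> continuous f ->
  (\int[mu]_(x in `[a, b]) (f x)%:E = (F b - F a)%:E)%E.
Proof.
move=> ab dF cf.
have cF x : {for x, continuous F}.
  by apply: differentiable_continuous; apply/derivable1_diffP; apply: ex_derive.
rewrite (@continuous_FTC2 _ f F)//.
- exact: continuous_subspaceT.
- split.
  + by move=> x _; apply: ex_derive.
  + by apply: cvg_at_right_filter; exact: cF.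
  + by apply: cvg_at_left_filter; exact: cF.
- by move=> x _; rewrite derive1E; apply: derive_val.
Qed.

Lemma is_derive_bigsum (I : Type) (s : seq I) (P : pred I) (F f : I -> R -> R) (x : R) :
  (forall p, is_derive x (1 : R) (F p) (f p x)) ->
  is_derive x (1 : R) (fun y => \sum_(p <- s | P p) F p y) (\sum_(p <- s | P p) f p x).
Proof.
move=> dF; elim: s => [|p s IH].
  rewrite big_nil; rewrite [X in is_derive _ _ X _](_ : _ = cst 0); first exact: is_derive_cst.
  by apply/funext => y; rewrite big_nil.
rewrite big_cons; case: ifPn => Pp.
  rewrite [X in is_derive _ _ X _](_ : _ = F p \+ (fun y => \sum_(p <- s | P p) F p y)).
    exact: is_deriveD.
  by apply/funext => y; rewrite big_cons Pp.
rewrite [X in is_derive _ _ X _](_ : _ = (fun y => \sum_(p <- s | P p) F p y))//.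
by apply/funext => y; rewrite big_cons (negbTE Pp).
Qed.

Lemma continuous_bigsum (I : Type) (s : seq I) (P : pred I) (f : I -> R -> R) :
  (forall p, continuous (f p)) -> continuous (fun y => \sum_(p <- s | P p) f p y).
Proof.
move=> cf; elim: s => [|p s IH].
  rewrite (_ : (fun _ => _) = cst 0); first exact: cst_continuous.
  by apply/funext => y; rewrite big_nil.
have [Pp|Pp] := boolP (P p).
  rewrite (_ : (fun _ => _) = (fun y => f p y + \sum_(p <- s | P p) f p y)).
    by move=> x; apply: cvgD; [exact: cf|exact: IH].
  by apply/funext => y; rewrite big_cons Pp.
rewrite (_ : (fun _ => _) = (fun y => \sum_(p <- s | P p) f p y))//.
by apply/funext => y; rewrite big_cons (negbTE Pp).
Qed.

Lemma is_derive_affine (a b x : R) : is_derive x (1 : R) (fun y => a * y + b) a.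
Proof.
have -> : (fun y : R => a * y + b) = (a *: @id R) + cst b by apply/funext => y.
by apply: is_derive_eq; rewrite addr0 /GRing.scale /= mulr1.
Qed.

Lemma is_derive_cos_affine (a b x : R) :
  is_derive x (1 : R) (fun y => cos (a * y + b)) (- a * sin (a * x + b)).
Proof.
have := @is_derive1_comp R cos (fun y => a * y + b) x _ _ (is_derive_cos _) (is_derive_affine a b x).
by rewrite mulrC mulrN mulNr.
Qed.

Lemma is_derive_sin_affine (a b x : R) :
  is_derive x (1 : R) (fun y => sin (a * y + b)) (a * cos (a * x + b)).
Proof.
have := @is_derive1_comp R sin (fun y => a * y + b) x _ _ (is_derive_sin _) (is_derive_affine a b x).
by rewrite mulrC.
Qed.

Lemma continuous_cos_affine (a b : R) : continuous (fun y => cos (a * y + b)).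
Proof.
move=> x; apply: differentiable_continuous; apply/derivable1_diffP.
by apply: ex_derive; exact: is_derive_cos_affine.
Qed.

Lemma sin_2piz (z : int) (th : R) : sin (2 * pi * z%:~R + th) = sin th.
Proof.
have := @expi_int R z; rewrite /expi => e; have c := congr1 (@complex.Re R) e; have s := congr1 (@complex.Im R) e.
rewrite /= in c s.
by rewrite sinD c s mul0r mul1r add0r.
Qed.

(** Orthogonality of the exponentials in real form: a phase [th] of 0 or pi/2 gives real or
    imaginary parts, and a phase may also carry the other variable of a double integral. *)
Lemma integral_unit_cos (I : finType) (P : pred I) (ka th : I -> R) (m : I -> int) :
  (\int[mu]_(y in `[0%R, 1%R]) (\sum_(p | P p) ka p * cos (2 * pi * (m p)%:~R * y + th p))%:E =
  (\sum_(p | P p && (m p == 0)) ka p * cos (th p))%:E)%E.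
Proof.
pose F p y : R := ka p * (if m p == 0 then cos (th p) * y else sin (2 * pi * (m p)%:~R * y + th p) / (2 * pi * (m p)%:~R)).
have dF (x : R) : is_derive x (1 : R) (fun y => \sum_(p | P p) F p y)
    (\sum_(p | P p) ka p * cos (2 * pi * (m p)%:~R * x + th p)).
  apply: (is_derive_bigsum _ _ (f := fun p y => ka p * cos (2 * pi * (m p)%:~R * y + th p))) => p.
  rewrite /F; have [->|m0] := eqVneq (m p) 0; rewrite /=.
    rewrite (_ : (fun y => _) = ka p * cos (th p) *: id); last first.
      by apply/funext => y; rewrite mulrA.
    by apply: is_derive_eq; rewrite /GRing.scale/= mulr1 mulr0 mul0r add0r.
  set w := 2 * pi * _; have w0 : w != 0.
    by rewrite /w mulf_neq0// ?intr_eq0// mulf_neq0// gt_eqF// pi_gt0.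
  rewrite (_ : (fun y => _) = (ka p / w) *: (fun y => sin (w * y + th p))); last first.
    by apply/funext => y; rewrite /GRing.scale/= mulrA mulrAC.
  have D := is_derive_sin_affine w (th p) x.
  by apply: is_derive_eq; rewrite /GRing.scale/=; field.
have cf : continuous (fun y : R => \sum_(p | P p) ka p * cos (2 * pi * (m p)%:~R * y + th p)).
  apply: continuous_bigsum => p x; apply: cvgM; first exact: cvg_cst.
  exact: continuous_cos_affine.
rewrite (FTC_is_derive ltr01 dF cf).
congr (_%:E); rewrite -sumrB [RHS]big_mkcondr/=; apply: eq_bigr => p Pp.
rewrite /F; case: ifPn => m0; first by rewrite mulr1 mulr0 mulr0 subr0.
by rewrite mulr1 mulr0 add0r sin_2piz subrr.
Qed.

End TrigIntegral.

Section TrigPoly.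
Context {R : realType}.
Local Notation mu := (@lebesgue_measure R).

Lemma measurable_Re_trig d (T : measurableType d) (I : finType) (P : pred I) (b : I -> R[i]) (s : I -> T -> R) :
  (forall p, measurable_fun [set: T] (s p)) ->
  measurable_fun [set: T] (fun z => complex.Re (\sum_(p | P p) b p * expi (s p z))).
Proof.
move=> ms; under eq_fun do rewrite Re_sum.
under eq_fun do rewrite big_mkcond/=.
apply: measurable_sum => p; case: (P p) => //.
rewrite (_ : (fun _ => _) = (fun z => complex.Re (b p) * cos (2 * pi * s p z) - complex.Im (b p) * sin (2 * pi * s p z))).
  apply: measurable_funB; apply: measurable_funM => //; (apply: measurableT_comp; last by apply: measurable_funM).
    by apply: continuous_measurable_fun; exact: continuous_cos.
  by apply: continuous_measurable_fun; exact: continuous_sin.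
by apply/funext => z; case: (b p).
Qed.

Lemma measurable_Im_trig d (T : measurableType d) (I : finType) (P : pred I) (b : I -> R[i]) (s : I -> T -> R) :
  (forall p, measurable_fun [set: T] (s p)) ->
  measurable_fun [set: T] (fun z => complex.Im (\sum_(p | P p) b p * expi (s p z))).
Proof.
move=> ms.
have := measurable_Re_trig P (fun p => - 'i%C * b p) ms.
congr (measurable_fun _ _); apply/funext => z.
rewrite Re_sum Im_sum; apply: eq_bigr => p _.
by case: (b p) => u v; case: (expi _) => c d' /=; ring.
Qed.

Lemma measurable_nc_trig d (T : measurableType d) (I : finType) (P : pred I) (b : I -> R[i]) (s : I -> T -> R) :
  (forall p, measurable_fun [set: T] (s p)) ->
  measurable_fun [set: T] (fun z => nc (\sum_(p | P p) b p * expi (s p z)) ^+ 2).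
Proof.
move=> ms; under eq_fun do rewrite nc_sqr.
by apply: measurable_funD; apply: measurable_funX; [exact: measurable_Re_trig|exact: measurable_Im_trig].
Qed.

Lemma measurable_dot (n : int * int) : measurable_fun [set: R * R] (dot n : R * R -> R).
Proof. by apply: measurable_funD; apply: measurable_funM. Qed.

Lemma measurable_wave_phase (n : int * int) (q : R) :
  measurable_fun [set: R * (R * R)] (fun tx : R * (R * R) => dot n tx.2 + q * tx.1).
Proof.
apply: measurable_funD; last by apply: measurable_funM.
by apply: (measurableT_comp (measurable_dot n)).
Qed.

Lemma measurable_torus : measurable (torus : set (R * R)).
Proof. by apply: measurableX. Qed.

Lemma integral_torus_cos (J : finType) (ka th : J -> R) (m l : J -> int) :
  (forall x : R * R, 0 <= \sum_q ka q * cos (2 * pi * ((m q)%:~R * x.1 + (l q)%:~R * x.2) + th q)) ->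
  (\int[leb2]_(x in torus) (\sum_q ka q * cos (2 * pi * ((m q)%:~R * x.1 + (l q)%:~R * x.2) + th q))%:E =
  (\sum_(q | (m q == 0) && (l q == 0)) ka q * cos (th q))%:E)%E.
Proof.
move=> f0; rewrite [LHS]tonelli_setX//=; last first.
  apply/measurable_EFinP; apply: measurable_sum => q; apply: measurable_funM => //.
  apply: measurableT_comp; first by apply: continuous_measurable_fun; exact: continuous_cos.
  apply: measurable_funD => //; apply: measurable_funM => //.
  by apply: measurable_funD; apply: measurable_funM.
transitivity (\int[mu]_(x in `[0%R, 1%R]) (\sum_(q | l q == 0%R) ka q * cos (2 * pi * (m q)%:~R * x + th q))%:E)%E.
  apply: eq_integral => x _.
  have := integral_unit_cos xpredT ka (fun q => 2 * pi * (m q)%:~R * x + th q) l.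
  move=> <-; apply: eq_integral => y _; congr (_%:E); apply: eq_bigr => q _.
  by congr (_ * cos _); ring.
rewrite integral_unit_cos; congr (_%:E); apply: eq_bigl => q; exact: andbC.
Qed.

(** Frequencies may repeat: for a product of two sums, indexed by pairs, the coincidences of [nu]
    are the resonances. *)
Lemma plancherel (I : finType) (b : I -> R[i]) (nu : I -> int * int) :
  (\int[leb2]_(x in torus) (nc (\sum_p b p * expi (dot (nu p) x)) ^+ 2)%:E =
  (\sum_p \sum_(p' | nu p' == nu p) complex.Re (b p * (b p')^*%C))%:E)%E.
Proof.
pose J := (I * I * bool)%type.
pose ka (q : J) : R := let z := b q.1.1 * (b q.1.2)^*%C in if q.2 then complex.Im z else complex.Re z.
pose th (q : J) : R := if q.2 then pi / 2 else 0.
pose m (q : J) : int := (nu q.1.1).1 - (nu q.1.2).1.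
pose l (q : J) : int := (nu q.1.1).2 - (nu q.1.2).2.
have E x : nc (\sum_p b p * expi (dot (nu p) x)) ^+ 2 =
   \sum_q ka q * cos (2 * pi * ((m q)%:~R * x.1 + (l q)%:~R * x.2) + th q).
  rewrite nc_sqr_sum pair_bigA /= -(pair_bigA _ (fun p c => ka (p, c) * cos (2 * pi * ((m (p, c))%:~R * x.1 + (l (p, c))%:~R * x.2) + th (p, c))))/=.
  apply: eq_bigr => -[p p'] _; rewrite big_bool /ka /th /m /l /=.
  have -> : b p * expi (dot (nu p) x) * (b p' * expi (dot (nu p') x))^*%C =
    (b p * (b p')^*%C) * expi (((nu p).1 - (nu p').1)%:~R * x.1 + ((nu p).2 - (nu p').2)%:~R * x.2).
    rewrite conjcM mulrACA -expiN -expiD; congr (_ * expi _).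
    by rewrite /dot !rmorphB/=; ring.
  rewrite addr0 cosDpihalf; case: (b p * _) => u v; rewrite /expi /=; ring.
under eq_integral do rewrite E.
rewrite integral_torus_cos; last by move=> x; rewrite -E sqr_ge0.
congr (_%:E).
rewrite [RHS](_ : _ = \sum_p \sum_(p' | nu p' == nu p) \sum_c ka (p, p', c) * cos (th (p, p', c))); last first.
  apply: eq_bigr => p _; apply: eq_bigr => p' _.
  by rewrite big_bool /ka /th /= cos_pihalf cos0 mulr0 add0r mulr1.
rewrite pair_big_dep/= pair_big_dep/= [LHS]big_mkcond/= [RHS]big_mkcond/=.
apply: eq_bigr => -[[p p'] c] _; rewrite /m /l /= andbT !subr_eq0.
by rewrite [nu p' == _]eq_sym -pair_eqE /=.
Qed.

(* The value at time [t] of the integral over the torus of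
   |sum_p b_p e(nu_p.x + la_p t)|^2. *)
Definition energy (I : finType) (b : I -> R[i]) (nu : I -> int * int) (la : I -> R) (t : R) : R :=
  \sum_p \sum_(p' | nu p' == nu p) complex.Re (b p * (b p')^*%C * expi ((la p - la p') * t)).

(** Plancherel is applied in x only. The time frequencies [la] are real, so a weight W is kept in t
    to produce decay in their differences. *)
Lemma spacetime_integral (I : finType) (b : I -> R[i]) (nu : I -> int * int) (la : I -> R)
   (W : R -> R) (D : set R) : measurable D -> measurable_fun setT W -> (forall t, 0 <= W t) ->
  (\int[leb3]_(z in D `*` torus) (W z.1 * nc (\sum_p b p * expi (dot (nu p) z.2 + la p * z.1)) ^+ 2)%:E =
   \int[mu]_(t in D) (W t * energy b nu la t)%:E)%E.
Proof.
move=> mD mW W0; rewrite [LHS]tonelli_setX//=; last 3 first.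
- exact: measurable_torus.
- apply/measurable_EFinP; apply: measurable_funM; first exact: measurableT_comp.
  by apply: measurable_nc_trig => p; exact: measurable_wave_phase.
- by move=> z; rewrite lee_fin mulr_ge0// sqr_ge0.
apply: eq_integral => t _.
under eq_integral do rewrite EFinM.
rewrite ge0_integralZl_EFin//; last 3 first.
- exact: measurable_torus.
- by move=> x _; rewrite lee_fin sqr_ge0.
- apply/measurable_EFinP; apply: measurable_funTS; apply: measurable_nc_trig => p.
  by apply: measurable_funD => //; exact: measurable_dot.
rewrite EFinM; congr (_ * _)%E.
have -> : energy b nu la t = \sum_p \sum_(p' | nu p' == nu p) complex.Re (b p * expi (la p * t) * (b p' * expi (la p' * t))^*%C).
  apply: eq_bigr => p _; apply: eq_bigr => p' _.
  by rewrite conjcM mulrACA -expiN -expiD; congr (complex.Re (_ * expi _)); ring.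
rewrite -plancherel; apply: eq_integral => x _; congr ((nc _ ^+ 2)%:E).
by apply: eq_bigr => p _; rewrite expiD mulrAC mulrA.
Qed.

End TrigPoly.

(** * The bilinear estimate on short time intervals *)

Section Oscillation.
Context {R : realType}.

(** With h(j) = 1 / (y (1 + y j)), the term at distance j + 1 is at most h(j) - h(j + 1); each side
    of m telescopes to at most h(0) = 1/y. *)
Lemma inv_sq_sum_le (y : R) (K m : nat) : 0 < y -> (m < K)%N ->
  \sum_(i < K) ((1 + y * `|m%:R - i%:R|) ^+ 2)^-1 <= 1 + 2 / y.
Proof.
move=> y0 mK; pose h (j : nat) := ((1 + y * j%:R) * y)^-1.
have p j : 0 < 1 + y * j%:R by rewrite ltr_pwDl// mulr_ge0// ltW.
have h0 j : 0 <= h j by rewrite invr_ge0 mulr_ge0// ltW.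
have hS j : ((1 + y * j.+1%:R) ^+ 2)^-1 <= h j - h j.+1.
  have -> : h j - h j.+1 = ((1 + y * j%:R) * (1 + y * j.+1%:R))^-1.
    rewrite /h; have := p j; have := p j.+1; rewrite -natr1 => q1 q2.
    by field; rewrite !gt_eqF.
  rewrite lef_pV2 ?posrE ?exprn_gt0 ?mulr_gt0// expr2 ler_wpM2r ?(ltW (p _))//.
  by rewrite lerD2l ler_wpM2l ?(ltW y0)// ler_nat.
pose f (i : nat) := ((1 + y * `|m%:R - i%:R|) ^+ 2)^-1.
have hy : h 0%N = y^-1 by rewrite /h mulr0 addr0 mul1r.
rewrite -(big_mkord xpredT f) (@big_cat_nat _ _ _ m)//=; last exact: ltnW.
rewrite [X in _ + X](@big_ltn _ _ _ m)//=.
have -> : f m = 1 by rewrite /f subrr normr0 mulr0 addr0 expr1n invr1.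
have s1 : \sum_(0 <= i < m) f i <= y^-1.
  apply: (@le_trans _ _ (\sum_(0 <= i < m) (h (m - i.+1)%N - h (m - i)%N))).
    apply: ler_sum_nat => i /andP[_ im].
    have e : (m - i)%N = (m - i.+1).+1 by lia.
    rewrite e /f -natrB ?(ltnW im)// normr_nat e; exact: hS.
  rewrite (telescope_sumr_eq (fun i => h (m - i)%N))//.
  by rewrite subnn hy gerBl.
have s2 : \sum_(m.+1 <= i < K) f i <= y^-1.
  apply: (@le_trans _ _ (\sum_(m.+1 <= i < K) (- h (i.+1 - m.+1)%N - - h (i - m.+1)%N))).
    apply: ler_sum_nat => i /andP[im _].
    have e : (i - m)%N = (i - m.+1).+1 by lia.
    rewrite /f distrC -natrB ?(ltnW im)// normr_nat subSS e opprK [leRHS]addrC; exact: hS.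
  rewrite (telescope_sumr_eq (fun i => - h (i - m.+1)%N))//.
  by rewrite subnn opprK hy addrC gerBl.
lra.
Qed.

(** Once p and the second index m of p' are fixed, resonance determines p' because [nu1] is
    injective. A row of the matrix is therefore a sum over m alone, with phases spaced by g, and
    [inv_sq_sum_le] bounds it; the weight is symmetric, so AM-GM completes the Schur test. *)
Lemma schur_gap (I1 : finType) (K : nat) (c : I1 -> R[i]) (d : 'I_K -> R[i])
    (nu1 : I1 -> int * int) (nu2 : 'I_K -> int * int) (l1 : I1 -> R) (l2 : 'I_K -> R) (g T : R) :
  0 < g -> 0 < T -> injective nu1 ->
  (forall n n' m m', c n != 0 -> c n' != 0 -> nu1 n + nu2 m = nu1 n' + nu2 m' ->
     g * `|m%:R - m'%:R| <= `|l1 n + l2 m - (l1 n' + l2 m')|) ->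
  \sum_(p : I1 * 'I_K) \sum_(p' : I1 * 'I_K | nu1 p'.1 + nu2 p'.2 == nu1 p.1 + nu2 p.2)
     nc (c p.1 * d p.2) * nc (c p'.1 * d p'.2) / (1 + T * `|l1 p.1 + l2 p.2 - (l1 p'.1 + l2 p'.2)|) ^+ 2
  <= (1 + 2 / (T * g)) * (\sum_n nc (c n) ^+ 2) * (\sum_m nc (d m) ^+ 2).
Proof.
move=> g0 T0 inj1 gap.
pose b (p : I1 * 'I_K) := c p.1 * d p.2; pose nu (p : I1 * 'I_K) := nu1 p.1 + nu2 p.2.
pose la (p : I1 * 'I_K) := l1 p.1 + l2 p.2.
pose w p p' := ((1 + T * `|la p - la p'|) ^+ 2)^-1.
pose q p p' := [&& nu p' == nu p, c p.1 != 0 & c p'.1 != 0].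
have den z : 0 < 1 + T * `|z| by rewrite ltr_pwDl// mulr_ge0// ltW.
have den2 z : 0 < 1 + T * g * `|z| by rewrite ltr_pwDl// mulr_ge0// mulr_ge0// ltW.
have w0 p p' : 0 <= w p p' by rewrite invr_ge0 sqr_ge0.
have wC p p' : w p p' = w p' p by rewrite /w distrC.
have qC p p' : q p p' = q p' p by rewrite /q eq_sym [(c p.1 != 0) && _]andbC.
have inner p : c p.1 != 0 -> \sum_(p' | q p p') w p p' <= 1 + 2 / (T * g).
  move=> cp.
  apply: le_trans (inv_sq_sum_le (mulr_gt0 T0 g0) (ltn_ord p.2)).
  apply: (@le_trans _ _ (\sum_(p' | q p p') ((1 + T * g * `|p.2%:R - p'.2%:R|) ^+ 2)^-1)).
    apply: ler_sum => p' /and3P[/eqP e _ cp'].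
    rewrite lef_pV2 ?posrE ?exprn_gt0//.
    rewrite ler_pXn2r//; [|by rewrite nnegrE ltW|by rewrite nnegrE ltW].
    rewrite lerD2l -mulrA ler_wpM2l ?(ltW T0)//; by apply: gap => //; exact: esym e.
  pose v (m : 'I_K) := ((1 + T * g * `|p.2%:R - m%:R|) ^+ 2)^-1.
  rewrite (partition_big (fun p' : I1 * 'I_K => p'.2) xpredT)//=.
  apply: ler_sum => m _.
  apply: (@le_trans _ _ (\sum_(p' | q p p' && (p'.2 == m)) v m)).
    by apply: ler_sum => p' /andP[_ /eqP ->].
  rewrite sumr_const -[leLHS]mulr_natl ler_piMl//; first by rewrite invr_ge0 sqr_ge0.
  rewrite lern1; apply/card_le1_eqP => -[n1 m1] [n2 m2].
  rewrite ![_ \in _]unfold_in /= => /andP[/and3P[/eqP e1 _ _] /eqP f1] /andP[/and3P[/eqP e2 _ _] /eqP f2].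
  move: e1 e2; rewrite /nu /= f1 f2 => <- /addIr /inj1 ->; done.
apply: (@le_trans _ _ (\sum_p \sum_(p' | q p p') nc (b p) * nc (b p') * w p p')).
  apply: ler_sum => p _; rewrite [X in X <= _]big_mkcond [X in _ <= X]big_mkcond /=.
  apply: ler_sum => p' _; rewrite /q; case: eqP => //= _.
  have [cp|cp] := eqVneq (c p.1) 0; first by rewrite /= cp mul0r nc0 !mul0r.
  have [cp'|cp'] := eqVneq (c p'.1) 0; first by rewrite /= cp' mul0r nc0 mulr0 !mul0r.
  by [].
apply: (@le_trans _ _ (\sum_p \sum_(p' | q p p') (2^-1 * (nc (b p) ^+ 2 * w p p') + 2^-1 * (nc (b p') ^+ 2 * w p p')))).
  apply: ler_sum => p _; apply: ler_sum => p' _.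
  rewrite -mulrDr -mulrDl mulrA ler_wpM2r//.
  have := sqr_ge0 (nc (b p) - nc (b p')); rewrite sqrrB; lra.
under eq_bigr do rewrite big_split/=.
rewrite big_split/=.
have E : \sum_p \sum_(p' | q p p') 2^-1 * (nc (b p') ^+ 2 * w p p') = \sum_p \sum_(p' | q p p') 2^-1 * (nc (b p) ^+ 2 * w p p').
  rewrite (exchange_big_dep xpredT)//=; apply: eq_bigr => p _.
  by apply: eq_big => [p'|p' _]; [rewrite qC|rewrite wC].
rewrite E -big_split/=.
apply: (@le_trans _ _ (\sum_p nc (b p) ^+ 2 * (1 + 2 / (T * g)))).
  apply: ler_sum => p _; rewrite -big_split/=.
  have [cp|cp] := eqVneq (c p.1) 0.
    rewrite big_pred0; first by rewrite mulr_ge0 ?sqr_ge0// addr_ge0// divr_ge0// mulr_ge0// ltW.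
    by move=> p'; rewrite /q cp eqxx /= andbF.
  apply: (@le_trans _ _ (nc (b p) ^+ 2 * \sum_(p' | q p p') w p p')).
    rewrite mulr_sumr le_eqVlt; apply/orP; left; apply/eqP; apply: eq_bigr => p' _; lra.
  by rewrite ler_wpM2l ?sqr_ge0// inner.
rewrite -mulr_suml mulrC -mulrA ler_wpM2l//.
  by rewrite addr_ge0// divr_ge0// mulr_ge0// ltW.
rewrite mulr_suml -(pair_bigA _ (fun n m => nc (b (n, m)) ^+ 2))/=.
rewrite le_eqVlt; apply/orP; left; apply/eqP; apply: eq_bigr => n _.
by rewrite mulr_sumr; apply: eq_bigr => m _; rewrite /b ncM exprMn.
Qed.

End Oscillation.

Section LocalBilinear.
Context {R : realType}.
Local Notation mu := (@lebesgue_measure R).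

(** The primitive comes from repeated integration by parts. The first boundary terms vanish with the
    parabola, and 2T/w^2 + 4/|w|^3 remains (T = B - A), which is used for T|w| > 1; otherwise the
    mean value theorem gives T^3. Clearing the denominator by (2T|w|)^2 yields 8 T^3 + 16 T^3 = 24
    T^3. *)
Lemma parabola_cos_primitive (A B w th : R) : A < B ->
  exists G : R -> R, (forall t, is_derive t (1 : R) G ((t - A) * (B - t) * cos (w * t + th))) /\
   `|G B - G A| <= 24 * (B - A) ^+ 3 / (1 + (B - A) * `|w|) ^+ 2.
Proof.
move=> AB; set T := B - A; have T0 : 0 < T by rewrite subr_gt0.
have Tw0 : 0 <= T * `|w| by rewrite mulr_ge0// ltW.
have D0 : 0 < (1 + T * `|w|) ^+ 2 by rewrite exprn_gt0// ltr_pwDl.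
have trivial_bound (G : R -> R) : (forall t, is_derive t (1 : R) G ((t - A) * (B - t) * cos (w * t + th))) ->
    `|G B - G A| <= T ^+ 3.
  move=> dG; have cG : {within `[A, B], continuous G}.
    apply: continuous_subspaceT => x.
    by apply: differentiable_continuous; apply/derivable1_diffP; apply: ex_derive.
  have [c] := MVT AB (fun x _ => dG x) cG.
  rewrite in_itv/= => /andP[Ac cB] ->.
  rewrite -/T normrM (ger0_norm (ltW T0)) exprSr ler_wpM2r ?(ltW T0)//.
  rewrite normrM -[leRHS]mulr1; apply: ler_pM => //; last by rewrite ler_norml cos_le1 cos_geN1.
  rewrite ger0_norm; last by rewrite mulr_ge0// subr_ge0 ltW.
  by rewrite expr2; apply: ler_pM; rewrite ?subr_ge0 ?(ltW Ac) ?(ltW cB)// /T; lra.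
have T3 : 0 < T ^+ 3 by rewrite exprn_gt0.
have [w0|w0] := eqVneq w 0.
  pose G (t : R) : R := cos th * ((A + B) / 2 * t ^+ 2 - t ^+ 3 / 3 - A * B * t).
  have dG t : is_derive t (1 : R) G ((t - A) * (B - t) * cos (w * t + th)).
    rewrite w0 mul0r add0r /G.
    have -> : (fun t : R => cos th * ((A + B) / 2 * t ^+ 2 - t ^+ 3 / 3 - A * B * t)) =
       cos th *: (((A + B) / 2) *: ((id : R -> R) * (id : R -> R)) - 3^-1 *: ((id : R -> R) * ((id : R -> R) * (id : R -> R))) - (A * B) *: (id : R -> R)).
      apply/funext => y.
      transitivity (cos th * ((A + B) / 2 * (y * y) - 3^-1 * (y * (y * y)) - A * B * y)); last by [].
      lra.
    apply: is_derive_eq; rewrite /GRing.scale/=; rewrite ?fctE; by field.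
  exists G; split => //.
  rewrite w0 normr0 mulr0 addr0 expr1n divr1; apply: le_trans (trivial_bound _ dG) _; lra.
pose G (t : R) : R := (t - A) * (B - t) * sin (w * t + th) / w + (A + B - 2 * t) * cos (w * t + th) / w ^+ 2
    + 2 * sin (w * t + th) / w ^+ 3.
have dG t : is_derive t (1 : R) G ((t - A) * (B - t) * cos (w * t + th)).
  have dS := is_derive_sin_affine w th t; have dC := is_derive_cos_affine w th t.
  have dB := is_derive_affine (-2) (A + B) t.
  pose S (y : R) := sin (w * y + th); pose Cc (y : R) := cos (w * y + th).
  pose L (y : R) := -2 * y + (A + B).
  have dQ : is_derive t (1 : R) (fun y : R => (y - A) * (B - y)) (A + B - 2 * t).
    have -> : (fun y : R => (y - A) * (B - y)) = (A + B) *: (id : R -> R) - ((id : R -> R) * (id : R -> R)) - cst (A * B).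
      apply/funext => y; transitivity ((A + B) * y - y * y - A * B); last by [].
      lra.
    apply: is_derive_eq; rewrite /GRing.scale/= ?fctE; lra.
  have -> : G = w^-1 *: ((fun y : R => (y - A) * (B - y)) * S) + (w ^+ 2)^-1 *: (L * Cc) + (2 / w ^+ 3) *: S.
    apply/funext => y.
    transitivity (w^-1 * ((y - A) * (B - y) * S y) + (w ^+ 2)^-1 * (L y * Cc y) + (2 / w ^+ 3) * S y); last by [].
    by rewrite /G /S /Cc /L; ring.
  have D := is_deriveD (is_deriveD (is_deriveZ w^-1 (is_deriveM dQ dS)) (is_deriveZ (w ^+ 2)^-1 (is_deriveM dB dC))) (is_deriveZ (2 / w ^+ 3) dS).
  apply: (is_derive_eq D); rewrite /GRing.scale/= /S /L /Cc.
  move: (sin _) (cos _) => s c; clear -w0; field.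
  exact: w0.
exists G; split => //.
have [Tw|Tw] := lerP (T * `|w|) 1.
  apply: le_trans (trivial_bound _ dG) _; rewrite ler_pdivlMr// mulrC ler_wpM2r ?(ltW T3)//.
  have : (1 + T * `|w|) ^+ 2 <= 2 ^+ 2 by rewrite lerXn2r ?nnegrE// ?addr_ge0//; lra.
  lra.
have aw : 0 < `|w| by rewrite normr_gt0.
have bnd : `|G B - G A| <= 2 * T / `|w| ^+ 2 + 4 / `|w| ^+ 3.
  have -> : G B - G A = (- T * cos (w * B + th) - T * cos (w * A + th)) / w ^+ 2 + (2 * sin (w * B + th) - 2 * sin (w * A + th)) / w ^+ 3.
    by rewrite /G /T; ring.
  apply: le_trans (ler_normD _ _) _; apply: lerD.
    rewrite normrM normfV normrX ler_wpM2r// ?invr_ge0 ?exprn_ge0//.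
    have := cos_le1 (w * B + th); have := cos_geN1 (w * B + th).
    have := cos_le1 (w * A + th); have := cos_geN1 (w * A + th).
    by move=> ? ? ? ?; rewrite ler_norml; apply/andP; split; nra.
  rewrite normrM normfV normrX ler_wpM2r// ?invr_ge0 ?exprn_ge0//.
  have := sin_le1 (w * B + th); have := sin_geN1 (w * B + th).
  have := sin_le1 (w * A + th); have := sin_geN1 (w * A + th).
  by move=> ? ? ? ?; rewrite ler_norml; apply/andP; split; lra.
apply: le_trans bnd _; rewrite ler_pdivlMr//.
set a := `|w| in aw Tw Tw0 D0 *.
have h1 : (1 + T * a) ^+ 2 <= (2 * (T * a)) ^+ 2 by rewrite ler_pXn2r// ?nnegrE; lra.
have h0 : 0 <= 2 * T / a ^+ 2 + 4 / a ^+ 3.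
  by rewrite addr_ge0// divr_ge0 ?exprn_ge0 ?(ltW aw)// mulr_ge0// ltW.
apply: (le_trans (ler_wpM2l h0 h1)).
have -> : (2 * T / a ^+ 2 + 4 / a ^+ 3) * (2 * (T * a)) ^+ 2 = 8 * T ^+ 3 + 16 * T ^+ 2 / a.
  by field; rewrite gt_eqF.
have : T ^+ 2 / a <= T ^+ 3.
  by rewrite ler_pdivrMr// [T ^+ 3]exprSr -mulrA ler_peMr ?sqr_ge0// ltW.
lra.
Qed.

(** The constant is 48 = 2 * 24, as the real and the imaginary part of each coefficient have their
    own primitive. The factor 2 pi in the phases is dropped, being at least 1. *)
Lemma energy_integral_le (I : finType) (b : I -> R[i]) (nu : I -> int * int) (la : I -> R) (k A B : R) :
  0 <= k -> A < B ->
  (\int[mu]_(t in `[A, B]) ((t - A) * (B - t) * k * energy b nu la t)%:E <=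
   (48 * k * (B - A) ^+ 3 * \sum_p \sum_(p' | nu p' == nu p) nc (b p) * nc (b p') / (1 + (B - A) * `|la p - la p'|) ^+ 2)%:E)%E.
Proof.
move=> k0 AB; set T := B - A; have T0 : 0 < T by rewrite subr_gt0.
pose w p p' := 2 * pi * (la p - la p').
pose z p p' := Complex k 0 * (b p * (b p')^*%C).
have exC p p' := cid (parabola_cos_primitive (w p p') 0 AB).
have exS p p' := cid (parabola_cos_primitive (w p p') (pi / 2) AB).
pose GC p p' := projT1 (exC p p'); pose GS p p' := projT1 (exS p p').
have HC p p' := projT2 (exC p p'); have HS p p' := projT2 (exS p p').
pose gg p p' t := complex.Re (z p p') * ((t - A) * (B - t) * cos (w p p' * t + 0)) +
         complex.Im (z p p') * ((t - A) * (B - t) * cos (w p p' * t + pi / 2)).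
pose F p p' t := complex.Re (z p p') * GC p p' t + complex.Im (z p p') * GS p p' t.
have dF p p' t : is_derive t (1 : R) (F p p') (gg p p' t).
  have d1 := (HC p p').1 t; have d2 := (HS p p').1 t.
  have -> : F p p' = complex.Re (z p p') *: GC p p' + complex.Im (z p p') *: GS p p' by [].
  exact: (is_deriveD (is_deriveZ _ d1) (is_deriveZ _ d2)).
have E t : (t - A) * (B - t) * k * energy b nu la t = \sum_p \sum_(p' | nu p' == nu p) gg p p' t.
  rewrite /energy mulr_sumr; apply: eq_bigr => p _; rewrite mulr_sumr; apply: eq_bigr => p' _.
  rewrite /gg cosDpihalf addr0 /w /z /expi; case: (b p * _) => u v /=.
  by rewrite [2 * pi * (_ * t)]mulrA; ring.
under eq_integral do rewrite E.
have dFF t : is_derive t (1 : R) (fun t => \sum_p \sum_(p' | nu p' == nu p) F p p' t) (\sum_p \sum_(p' | nu p' == nu p) gg p p' t).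
  apply: (is_derive_bigsum _ _ (F := fun p t => \sum_(p' | nu p' == nu p) F p p' t) (f := fun p t => \sum_(p' | nu p' == nu p) gg p p' t)) => p.
  exact: is_derive_bigsum.
have cg : continuous (fun t : R => \sum_p \sum_(p' | nu p' == nu p) gg p p' t).
  apply: continuous_bigsum => p; apply: continuous_bigsum => p' x.
  have cq : (fun t : R => (t - A) * (B - t)) @ x --> (x - A) * (B - x).
    by apply: cvgM; apply: cvgB; (exact: cvg_cst || exact: cvg_id).
  apply: cvgD; (apply: cvgM; [exact: cvg_cst|]); (apply: cvgM; [exact: cq|exact: continuous_cos_affine]).
rewrite (FTC_is_derive AB dFF cg) lee_fin -sumrB mulr_sumr; apply: ler_sum => p _.
rewrite -sumrB mulr_sumr; apply: ler_sum => p' _.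
have -> : F p p' B - F p p' A = complex.Re (z p p') * (GC p p' B - GC p p' A) + complex.Im (z p p') * (GS p p' B - GS p p' A).
  by rewrite /F; ring.
apply: le_trans (ler_norm _) _; apply: le_trans (ler_normD _ _) _; rewrite !normrM.
set D := (1 + T * `|la p - la p'|) ^+ 2.
have T3 : 0 <= 24 * T ^+ 3 by rewrite mulr_ge0// exprn_ge0// ltW.
have D0 : 0 < D by rewrite exprn_gt0// ltr_pwDl// mulr_ge0// ltW.
have wD : 24 * T ^+ 3 / (1 + T * `|w p p'|) ^+ 2 <= 24 * T ^+ 3 / D.
  have kk : T * `|la p - la p'| <= T * `|w p p'|.
    rewrite ler_wpM2l ?(ltW T0)// /w normrM ler_peMl// ger0_norm; last by rewrite mulr_ge0// pi_ge0.
    have := @pi_ge2 R; lra.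
  have kk0 : 0 <= T * `|la p - la p'| by rewrite mulr_ge0// ltW.
  rewrite ler_wpM2l// lef_pV2 ?posrE//; last by rewrite exprn_gt0//; lra.
  rewrite /D lerXn2r ?nnegrE//; lra.
have zz : nc (z p p') = k * (nc (b p) * nc (b p')) by rewrite /z !ncM ncJ nc_real ger0_norm.
have c1 := le_trans (HC p p').2 wD; have c2 := le_trans (HS p p').2 wD.
have r1 := Re_le_nc (z p p'); have r2 := Im_le_nc (z p p').
have X1 := ler_pM (normr_ge0 _) (normr_ge0 _) r1 c1.
have X2 := ler_pM (normr_ge0 _) (normr_ge0 _) r2 c2.
apply: le_trans (lerD X1 X2) _; rewrite zz le_eqVlt; apply/orP; left; apply/eqP.
by field; rewrite gt_eqF.
Qed.

Lemma local_bilinear (I1 : finType) (K : nat) (c : I1 -> R[i]) (d : 'I_K -> R[i])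
    (nu1 : I1 -> int * int) (nu2 : 'I_K -> int * int) (l1 : I1 -> R) (l2 : 'I_K -> R) (g t0 L : R) :
  0 < g -> 0 < L -> injective nu1 ->
  (forall n n' m m', c n != 0 -> c n' != 0 -> nu1 n + nu2 m = nu1 n' + nu2 m' ->
     g * `|m%:R - m'%:R| <= `|l1 n + l2 m - (l1 n' + l2 m')|) ->
  (\int[leb3]_(z in `[t0, (t0 + L)%R] `*` torus)
     (nc ((\sum_n c n * expi (dot (nu1 n) z.2 + l1 n * z.1)) *
          (\sum_m d m * expi (dot (nu2 m) z.2 + l2 m * z.1))) ^+ 2)%:E <=
   (512 * (L + g^-1) * (\sum_n nc (c n) ^+ 2) * (\sum_m nc (d m) ^+ 2))%:E)%E.
Proof.
move=> g0 L0 inj1 gap.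
pose A := t0 - L / 2; pose B := t0 + 3 / 2 * L; have BA : B - A = 2 * L by rewrite /A /B; field.
have AB : A < B by rewrite -subr_gt0 BA mulr_gt0.
(* A parabola at least 1 on [t0, t0 + L]: it vanishes at both ends of the doubled
   interval, so its Fourier transform decays quadratically. *)
pose W (t : R) := Num.max 0 ((t - A) * (B - t)) * (4 / (3 * L ^+ 2)).
have L2 : 0 < 4 / (3 * L ^+ 2) by rewrite divr_gt0// mulr_gt0// exprn_gt0.
have W0 t : 0 <= W t by rewrite mulr_ge0 ?(ltW L2)// le_max lexx.
have W1 t : t0 <= t <= t0 + L -> 1 <= W t.
  move=> /andP[h1 h2]; rewrite /W.
  have : 3 * L ^+ 2 / 4 <= (t - A) * (B - t) by rewrite /A /B; nra.
  move=> h; apply: (@le_trans _ _ ((3 * L ^+ 2 / 4) * (4 / (3 * L ^+ 2)))).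
    by rewrite le_eqVlt; apply/orP; left; apply/eqP; field; rewrite gt_eqF.
  by rewrite ler_wpM2r ?(ltW L2)// le_max h orbT.
pose b (p : I1 * 'I_K) := c p.1 * d p.2; pose nu (p : I1 * 'I_K) := nu1 p.1 + nu2 p.2.
pose la (p : I1 * 'I_K) := l1 p.1 + l2 p.2.
have V z : (\sum_n c n * expi (dot (nu1 n) z.2 + l1 n * z.1)) *
          (\sum_m d m * expi (dot (nu2 m) z.2 + l2 m * z.1)) =
   \sum_p b p * expi (dot (nu p) z.2 + la p * z.1) :> R[i].
  rewrite mulr_suml -(pair_bigA _ (fun n m => b (n, m) * expi (dot (nu (n, m)) z.2 + la (n, m) * z.1)))/=.
  apply: eq_bigr => n _; rewrite mulr_sumr; apply: eq_bigr => m _.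
  rewrite /b /= mulrACA -expiD; congr (_ * expi _).
  by rewrite /dot /nu /la /= !rmorphD/=; ring.
apply: (@le_trans _ _ (\int[leb3]_(z in `[A, B] `*` torus) (W z.1 * nc (\sum_p b p * expi (dot (nu p) z.2 + la p * z.1)) ^+ 2)%:E)%E).
  apply: ge0_le_integral_nonmeasurable => z.
  - by move=> _; rewrite lee_fin sqr_ge0.
  - by move=> _; rewrite lee_fin mulr_ge0 ?sqr_ge0.
  - rewrite /= => -[]; rewrite in_itv/= => h1 h2; split.
      split => //; rewrite /= in_itv/=; move: h1 => /andP[? ?]; rewrite /A /B.
      by apply/andP; split; lra.
    by rewrite V lee_fin ler_peMl ?sqr_ge0// W1.
rewrite spacetime_integral//; last first.
  apply: measurable_funM => //; apply: measurable_maxr => //.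
  by apply: measurable_funM; apply: measurable_funB.
pose kk : R := 4 / (3 * L ^+ 2).
have -> : (\int[mu]_(t in `[A, B]) (W t * energy b nu la t)%:E =
   \int[mu]_(t in `[A, B]) ((t - A) * (B - t) * kk * energy b nu la t)%:E)%E.
  apply: eq_integral => t; rewrite inE/= in_itv/= => /andP[h1 h2].
  rewrite /W max_r//; by rewrite mulr_ge0// subr_ge0.
(* On the doubled interval 48 * 4 / (3 L^2) * (2L)^3 = 512 L, and the Schur factor 1 + 1/(L g) turns
   it into 512 (L + 1/g). *)
apply: le_trans (energy_integral_le _ _ _ (ltW L2) AB) _.
rewrite BA lee_fin.
have S := schur_gap d g0 (_ : 0 < 2 * L) inj1 gap.
have {}S := S (mulr_gt0 (ltr0Sn _ _) L0).
have k0 : 0 <= 48 * kk * (2 * L) ^+ 3.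
  by rewrite mulr_ge0// ?exprn_ge0// mulr_ge0// ltW.
apply: le_trans (ler_wpM2l k0 S) _.
rewrite !mulrA ler_wpM2r//; first by apply: sumr_ge0 => m _; exact: sqr_ge0.
rewrite ler_wpM2r//; first by apply: sumr_ge0 => m _; exact: sqr_ge0.
by rewrite /kk le_eqVlt; apply/orP; left; apply/eqP; field; rewrite !gt_eqF.
Qed.

End LocalBilinear.

Section Bilinear.
Context {R : realType}.

Lemma measurable_slab (A B : R) : measurable (`[A, B] `*` torus : set (R * (R * R))).
Proof. by apply: measurableX => //; exact: measurable_torus. Qed.

(** The gap condition holds only within a slice j, where one coordinate of the second frequency is
    frozen. Cauchy-Schwarz over the slices costs the factor J. *)
Lemma slice_bilinear (I1 : finType) (J K : nat) (c : I1 -> R[i]) (d : 'I_J -> 'I_K -> R[i])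
    (nu1 : I1 -> int * int) (nu2 : 'I_J -> 'I_K -> int * int)
    (l1 : I1 -> R) (l2 : 'I_J -> 'I_K -> R) (g t0 L : R) :
  0 < g -> 0 < L -> injective nu1 ->
  (forall j n n' m m', c n != 0 -> c n' != 0 -> nu1 n + nu2 j m = nu1 n' + nu2 j m' ->
     g * `|m%:R - m'%:R| <= `|l1 n + l2 j m - (l1 n' + l2 j m')|) ->
  (\int[leb3]_(z in `[t0, (t0 + L)%R] `*` torus)
     (nc ((\sum_n c n * expi (dot (nu1 n) z.2 + l1 n * z.1)) *
          (\sum_j \sum_m d j m * expi (dot (nu2 j m) z.2 + l2 j m * z.1))) ^+ 2)%:E <=
   (512 * (L + g^-1) * J%:R * (\sum_n nc (c n) ^+ 2) * (\sum_j \sum_m nc (d j m) ^+ 2))%:E)%E.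
Proof.
move=> g0 L0 inj1 gap.
pose U1 (z : R * (R * R)) := \sum_n c n * expi (dot (nu1 n) z.2 + l1 n * z.1).
pose U2 j (z : R * (R * R)) := \sum_m d j m * expi (dot (nu2 j m) z.2 + l2 j m * z.1).
have mU j : measurable_fun [set: R * (R * R)] (fun z => nc (U1 z * U2 j z) ^+ 2).
  under eq_fun do rewrite ncM exprMn.
  by apply: measurable_funM; apply: measurable_nc_trig => p; exact: measurable_wave_phase.
apply: (@le_trans _ _ (\int[leb3]_(z in `[t0, (t0 + L)%R] `*` torus) (\sum_j (J%:R * nc (U1 z * U2 j z) ^+ 2)%:E))%E).
  apply: ge0_le_integral_nonmeasurable => z.
  - by move=> _; rewrite lee_fin sqr_ge0.
  - by move=> _; rewrite sume_ge0// => j _; rewrite lee_fin mulr_ge0// sqr_ge0.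
  move=> Dz; split => //; rewrite sumEFin lee_fin -mulr_sumr [X in nc X]mulr_sumr.
  by apply: le_trans (cauchy_schwarz_card _ _) _; rewrite card_ord.
rewrite ge0_integral_sum//; last 3 first.
- exact: measurable_slab.
- move=> j; apply/measurable_EFinP; apply: measurable_funTS.
  by apply: measurable_funM => //; exact: mU.
- by move=> j z _; rewrite lee_fin mulr_ge0// sqr_ge0.
rewrite mulr_sumr -sumEFin; apply: lee_sum => j _.
under eq_integral do rewrite EFinM.
rewrite ge0_integralZl_EFin//; last 3 first.
- exact: measurable_slab.
- by move=> z _; rewrite lee_fin sqr_ge0.
- by apply/measurable_EFinP; apply: measurable_funTS; exact: mU.
have H := local_bilinear (d j) t0 g0 L0 inj1 (gap j).
have J0 : (0 <= (J%:R : R)%:E)%E by rewrite lee_fin.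
apply: le_trans (lee_wpmul2l J0 H) _.
by rewrite -EFinM lee_fin le_eqVlt; apply/orP; left; apply/eqP; ring.
Qed.

Lemma freq_inj N : injective (@freq N).
Proof.
move=> [i j] [i' j'] [] /addIr e1 /addIr e2; congr pair; apply: val_inj => /=.
  by move: e1 => -[].
by move: e2 => -[].
Qed.

(** Eliminating u' gives u^2 + v^2 - u'^2 - v'^2 = 2 (v' - u)(v - v'), and |v' - u| >= N1/3 - 2 N2
    >= N1/6; the separation by 12 is used in the last inequality. *)
Lemma gap_1d (C a N1 N2 u u' v v' : R) : C^-1 < a < C -> 1 < C -> 0 < N1 -> 12 * N2 <= N1 ->
  N1 <= 3 * `|u| -> `|v'| <= 2 * N2 -> u + v = u' + v' ->
  N1 / (3 * C) * `|v - v'| <= `|a * u ^+ 2 + a * v ^+ 2 - (a * u' ^+ 2 + a * v' ^+ 2)|.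
Proof.
move=> /andP[aC _] C1 N10 N12 hu hv' e.
have C0 : 0 < C by rewrite (lt_trans _ C1).
have a0 : 0 < a by rewrite (lt_trans _ aC)// invr_gt0.
have -> : a * u ^+ 2 + a * v ^+ 2 - (a * u' ^+ 2 + a * v' ^+ 2) = 2 * a * (v' - u) * (v - v').
  have -> : u' = u + v - v' by rewrite e addrK.
  ring.
rewrite normrM ler_wpM2r// !normrM (ger0_norm (ltW a0)) normr_nat.
have h : N1 / 6 <= `|v' - u|.
  have := lerB_dist u v'; rewrite distrC; lra.
have aC' : C^-1 <= a by rewrite ltW.
apply: (@le_trans _ _ (2 * C^-1 * (N1 / 6))).
  by rewrite le_eqVlt; apply/orP; left; apply/eqP; field; rewrite gt_eqF.
apply: ler_pM => //; [by rewrite mulr_ge0// invr_ge0 ltW|lra|].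
by rewrite ler_wpM2l.
Qed.

Lemma freq_le N (n : 'I_(2 * (2 * N)).+1) : `|(n%:Z - (2 * N)%N%:Z)%:~R| <= 2 * N%:R :> R.
Proof.
rewrite -natrM rmorphB/= -!pmulrn; have : n%:R <= (2 * (2 * N))%:R :> R by rewrite ler_nat -ltnS.
rewrite natrM; have : 0 <= n%:R :> R by [].
move=> ? ?; rewrite ler_norml; apply/andP; split; lra.
Qed.

Lemma bilinear_gain (C : R) : 1 < C -> exists K : R, 0 < K /\
  forall (a1 a2 : R) (N1 N2 : nat) (c : boxT N1 -> R[i]) (d : boxT N2 -> R[i]) (t0 : R),
  C^-1 < a1 < C -> C^-1 < a2 < C -> (0 < N2)%N -> (12 * N2 <= N1)%N ->
  (forall n, c n != 0 -> N1%:R ^+ 2 <= 4 * ((freq n).1%:~R ^+ 2 + (freq n).2%:~R ^+ 2) :> R) ->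
  (\int[leb3]_(z in `[t0, (t0 + (N2%:R ^+ 2)^-1)%R] `*` torus)
     (nc (evol a1 a2 c z.1 z.2 * evol a1 a2 d z.1 z.2) ^+ 2)%:E <=
   (K * (N2%:R / N1%:R + N2%:R^-1) * (\sum_n nc (c n) ^+ 2) * (\sum_m nc (d m) ^+ 2))%:E)%E.
Proof.
move=> C1; have C0 : 0 < C by rewrite (lt_trans _ C1).
exists (512 * (10 * (1 + 3 * C))); split; first lra.
move=> a1 a2 N1 N2 c d t0 ha1 ha2 N20 N12 supp.
have N10 : (0 < N1)%N by apply: leq_trans N12; rewrite muln_gt0.
have N1R : 0 < N1%:R :> R by rewrite ltr0n.
have N2R : 0 < N2%:R :> R by rewrite ltr0n.
have N12R : 12 * N2%:R <= N1%:R :> R by rewrite -natrM ler_nat.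
(* If both coordinates were below N1/3, then 4 |n|^2 < (8/9) N1^2, against [supp]. So where [big1]
   fails and c n is nonzero, the second coordinate is large. *)
pose big1 (n : boxT N1) : bool := N1%:R <= 3 * `|(freq n).1%:~R| :> R.
pose c1 n := if big1 n then c n else 0; pose c2 n := if big1 n then 0 else c n.
have c12 n : c n = c1 n + c2 n by rewrite /c1 /c2; case: ifP; rewrite ?addr0 ?add0r.
have c1P n : c1 n != 0 -> N1%:R <= 3 * `|(freq n).1%:~R| :> R.
  by rewrite /c1; case: ifP => //; rewrite eqxx.
have c2P n : c2 n != 0 -> N1%:R <= 3 * `|(freq n).2%:~R| :> R.
  rewrite /c2; case: ifPn => [|b1]; first by rewrite eqxx.
  move=> /supp; rewrite leNgt => h; rewrite leNgt; apply/negP => b2; move: h; apply/negP; rewrite negbK.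
  move: b1; rewrite /big1 -ltNge.
  rewrite -(real_normK (num_real (freq n).1%:~R)) -(real_normK (num_real (freq n).2%:~R)).
  move: b2; have := normr_ge0 ((freq n).1%:~R : R); have := normr_ge0 ((freq n).2%:~R : R).
  set x := `|_|; set y := `|_|; move=> x0 y0 hx hy; nra.
pose L : R := (N2%:R ^+ 2)^-1; pose g : R := N1%:R / (3 * C).
have L0 : 0 < L by rewrite invr_gt0 exprn_gt0.
have g0 : 0 < g by rewrite divr_gt0// mulr_gt0.
pose K2 := (2 * (2 * N2)).+1.
have dE (z : R * (R * R)) : evol a1 a2 d z.1 z.2 = \sum_(j < K2) \sum_(m < K2) d (m, j) * expi (dot (freq (m, j)) z.2 + Q a1 a2 (freq (m, j)) * z.1).
  rewrite exchange_big pair_bigA; by apply: eq_bigr => -[m j].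
have dE' (z : R * (R * R)) : evol a1 a2 d z.1 z.2 = \sum_(j < K2) \sum_(m < K2) d (j, m) * expi (dot (freq (j, m)) z.2 + Q a1 a2 (freq (j, m)) * z.1).
  by rewrite pair_bigA; apply: eq_bigr => -[m j].
have B1 := @slice_bilinear (boxT N1) K2 K2 c1 (fun j m => d (m, j)) (@freq N1) (fun j m => freq (m, j)) (fun n => Q a1 a2 (freq n)) (fun j m => Q a1 a2 (freq (m, j))) g t0 L g0 L0 (@freq_inj N1).
have B2 := @slice_bilinear (boxT N1) K2 K2 c2 (fun j m => d (j, m)) (@freq N1) (fun j m => freq (j, m)) (fun n => Q a1 a2 (freq n)) (fun j m => Q a1 a2 (freq (j, m))) g t0 L g0 L0 (@freq_inj N1).
have mm (m m' : 'I_K2) : (m%:R - m'%:R : R) = (m%:Z - (2 * N2)%N%:Z)%:~R - (m'%:Z - (2 * N2)%N%:Z)%:~R.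
  by rewrite !rmorphB/= -!pmulrn; ring.
have N1' : 12 * N2%:R <= N1%:R :> R by [].
have fh (m m' : 'I_K2) (n n' : boxT N1) (j : 'I_K2) :
  freq n + freq (m, j) = freq n' + freq (m', j) ->
  [/\ (freq n).1%:~R + (m%:Z - (2 * N2)%N%:Z)%:~R = (freq n').1%:~R + (m'%:Z - (2 * N2)%N%:Z)%:~R :> R
    & (freq n).2 = (freq n').2].
  by move=> [] /(congr1 (fun z : int => z%:~R : R)); rewrite !rmorphD /= => -> /addIr.
have fh' (m m' : 'I_K2) (n n' : boxT N1) (j : 'I_K2) :
  freq n + freq (j, m) = freq n' + freq (j, m') ->
  [/\ (freq n).2%:~R + (m%:Z - (2 * N2)%N%:Z)%:~R = (freq n').2%:~R + (m'%:Z - (2 * N2)%N%:Z)%:~R :> R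
    & (freq n).1 = (freq n').1].
  by move=> [] /addIr e /(congr1 (fun z : int => z%:~R : R)); rewrite !rmorphD /= => ->; split.
have {}B1 := B1 _; have {}B2 := B2 _.
have gap1 : forall (j : 'I_K2) (n n' : boxT N1) (m m' : 'I_K2), c1 n != 0 -> c1 n' != 0 ->
    freq n + freq (m, j) = freq n' + freq (m', j) ->
    g * `|m%:R - m'%:R| <= `|Q a1 a2 (freq n) + Q a1 a2 (freq (m, j)) - (Q a1 a2 (freq n') + Q a1 a2 (freq (m', j)))|.
  move=> j n n' m m' /c1P h1 _ /fh [e1 e2].
  have := gap_1d ha1 C1 N1R N12R h1 (freq_le m') e1.
  by rewrite mm /Q e2 /=; congr (_ <= `|_|); ring.
have gap2 : forall (j : 'I_K2) (n n' : boxT N1) (m m' : 'I_K2), c2 n != 0 -> c2 n' != 0 ->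
    freq n + freq (j, m) = freq n' + freq (j, m') ->
    g * `|m%:R - m'%:R| <= `|Q a1 a2 (freq n) + Q a1 a2 (freq (j, m)) - (Q a1 a2 (freq n') + Q a1 a2 (freq (j, m')))|.
  move=> j n n' m m' /c2P h1 _ /fh' [e1 e2].
  have := gap_1d ha2 C1 N1R N12R h1 (freq_le m') e1.
  by rewrite mm /Q e2 /=; congr (_ <= `|_|); ring.
have {B1 gap1} B1 := B1 gap1; have {B2 gap2} B2 := B2 gap2.
have dS : \sum_(j < K2) \sum_(m < K2) nc (d (m, j)) ^+ 2 = \sum_m nc (d m) ^+ 2.
  by rewrite exchange_big pair_bigA; apply: eq_bigr => -[m j].
have dS' : \sum_(j < K2) \sum_(m < K2) nc (d (j, m)) ^+ 2 = \sum_m nc (d m) ^+ 2.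
  by rewrite pair_bigA; apply: eq_bigr => -[m j].
rewrite dS in B1; rewrite dS' in B2.
have me (e : boxT N1 -> R[i]) : measurable_fun [set: R * (R * R)] (fun z : R * (R * R) => nc (evol a1 a2 e z.1 z.2 * evol a1 a2 d z.1 z.2) ^+ 2).
  under eq_fun do rewrite ncM exprMn.
  by apply: measurable_funM; apply: measurable_nc_trig => p; exact: measurable_wave_phase.
have me2 (e : boxT N1 -> R[i]) : measurable_fun [set: R * (R * R)] (fun z : R * (R * R) => (2 * nc (evol a1 a2 e z.1 z.2 * evol a1 a2 d z.1 z.2) ^+ 2)%:E).
  by apply/measurable_EFinP; apply: measurable_funM => //; exact: me.
set D := (X in integral leb3 X).
have mD : measurable D by exact: measurable_slab.
have half (e : boxT N1 -> R[i]) : (\int[leb3]_(z in D) (2 * nc (evol a1 a2 e z.1 z.2 * evol a1 a2 d z.1 z.2) ^+ 2)%:E =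
   2%:E * \int[leb3]_(z in D) (nc (evol a1 a2 e z.1 z.2 * evol a1 a2 d z.1 z.2) ^+ 2)%:E)%E.
  under eq_integral do rewrite EFinM.
  rewrite ge0_integralZl_EFin//; first by move=> z _; rewrite lee_fin sqr_ge0.
  by apply/measurable_EFinP; apply: measurable_funTS; exact: me.
apply: (@le_trans _ _ (\int[leb3]_(z in D) ((2 * nc (evol a1 a2 c1 z.1 z.2 * evol a1 a2 d z.1 z.2) ^+ 2)%:E + (2 * nc (evol a1 a2 c2 z.1 z.2 * evol a1 a2 d z.1 z.2) ^+ 2)%:E))%E).
  apply: ge0_le_integral_nonmeasurable => z.
  - by move=> _; rewrite lee_fin sqr_ge0.
  - by move=> _; rewrite -EFinD lee_fin addr_ge0// mulr_ge0// sqr_ge0.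
  move=> Dz; split => //; rewrite -EFinD lee_fin.
  have -> : evol a1 a2 c z.1 z.2 = evol a1 a2 c1 z.1 z.2 + evol a1 a2 c2 z.1 z.2.
    by rewrite /evol -big_split/=; apply: eq_bigr => n _; rewrite c12 mulrDl.
  rewrite mulrDl; set x := _ * evol _ _ d _ _; set y := _ * evol _ _ d _ _.
  have h1 := ler_ncD x y; have h0 := nc_ge0 (x + y).
  have h2 : nc (x + y) ^+ 2 <= (nc x + nc y) ^+ 2 by rewrite ler_pXn2r// nnegrE ?addr_ge0 ?nc_ge0.
  by apply: le_trans h2 _; have := sqr_ge0 (nc x - nc y); rewrite sqrrB sqrrD; lra.
rewrite ge0_integralD//; last 4 first.
- by move=> z _; rewrite lee_fin mulr_ge0// sqr_ge0.
- by apply: measurable_funTS; exact: me2.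
- by move=> z _; rewrite lee_fin mulr_ge0// sqr_ge0.
- by apply: measurable_funTS; exact: me2.
rewrite !half.
have p2 : (0 <= (2 : R)%:E)%E by rewrite lee_fin.
have {}B1 : (\int[leb3]_(z in D) (nc (evol a1 a2 c1 z.1 z.2 * evol a1 a2 d z.1 z.2) ^+ 2)%:E <=
   (512 * (L + g^-1) * K2%:R * (\sum_n nc (c1 n) ^+ 2) * (\sum_m nc (d m) ^+ 2))%:E)%E.
  by under eq_integral do rewrite dE.
have {}B2 : (\int[leb3]_(z in D) (nc (evol a1 a2 c2 z.1 z.2 * evol a1 a2 d z.1 z.2) ^+ 2)%:E <=
   (512 * (L + g^-1) * K2%:R * (\sum_n nc (c2 n) ^+ 2) * (\sum_m nc (d m) ^+ 2))%:E)%E.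
  by under eq_integral do rewrite dE'.
apply: (le_trans (leeD (lee_wpmul2l p2 B1) (lee_wpmul2l p2 B2))).
rewrite -!EFinM -EFinD lee_fin.
have cS : \sum_n nc (c n) ^+ 2 = \sum_n nc (c1 n) ^+ 2 + \sum_n nc (c2 n) ^+ 2.
  rewrite -big_split/=; apply: eq_bigr => n _; rewrite /c1 /c2.
  by case: ifP => _; rewrite nc0 expr0n/= ?addr0 ?add0r.
rewrite cS; set X1 := \sum_n nc (c1 n) ^+ 2; set X2 := \sum_n nc (c2 n) ^+ 2; set Y := \sum_m _.
have X10 : 0 <= X1 by apply: sumr_ge0 => n _; exact: sqr_ge0.
have X20 : 0 <= X2 by apply: sumr_ge0 => n _; exact: sqr_ge0.
have Y0 : 0 <= Y by apply: sumr_ge0 => n _; exact: sqr_ge0.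
have K2le : K2%:R <= 5 * N2%:R :> R by rewrite -natrM ler_nat /K2; clear -N20; lia.
(* There are 4 N2 + 1 <= 5 N2 slices, and 5 N2 (N2^-2 + 3C / N1) has both terms of the gain. *)
have main : (L + g^-1) * K2%:R <= 5 * (1 + 3 * C) * (N2%:R / N1%:R + N2%:R^-1).
  apply: (@le_trans _ _ ((L + g^-1) * (5 * N2%:R))).
    by apply: ler_wpM2l => //; apply: addr_ge0; [exact: ltW|rewrite invr_ge0; exact: ltW].
  have -> : (L + g^-1) * (5 * N2%:R) = 5 * (N2%:R^-1 + 3 * C * (N2%:R / N1%:R)).
    by rewrite /L /g; field; rewrite !gt_eqF.
  have i0 : 0 <= N2%:R / N1%:R :> R by rewrite divr_ge0.
  have j0 : 0 <= N2%:R^-1 :> R by rewrite invr_ge0.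
  have := mulr_ge0 (ltW C0) j0; lra.
have XY : 0 <= (X1 + X2) * Y by rewrite mulr_ge0// addr_ge0.
have := ler_wpM2r XY main.
set A := (L + g^-1) * K2%:R; set B := N2%:R / N1%:R + N2%:R^-1.
move=> h.
have -> : 2 * (512 * (L + g^-1) * K2%:R * X1 * Y) + 2 * (512 * (L + g^-1) * K2%:R * X2 * Y) = 512 * (2 * (A * ((X1 + X2) * Y))).
  by rewrite /A; ring.
have -> : 512 * (10 * (1 + 3 * C)) * B * (X1 + X2) * Y = 512 * (2 * (5 * (1 + 3 * C) * B * ((X1 + X2) * Y))).
  by ring.
by apply: ler_wpM2l; [exact: ler0n|apply: ler_wpM2l; [exact: ler0n|exact: h]].
Qed.

End Bilinear.

(** * The multilinear estimate *)

Section Combine.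
Context {R : realType}.

Lemma powR_sum_exp (J : finType) (P : pred J) (m : R) (w : J -> R) : 0 < m ->
  \prod_(j | P j) (m `^ w j) = m `^ (\sum_(j | P j) w j).
Proof.
move=> m0; elim/big_rec2 : _ => [|j y1 y2 _ ->]; first by rewrite powRr0.
by rewrite powRD//; apply/implyP => _; rewrite gt_eqF.
Qed.

(** A crude weighted AM-GM: each x_j is at most the total m, and the weights sum to 1. *)
Lemma prod_powR_le_sum (J : finType) (P : pred J) (x w : J -> R) :
  (forall j, 0 <= x j) -> (forall j, P j -> 0 < w j) -> \sum_(j | P j) w j = 1 ->
  \prod_(j | P j) (x j `^ w j) <= \sum_(j | P j) x j.
Proof.
move=> x0 w0 w1; set m := \sum_(j | P j) x j.
have xm j : P j -> x j <= m.
  by move=> Pj; rewrite /m (bigD1 j)//= lerDl; apply: sumr_ge0.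
have m0 : 0 <= m by apply: sumr_ge0.
apply: (@le_trans _ _ (\prod_(j | P j) (m `^ w j))).
  apply: ler_prod => j Pj; rewrite powR_ge0/=.
  by apply: ge0_ler_powR; rewrite ?nnegrE ?xm// ltW// w0.
have [mE|mn] := eqVneq m 0; last by rewrite powR_sum_exp ?lt_def ?mn// w1 powRr1.
case: (pickP P) => [j Pj|nP]; last first.
  have : (0 : R) = 1 by rewrite -w1 big_pred0.
  by move/eqP; rewrite eq_sym oner_eq0.
by rewrite mE (bigD1 j)//= powR0 ?mul0r// gt_eqF// w0.
Qed.

Lemma min_le_powR (a b e : R) : 0 <= a -> 0 <= b -> 0 <= e <= 1 -> Num.min a b <= a `^ (1 - e) * b `^ e.
Proof.
move=> a0 b0 /andP[e0 e1].
have [->|m0] := eqVneq (Num.min a b) 0; first by rewrite mulr_ge0 ?powR_ge0.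
have mp : 0 < Num.min a b by rewrite lt_def m0 le_min a0.
have -> : Num.min a b = Num.min a b `^ (1 - e) * Num.min a b `^ e.
  by rewrite -powRD ?m0 ?implybT// subrK powRr1// ltW.
apply: ler_pM; rewrite ?powR_ge0//; apply: ge0_ler_powR; rewrite ?nnegrE ?(ltW mp) ?subr_ge0//.
  by rewrite ge_min lexx.
by rewrite ge_min lexx orbT.
Qed.

Lemma energy_freq N (b : boxT N -> R[i]) (la : boxT N -> R) t :
  energy b (@freq N) la t = \sum_n nc (b n) ^+ 2.
Proof.
apply: eq_bigr => n _; rewrite (big_pred1 n); last first.
  by move=> n' /=; rewrite (inj_eq (@freq_inj N)).
by rewrite subrr mul0r expi0 mulr1 -nc_sqrE.
Qed.

Lemma slab_mass a1 a2 N (b : boxT N -> R[i]) (A B : R) : A < B ->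
  (\int[leb3]_(z in `[A, B] `*` torus) (nc (evol a1 a2 b z.1 z.2) ^+ 2)%:E =
   ((B - A) * \sum_n nc (b n) ^+ 2)%:E)%E.
Proof.
move=> AB.
have := @spacetime_integral R (boxT N) b (@freq N) (fun n => Q a1 a2 (freq n)) (cst 1) `[A, B] (measurable_itv _) (measurable_cst _) (fun _ => ler01).
under eq_integral do rewrite mul1r.
move=> ->; under eq_integral do rewrite mul1r energy_freq.
rewrite integral_cst//= lebesgue_measure_itv/= lte_fin AB -EFinB -EFinM mulrC//.
Qed.

End Combine.

Section Core.
Context {R : realType}.

Lemma unit_cell (M : nat) (t : R) : (0 < M)%N -> 0 <= t <= 1 ->
  exists i : 'I_(M ^ 2), i%:R / M%:R ^+ 2 <= t <= i%:R / M%:R ^+ 2 + (M%:R ^+ 2)^-1.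
Proof.
move=> M0 /andP[t0 t1].
have M2 : 0 < M%:R ^+ 2 :> R by rewrite exprn_gt0// ltr0n.
have MN : (0 < M ^ 2)%N by rewrite expn_gt0 M0.
have cell (i : nat) : i%:R / M%:R ^+ 2 + (M%:R ^+ 2)^-1 = i.+1%:R / M%:R ^+ 2 :> R.
  by rewrite -[in RHS]natr1 mulrDl mul1r.
have [lt|ge] := ltP t 1; last first.
  have e : t = 1 by apply/eqP; rewrite eq_le t1.
  have im : ((M ^ 2).-1 < M ^ 2)%N by rewrite prednK.
  exists (Ordinal im); rewrite /= cell prednK// e natrX divff ?gt_eqF// lexx andbT.
  by rewrite ler_pdivrMr// mul1r -natrX ler_nat leq_pred.
have tM : 0 <= t * M%:R ^+ 2 by rewrite mulr_ge0// ltW.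
have /andP[h1 h2] : (Num.truncn (t * M%:R ^+ 2))%:R <= t * M%:R ^+ 2 < (Num.truncn (t * M%:R ^+ 2)).+1%:R.
  exact: truncn_itv.
have im : (Num.truncn (t * M%:R ^+ 2) < M ^ 2)%N.
  by rewrite -(ltr_nat R); apply: le_lt_trans h1 _; rewrite natrX gtr_pMl.
exists (Ordinal im); rewrite /= cell ler_pdivrMr// h1/= ler_pdivlMr// ltW//.
Qed.

Lemma evol_eq0 a1 a2 N (b : boxT N -> R[i]) t x : \sum_n nc (b n) ^+ 2 = 0 -> evol a1 a2 b t x = 0.
Proof.
move=> B0; apply: big1 => n _.
have /eqP : nc (b n) ^+ 2 = 0 by apply: (psumr_eq0P _ B0) => // m _; exact: sqr_ge0.
by rewrite sqrf_eq0 => /eqP /nc_eq0 ->; rewrite mul0r.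
Qed.

Lemma measurable_evol2 a1 a2 N (b : boxT N -> R[i]) :
  measurable_fun [set: R * (R * R)] (fun z : R * (R * R) => nc (evol a1 a2 b z.1 z.2) ^+ 2).
Proof. by apply: measurable_nc_trig => p; exact: measurable_wave_phase. Qed.

(** Two bounds compete: h^2 from the supremum of the second factor, and the transversality gain M/N0
    + 1/M. Their minimum is at most the geometric mean with exponents 1 - e and e. The lower bound
    on frequencies is asked for N0 > 1 only, because the symbol at N0 = 1 does not vanish near the
    origin. *)
Lemma pair_bound (C : R) : 1 < C -> exists K : R, 0 < K /\
  forall (a1 a2 : R) (N0 M : nat) (c : boxT N0 -> R[i]) (d : boxT M -> R[i]) (t0 h e : R),
  C^-1 < a1 < C -> C^-1 < a2 < C -> (0 < M <= N0)%N ->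
  ((1 < N0)%N -> forall n, c n != 0 -> N0%:R ^+ 2 <= 4 * ((freq n).1%:~R ^+ 2 + (freq n).2%:~R ^+ 2) :> R) ->
  0 <= h <= 1 -> 0 <= e <= 1 ->
  (forall t x, t0 <= t <= t0 + (M%:R ^+ 2)^-1 ->
     nc (evol a1 a2 d t x) <= 5 * M%:R * Num.sqrt (\sum_n nc (d n) ^+ 2) * h) ->
  (\int[leb3]_(z in `[t0, (t0 + (M%:R ^+ 2)^-1)%R] `*` torus)
     (nc (evol a1 a2 c z.1 z.2 * evol a1 a2 d z.1 z.2) ^+ 2)%:E <=
   (K * ((h ^+ 2) `^ (1 - e) * (M%:R / N0%:R + M%:R^-1) `^ e) *
      ((\sum_n nc (c n) ^+ 2) * (\sum_m nc (d m) ^+ 2)))%:E)%E.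
Proof.
move=> C1; have [K1 [K10 HK1]] := bilinear_gain C1.
exists (300 + K1); split; first by lra.
move=> a1 a2 N0 M c d t0 h e ha1 ha2 /andP[M0 MN0] supp /andP[h0 h1] e01 hd.
have N00 : (0 < N0)%N by apply: leq_trans MN0.
have MR : 0 < M%:R :> R by rewrite ltr0n.
have NR : 0 < N0%:R :> R by rewrite ltr0n.
have M2 : 0 < M%:R ^+ 2 :> R by rewrite exprn_gt0.
set X := \sum_n _; set Y := \sum_m nc (d m) ^+ 2 in hd *.
have X0 : 0 <= X by apply: sumr_ge0 => n _; exact: sqr_ge0.
have Y0 : 0 <= Y by apply: sumr_ge0 => n _; exact: sqr_ge0.
have XY : 0 <= X * Y by rewrite mulr_ge0.
set m := M%:R / N0%:R + M%:R^-1.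
have m0 : 0 <= m by rewrite addr_ge0 ?invr_ge0// divr_ge0.
have h2 : 0 <= h ^+ 2 by rewrite exprn_ge0.
suff key : (\int[leb3]_(z in `[t0, (t0 + (M%:R ^+ 2)^-1)%R] `*` torus)
     (nc (evol a1 a2 c z.1 z.2 * evol a1 a2 d z.1 z.2) ^+ 2)%:E <=
     ((300 + K1) * Num.min (h ^+ 2) m * (X * Y))%:E)%E.
  apply: (le_trans key); rewrite lee_fin; apply: ler_wpM2r => //.
  by apply: ler_wpM2l; [lra|exact: min_le_powR].
have trivial_bound : (\int[leb3]_(z in `[t0, (t0 + (M%:R ^+ 2)^-1)%R] `*` torus)
     (nc (evol a1 a2 c z.1 z.2 * evol a1 a2 d z.1 z.2) ^+ 2)%:E <= (25 * h ^+ 2 * (X * Y))%:E)%E.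
  pose v := (5 * M%:R * Num.sqrt Y * h) ^+ 2.
  have v0 : 0 <= v by exact: sqr_ge0.
  apply: (@le_trans _ _ (\int[leb3]_(z in `[t0, (t0 + (M%:R ^+ 2)^-1)%R] `*` torus) (v%:E * (nc (evol a1 a2 c z.1 z.2) ^+ 2)%:E))%E).
    apply: ge0_le_integral_nonmeasurable => z.
    - by move=> _; rewrite lee_fin sqr_ge0.
    - by move=> _; rewrite -EFinM lee_fin mulr_ge0// sqr_ge0.
    move=> Dz; split => //; rewrite -EFinM lee_fin ncM exprMn mulrC ler_wpM2r ?sqr_ge0//.
    rewrite /v ler_pXn2r ?nnegrE ?nc_ge0//; last by rewrite !mulr_ge0 ?sqrtr_ge0// ltW.
    by apply: hd; case: Dz => /=; rewrite in_itv.
  rewrite ge0_integralZl_EFin//; last 3 first.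
  - exact: measurable_slab.
  - by move=> z _; rewrite lee_fin sqr_ge0.
  - by apply/measurable_EFinP; apply: measurable_funTS; exact: measurable_evol2.
  rewrite slab_mass; last by rewrite ltrDl invr_gt0.
  rewrite -EFinM lee_fin le_eqVlt; apply/orP; left; apply/eqP.
  rewrite /v !exprMn sqr_sqrtr// -/X addrAC subrr add0r; field.
  by rewrite gt_eqF.
(* Without separation of scales the gain is at least 1/12 >= h^2 / 12, so the trivial bound
   suffices; this gives 300 = 25 * 12. *)
have [N12|N12] := leqP (12 * M) N0; last first.
  apply: (le_trans trivial_bound); rewrite lee_fin ler_wpM2r//.
  have m12 : 1 <= 12 * m.
    have : 1 <= 12 * (M%:R / N0%:R) :> R.
      by rewrite mulrA ler_pdivlMr// mul1r -natrM ler_nat ltnW.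
    have : 0 <= M%:R^-1 :> R by rewrite invr_ge0.
    by rewrite /m; lra.
  have hh : h ^+ 2 <= 1 by rewrite expr_le1.
  have mn0 : 0 <= Num.min (h ^+ 2) m by rewrite le_min h2.
  have : h ^+ 2 <= 12 * Num.min (h ^+ 2) m.
    by rewrite minEle; case: ifP => _; lra.
  have := mulr_ge0 (ltW K10) mn0; lra.
have [hm|hm] := leP (h ^+ 2) m.
  apply: (le_trans trivial_bound); rewrite lee_fin ler_wpM2r// ler_wpM2r//; lra.
have N01 : (1 < N0)%N by apply: leq_trans N12; rewrite -[2%N]/(2 * 1)%N leq_mul.
have := HK1 a1 a2 N0 M c d t0 ha1 ha2 M0 N12 (supp N01).
move=> /le_trans; apply; rewrite lee_fin -/m -/X -/Y -mulrA ler_wpM2r// ler_wpM2r//.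
lra.
Qed.

End Core.

Section Multilinear.
Context {R : realType}.

(** On a slab every factor except the pair ([ord0], [j1]) is replaced by its bound V. Closed slabs
    cover the end points, and their overlaps only increase the right-hand side. *)
Lemma slab_decomposition (k : nat) (a1 a2 : R) (N : 'I_k.+1 -> nat) (b : forall j, boxT (N j) -> R[i])
   (M : nat) (j1 : 'I_k.+1) (V : 'I_(M ^ 2) -> 'I_k.+1 -> R) :
  (0 < M)%N -> j1 != ord0 ->
  (forall i j, 0 <= V i j) ->
  (forall (i : 'I_(M ^ 2)) j t x, j != ord0 -> i%:R / M%:R ^+ 2 <= t <= i%:R / M%:R ^+ 2 + (M%:R ^+ 2)^-1 ->
     nc (evol a1 a2 (b j) t x) ^+ 2 <= V i j) ->
  (\int[leb3]_(z in `[0%R, 1%R] `*` torus) (\prod_j nc (evol a1 a2 (b j) z.1 z.2) ^+ 2)%:E <=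
   \sum_(i < M ^ 2) (\prod_(j | (j != ord0) && (j != j1)) V i j)%:E *
     \int[leb3]_(z in `[(i%:R / M%:R ^+ 2)%R, (i%:R / M%:R ^+ 2 + (M%:R ^+ 2)^-1)%R] `*` torus)
       (nc (evol a1 a2 (b ord0) z.1 z.2 * evol a1 a2 (b j1) z.1 z.2) ^+ 2)%:E)%E.
Proof.
move=> M0 j10 V0 HV.
pose D (i : 'I_(M ^ 2)) : set (R * (R * R)) := `[(i%:R / M%:R ^+ 2)%R, (i%:R / M%:R ^+ 2 + (M%:R ^+ 2)^-1)%R] `*` torus.
pose F (z : R * (R * R)) := nc (evol a1 a2 (b ord0) z.1 z.2 * evol a1 a2 (b j1) z.1 z.2) ^+ 2.
pose P i := \prod_(j | (j != ord0) && (j != j1)) V i j.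
have P0 i : 0 <= P i by apply: prodr_ge0.
have F0 z : 0 <= F z by exact: sqr_ge0.
have mF : measurable_fun [set: R * (R * R)] F.
  rewrite /F; under eq_fun do rewrite ncM exprMn.
  by apply: measurable_funM; exact: measurable_evol2.
have mD i : measurable (D i) by exact: measurable_slab.
have mPF i : measurable_fun [set: R * (R * R)] (fun z => (P i * F z)%:E).
  by apply/measurable_EFinP; apply: measurable_funM.
have PF0 i z : (0 <= ((fun z => (P i * F z)%:E) \_ (D i)) z)%E.
  by rewrite /patch; case: ifP => // _; rewrite lee_fin mulr_ge0.
apply: (@le_trans _ _ (\int[leb3]_z (\sum_(i < M ^ 2) ((fun z => (P i * F z)%:E) \_ (D i)) z))%E).
  apply: ge0_le_integral_nonmeasurable => z.
  - by move=> _; rewrite lee_fin; apply: prodr_ge0 => j _; exact: sqr_ge0.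
  - by move=> _; rewrite sume_ge0.
  move=> [/= tz xz]; split => //.
  have tz' : 0 <= z.1 <= 1 by move: tz; rewrite in_itv.
  have [i hi] := @unit_cell R M z.1 M0 tz'.
  apply: (@le_trans _ _ (((fun z => (P i * F z)%:E) \_ (D i)) z)); last first.
    by rewrite (bigD1 i)//= leeDl// sume_ge0.
  have Dz : z \in D i by rewrite inE; split => //=; rewrite in_itv.
  rewrite /patch Dz lee_fin (bigD1 ord0)//= (bigD1 j1)//= mulrA mulrC /F ncM exprMn.
  apply: ler_wpM2r; first by apply: mulr_ge0; exact: sqr_ge0.
  rewrite /P; apply: ler_prod => j /andP[j0 _].
  by rewrite sqr_ge0/= HV.
rewrite ge0_integral_sum//; last first.
  move=> i; apply/(measurable_restrictT _ _).1; first exact: mD.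
  by apply: measurable_funTS; exact: mPF.
apply: lee_sum => i _; rewrite -integral_mkcond.
under eq_integral do rewrite EFinM.
rewrite ge0_integralZl_EFin//.
- exact: mD.
- by move=> z _; rewrite lee_fin.
- by apply/measurable_EFinP; apply: measurable_funTS; exact: mF.
Qed.

Lemma powR_anti (a u v : R) : 0 <= a <= 1 -> 0 < u -> u <= v -> a `^ v <= a `^ u.
Proof.
move=> /andP[a0 a1] u0 uv; have [->|an] := eqVneq a 0.
  by rewrite !powR0// gt_eqF// (lt_le_trans u0).
by apply: ger_powR => //; rewrite lt_def an a0.
Qed.

(** Summed over the slabs, the powers of the H_j give the product of (M/N_j)^(2 w_j), where M = N_2.
    As the w_j sum to 1, its M^2 cancels the M^-2 that appears when N_2^2, absent from the pair
    bound, is put into the product of all N_j^2. Each factor keeps N_j^(2 - 2 w_j). *)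
Lemma multilinear (C : R) (k : nat) : 1 < C -> (3 <= k)%N -> exists K : R, 0 < K /\
  forall (a1 a2 : R) (N : 'I_k.+1 -> nat) (b : forall j, boxT (N j) -> R[i]),
  C^-1 < a1 < C -> C^-1 < a2 < C ->
  (forall j, (0 < N j)%N) -> (forall i j : 'I_k.+1, (i <= j)%N -> (N j <= N i)%N) ->
  ((1 < N ord0)%N -> forall n, b ord0 n != 0 -> (N ord0)%:R ^+ 2 <= 4 * ((freq n).1%:~R ^+ 2 + (freq n).2%:~R ^+ 2) :> R) ->
  (\int[leb3]_(z in `[0%R, 1%R] `*` torus) (\prod_j nc (evol a1 a2 (b j) z.1 z.2) ^+ 2)%:E <=
  (K * ((N ord_max)%:R / (N ord0)%:R + (N (inord 1))%:R^-1) `^ (10 * k%:R)^-1 *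
    (\sum_n nc (b ord0 n) ^+ 2) *
    \prod_(j | j != ord0) ((N j)%:R `^ (2 - 2 / k%:R) * \sum_n nc (b j n) ^+ 2))%:E)%E.
Proof.
move=> C1 k3.
have [Km [Km0 HKm]] := sup_norm_moment C1.
have [Kp [Kp0 HKp]] := pair_bound C1.
have kR : 3 <= k%:R :> R by rewrite ler_nat.
have kR0 : 0 < k%:R :> R by lra.
pose e : R := (10 * k%:R)^-1.
have e0 : 0 < e by rewrite invr_gt0 mulr_gt0.
have ek : e * k%:R = 10^-1 by rewrite /e; field; rewrite gt_eqF.
pose j1 : 'I_k.+1 := inord 1; pose jk : 'I_k.+1 := ord_max.
have j1E : j1 = 1%N :> nat by rewrite /j1 inordK// ltnS (leq_trans _ k3).
have j10 : j1 != ord0 by rewrite -val_eqE /= j1E.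
have jk0 : jk != ord0 by rewrite -val_eqE /= -lt0n (leq_trans _ k3).
have j1k : jk != j1 by rewrite -val_eqE /= j1E gtn_eqF// (leq_trans _ k3).
(* The weights 1/k alone would only give the gain (N_2/N_1 + 1/N_2)^e; shifting
   e/2 of weight from N_{k+1} to N_2 adds the factor (N_{k+1}/N_2)^e. *)
pose w (j : 'I_k.+1) : R := if j == j1 then k%:R^-1 + e / 2 else if j == jk then k%:R^-1 - e / 2 else k%:R^-1.
have ki0 : 0 < k%:R^-1 :> R by rewrite invr_gt0.
have ke : e = k%:R^-1 / 10 by rewrite /e invfM mulrC.
have w0 j : 0 < w j by rewrite /w; case: ifP => _; [lra|case: ifP => _; lra].
have cardk : #|[pred j : 'I_k.+1 | j != ord0]|%:R = k%:R :> R.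
  by congr (_%:R); have := cardC1 (ord0 : 'I_k.+1); rewrite card_ord.
have wE j : w j = k%:R^-1 + (if j == j1 then e / 2 else 0) + (if j == jk then - (e / 2) else 0).
  rewrite /w; have [->|nj] := eqVneq j j1; first by rewrite eq_sym (negbTE j1k) addr0.
  by case: ifP => _; rewrite ?addr0.
have pick1 (c : R) (i : 'I_k.+1) : i != ord0 -> \sum_(j | j != ord0) (if j == i then c else 0) = c.
  move=> i0; rewrite -big_mkcondr (big_pred1 i)// => j.
  by rewrite /= andb_idl// => /eqP ->.
have w1 : \sum_(j | j != ord0) w j = 1.
  under eq_bigr do rewrite wE.
  rewrite !big_split/= !pick1// sumr_const -[X in X + _ + _]mulr_natl cardk.
  by rewrite divff ?gt_eqF// addrK.
have ki3 : k%:R^-1 <= 3^-1 :> R by rewrite lef_pV2// posrE.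
(* Here k >= 3 is used: the exponents of H available on a slab, 2(1 - e) for j1 and 2 for the
   others, may be lowered to 21/4 * w j because H <= 1. *)
have wle j : 21 / 4 * w j <= 2 * (1 - e).
  by rewrite /w; case: ifP => _; [lra|case: ifP => _; lra].
exists (Kp * 25 ^+ k * Km * k%:R); split.
  by do ?[exact: kR0 | exact: Km0 | exact: Kp0 | apply: exprn_gt0 | apply: mulr_gt0].
move=> a1 a2 N b ha1 ha2 N0 Nmono supp.
pose M := N j1; have M0 : (0 < M)%N by exact: N0.
have MR : 0 < M%:R :> R by rewrite ltr0n.
have M2 : 0 < M%:R ^+ 2 :> R by rewrite exprn_gt0.
have NM j : j != ord0 -> (N j <= M)%N.
  by move=> j0; apply: Nmono; rewrite j1E lt0n; move: j0; rewrite -val_eqE.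
pose B j := \sum_n nc (b j n) ^+ 2.
have B0 j : 0 <= B j by apply: sumr_ge0 => n _; exact: sqr_ge0.
have rhs0 : 0 <= Kp * 25 ^+ k * Km * k%:R * ((N ord_max)%:R / (N ord0)%:R + (N (inord 1))%:R^-1) `^ (10 * k%:R)^-1 *
    B ord0 * \prod_(j | j != ord0) ((N j)%:R `^ (2 - 2 / k%:R) * B j).
  apply: mulr_ge0; last by apply: prodr_ge0 => j _; rewrite mulr_ge0 ?powR_ge0.
  apply: mulr_ge0 => //; apply: mulr_ge0; last exact: powR_ge0.
  by do ?[exact: ler0n | exact: ltW | apply: exprn_ge0 | apply: mulr_ge0].
(* The suprema are normalised by B j, so a vanishing factor is treated apart; the product is then
   0. *)
have [/existsP[j /andP[j0 /eqP Bj]]|/existsPn nz] := boolP [exists j, (j != ord0) && (B j == 0)].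
  rewrite integral0_eq// => z _; rewrite (bigD1 j)//= evol_eq0// nc0 expr0n mul0r//.
have Bpos j : j != ord0 -> 0 < B j.
  by move=> j0; have := nz j; rewrite j0/= lt_def B0 andbT.
have exH j : exists H : 'I_(M ^ 2) -> R, j != ord0 ->
    [/\ forall i, 0 <= H i <= 1,
    forall (i : 'I_(M ^ 2)) t x, i%:R / M%:R ^+ 2 <= t <= i.+1%:R / M%:R ^+ 2 ->
     nc (evol a1 a2 (b j) t x) <= 5 * (N j)%:R * Num.sqrt (B j) * H i &
    \sum_i (H i `^ (21 / 4)) <= Km * M%:R ^+ 2 / (N j)%:R ^+ 2].
  have [->|j0] := eqVneq j ord0; first by exists (fun=> 0).
  have NN : (0 < N j <= M)%N by rewrite N0 NM.
  have [H HH] := HKm a1 a2 (N j) M (b j) ha1 ha2 NN (Bpos j j0).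
  by exists H.
have [H HH] := choice exH.
have cell (i : nat) : i%:R / M%:R ^+ 2 + (M%:R ^+ 2)^-1 = i.+1%:R / M%:R ^+ 2 :> R.
  by rewrite -[in RHS]natr1 mulrDl mul1r.
pose V i j := 25 * (N j)%:R ^+ 2 * B j * H j i ^+ 2.
have V0 i j : 0 <= V i j by do ?[exact: sqr_ge0 | exact: B0 | exact: ler0n | apply: mulr_ge0].
have HV (i : 'I_(M ^ 2)) j t x : j != ord0 -> i%:R / M%:R ^+ 2 <= t <= i%:R / M%:R ^+ 2 + (M%:R ^+ 2)^-1 ->
     nc (evol a1 a2 (b j) t x) ^+ 2 <= V i j.
  rewrite cell => j0 ht; have [h01 hh _] := HH j j0.
  have -> : V i j = (5 * (N j)%:R * Num.sqrt (B j) * H j i) ^+ 2.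
    by rewrite /V !exprMn sqr_sqrtr//; ring.
  have /andP[hi0 _] := h01 i.
  by rewrite ler_pXn2r ?nnegrE ?nc_ge0 ?hh// !mulr_ge0 ?sqrtr_ge0.
apply: le_trans (slab_decomposition M0 j10 V0 HV) _.
pose m : R := M%:R / (N ord0)%:R + M%:R^-1.
have m0 : 0 <= m by rewrite addr_ge0 ?invr_ge0// divr_ge0.
have pairb (i : 'I_(M ^ 2)) : (\int[leb3]_(z in `[(i%:R / M%:R ^+ 2)%R, (i%:R / M%:R ^+ 2 + (M%:R ^+ 2)^-1)%R] `*` torus)
       (nc (evol a1 a2 (b ord0) z.1 z.2 * evol a1 a2 (b j1) z.1 z.2) ^+ 2)%:E <=
   (Kp * ((H j1 i ^+ 2) `^ (1 - e) * m `^ e) * (B ord0 * B j1))%:E)%E.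
  have [h01 hh _] := HH j1 j10.
  apply: HKp => //; first by rewrite M0 Nmono.
    by apply/andP; split; lra.
  by move=> t x; rewrite cell => ht; exact: hh.
have {pairb} step (i : 'I_(M ^ 2)) : ((\prod_(j | (j != ord0) && (j != j1)) V i j)%:E *
     \int[leb3]_(z in `[(i%:R / M%:R ^+ 2)%R, (i%:R / M%:R ^+ 2 + (M%:R ^+ 2)^-1)%R] `*` torus)
       (nc (evol a1 a2 (b ord0) z.1 z.2 * evol a1 a2 (b j1) z.1 z.2) ^+ 2)%:E <=
   (Kp * m `^ e * B ord0 / M%:R ^+ 2 * (\prod_(j | j != ord0) (25 * (N j)%:R ^+ 2 * B j)) *
     \prod_(j | j != ord0) (H j i `^ (21 / 4 * w j)))%:E)%E.
  have P0 : 0 <= \prod_(j | (j != ord0) && (j != j1)) V i j by apply: prodr_ge0.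
  have P0E : (0 <= (\prod_(j | (j != ord0) && (j != j1)) V i j)%:E)%E by rewrite lee_fin.
  apply: le_trans (lee_wpmul2l P0E (pairb i)) _.
  rewrite -EFinM lee_fin [X in _ <= _ * X * _](bigD1 j1)//= [X in _ <= _ * X](bigD1 j1)//=.
  rewrite /V big_split/=; set P1 := \prod_(j | _ && _) (25 * _ * _).
  have P10 : 0 <= P1 by apply: prodr_ge0 => j _; do ?[exact: sqr_ge0 | exact: B0 | exact: ler0n | apply: mulr_ge0].
  have h1 : (H j1 i ^+ 2) `^ (1 - e) <= H j1 i `^ (21 / 4 * w j1).
    have [/(_ i) /andP[hi0 hi1] _ _] := HH j1 j10.
    rewrite -powR_mulrn// -powRrM; apply: powR_anti; rewrite ?hi0 ?hi1//.
    by rewrite mulr_gt0.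
  have h2 : \prod_(j | (j != ord0) && (j != j1)) H j i ^+ 2 <= \prod_(j | (j != ord0) && (j != j1)) (H j i `^ (21 / 4 * w j)).
    apply: ler_prod => j /andP[j0 _]; rewrite sqr_ge0/=.
    have [/(_ i) /andP[hi0 hi1] _ _] := HH j j0.
    rewrite -powR_mulrn//; apply: powR_anti; rewrite ?hi0 ?hi1//.
      by rewrite mulr_gt0.
    by apply: le_trans (wle j) _; lra.
  set u := _ `^ (1 - e) in h1 *; set u' := _ `^ _ in h1 *.
  set q := \prod_(j | _) _ ^+ 2 in h2 *; set q' := \prod_(j | _) _ `^ _ in h2 *.
  have u0 : 0 <= u by exact: powR_ge0.
  have q0 : 0 <= q by apply: prodr_ge0 => j _; exact: sqr_ge0.
  have A0 : 0 <= Kp * m `^ e * B ord0 * B j1 * P1.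
    by do ?[exact: P10 | exact: B0 | exact: powR_ge0 | exact: ltW | apply: mulr_ge0].
  have uq : u * q <= u' * q' by apply: ler_pM.
  have uq0 : 0 <= u * q by apply: mulr_ge0.
  have -> : P1 * q * (Kp * (u * m `^ e) * (B ord0 * B j1)) = (Kp * m `^ e * B ord0 * B j1 * P1) * (u * q) by ring.
  have -> : Kp * m `^ e * B ord0 / M%:R ^+ 2 * (25 * (N j1)%:R ^+ 2 * B j1 * P1) * (u' * q') = (Kp * m `^ e * B ord0 * B j1 * P1) * (25 * (u' * q')).
    by rewrite -/M; field; rewrite gt_eqF.
  by rewrite ler_wpM2l//; lra.
apply: le_trans (lee_sum _ (fun i _ => step i)) _.
rewrite sumEFin lee_fin -mulr_sumr.
(* Normalised so that the sum over i is at most [Km] for every j; AM-GM then loses nothing in the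
   N_j. *)
pose x j (i : 'I_(M ^ 2)) := ((N j)%:R / M%:R) ^+ 2 * H j i `^ (21 / 4).
have sumH : \sum_i \prod_(j | j != ord0) (H j i `^ (21 / 4 * w j)) <=
   (\prod_(j | j != ord0) ((M%:R / (N j)%:R) ^+ 2) `^ w j) * (k%:R * Km).
  have pw (i : 'I_(M ^ 2)) : \prod_(j | j != ord0) (H j i `^ (21 / 4 * w j)) <=
      (\prod_(j | j != ord0) ((M%:R / (N j)%:R) ^+ 2) `^ w j) * \sum_(j | j != ord0) x j i.
    have -> : \prod_(j | j != ord0) (H j i `^ (21 / 4 * w j)) =
      (\prod_(j | j != ord0) ((M%:R / (N j)%:R) ^+ 2) `^ w j) * \prod_(j | j != ord0) (x j i `^ w j).
      rewrite -big_split/=; apply: eq_bigr => j _; rewrite -powRM ?sqr_ge0//; last first.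
        by rewrite mulr_ge0 ?sqr_ge0 ?powR_ge0.
      rewrite powRrM; congr (_ `^ _); rewrite /x mulrA -exprMn.
      have -> : M%:R / (N j)%:R * ((N j)%:R / M%:R) = 1 :> R by field; rewrite !gt_eqF// ltr0n.
      by rewrite expr1n mul1r.
    rewrite ler_wpM2l//; first by apply: prodr_ge0 => j _; exact: powR_ge0.
    by apply: prod_powR_le_sum => // j; rewrite mulr_ge0 ?sqr_ge0 ?powR_ge0.
  apply: le_trans (ler_sum _ (fun i _ => pw i)) _.
  rewrite -mulr_sumr ler_wpM2l//; first by apply: prodr_ge0 => j _; exact: powR_ge0.
  rewrite exchange_big/= -cardk mulr_natl -sumr_const; apply: ler_sum => j j0.
  have [_ _ hs] := HH j j0; rewrite /x -mulr_sumr.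
  apply: le_trans (ler_wpM2l (sqr_ge0 _) hs) _.
  rewrite le_eqVlt; apply/orP; left; apply/eqP; field.
  by rewrite !gt_eqF// ltr0n.
set A := Kp * m `^ e * B ord0 / M%:R ^+ 2 * _.
have A0 : 0 <= A.
  rewrite /A; apply: mulr_ge0; last by apply: prodr_ge0 => j _; do ?[exact: sqr_ge0 | exact: B0 | exact: ler0n | apply: mulr_ge0].
  by rewrite divr_ge0 ?sqr_ge0//; do ?[exact: B0 | exact: powR_ge0 | exact: ltW | apply: mulr_ge0].
apply: le_trans (ler_wpM2l A0 sumH) _; rewrite /A.
have NR j : 0 < (N j)%:R :> R by rewrite ltr0n.
(* The deviation from the critical power N_j^(2 - 2/k); only j1 and jk have a nonzero exponent. *)
pose r j : R := (N j)%:R `^ (2 / k%:R - 2 * w j).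
have rE : \prod_(j | j != ord0) r j = ((N ord_max)%:R / M%:R) `^ e.
  rewrite (bigD1 j1)//= (bigD1 jk)/=; last by rewrite jk0.
  rewrite big1 ?mulr1; last first.
    move=> j /andP[/andP[_ nj1] njk]; rewrite /r /w (negbTE nj1) (negbTE njk) subrr powRr0//.
  rewrite /r /w eqxx (negbTE j1k) eqxx -/jk -/M.
  have -> : 2 / k%:R - 2 * (k%:R^-1 + e / 2) = - e by field; rewrite gt_eqF.
  have -> : 2 / k%:R - 2 * (k%:R^-1 - e / 2) = e by field; rewrite gt_eqF.
  by rewrite powRM ?invr_ge0// mulrC -powR_inv1// -powRrM mulN1r.
have prodE : (\prod_(j | j != ord0) (25 * (N j)%:R ^+ 2 * B j)) * (\prod_(j | j != ord0) ((M%:R / (N j)%:R) ^+ 2) `^ w j) =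
   25 ^+ k * M%:R ^+ 2 * ((N ord_max)%:R / M%:R) `^ e * \prod_(j | j != ord0) ((N j)%:R `^ (2 - 2 / k%:R) * B j).
  rewrite -rE.
  have -> : M%:R ^+ 2 = \prod_(j | j != ord0) (M%:R ^+ 2) `^ w j :> R.
    by rewrite powR_sum_exp// w1 powRr1// ltW.
  have -> : 25 ^+ k = \prod_(j : 'I_k.+1 | j != ord0) 25 :> R.
    rewrite prodr_const; congr (_ ^+ _); have := cardC1 (ord0 : 'I_k.+1); rewrite card_ord//.
  rewrite -!big_split/=; apply: eq_bigr => j _.
  have -> : (M%:R / (N j)%:R) ^+ 2 = M%:R ^+ 2 * (N j)%:R `^ (- 2) :> R.
    by rewrite exprMn exprVn powRN powR_mulrn.
  rewrite powRM ?sqr_ge0 ?powR_ge0// -powRrM /r.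
  have -> : (N j)%:R ^+ 2 = (N j)%:R `^ 2 :> R by rewrite powR_mulrn.
  have E2 : (N j)%:R `^ 2 * (N j)%:R `^ (-2 * w j) = (N j)%:R `^ (2 / k%:R - 2 * w j) * (N j)%:R `^ (2 - 2 / k%:R) :> R.
    rewrite -!powRD; [congr (_ `^ _); ring| |]; by apply/implyP => _; rewrite gt_eqF.
  transitivity (25 * B j * (M%:R ^+ 2) `^ w j * ((N j)%:R `^ 2 * (N j)%:R `^ (-2 * w j))); first by ring.
  by rewrite E2; ring.
set Z := \prod_(j | j != ord0) ((N j)%:R `^ (2 - 2 / k%:R) * B j) in prodE *.
have Z0 : 0 <= Z by apply: prodr_ge0 => j _; rewrite mulr_ge0 ?powR_ge0.
set P1 := \prod_(j | j != ord0) (25 * _ * _) in prodE *.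
set P2 := \prod_(j | j != ord0) _ in prodE *.
have -> : Kp * m `^ e * B ord0 / M%:R ^+ 2 * P1 * (P2 * (k%:R * Km)) = Kp * B ord0 / M%:R ^+ 2 * (k%:R * Km) * m `^ e * (P1 * P2) by ring.
rewrite prodE.
have -> : Kp * B ord0 / M%:R ^+ 2 * (k%:R * Km) * m `^ e * (25 ^+ k * M%:R ^+ 2 * ((N ord_max)%:R / M%:R) `^ e * Z) =
   Kp * 25 ^+ k * Km * k%:R * (m `^ e * ((N ord_max)%:R / M%:R) `^ e) * B ord0 * Z.
  by field; rewrite gt_eqF.
have -> : Kp * 25 ^+ k * Km * k%:R * ((N ord_max)%:R / (N ord0)%:R + (N (inord 1))%:R^-1) `^ (10 * k%:R)^-1 * (\sum_n nc (b ord0 n) ^+ 2) * Z =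
   Kp * 25 ^+ k * Km * k%:R * (((N ord_max)%:R / (N ord0)%:R + (N (inord 1))%:R^-1) `^ e) * B ord0 * Z by [].
apply: ler_wpM2r => //; apply: ler_wpM2r => //; apply: ler_wpM2l.
  by do ?[exact: ler0n | exact: ltW | apply: exprn_ge0 | apply: mulr_ge0].
rewrite -powRM ?divr_ge0//; apply: ge0_ler_powR; rewrite ?nnegrE ?(ltW e0)//.
- by rewrite mulr_ge0// divr_ge0.
(* The shifted weight pays off: (N_2/N_1 + 1/N_2) N_{k+1}/N_2 <= N_{k+1}/N_1 + 1/N_2, by N_{k+1} <=
   N_2. *)
rewrite /m -/j1 -/M mulrDl; apply: lerD.
  rewrite le_eqVlt; apply/orP; left; apply/eqP; field.
  by rewrite !gt_eqF.
rewrite mulrC -[leRHS]mul1r ler_wpM2r ?invr_ge0// ler_pdivrMr// mul1r ler_nat.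
by apply: NM.
Qed.

End Multilinear.

(** * Reduction to finite exponential sums *)

Section LittlewoodPaley.
Context {R : realType}.
Implicit Types (psi : R -> R).

Lemma cutoff_eq0 psi s : cutoff psi -> 2 <= `|s| -> psi s = 0.
Proof.
move=> [_ supp _ _ _] hs; apply/eqP/negPn/negP => ps.
have /supp : closure [set s | psi s != 0] s by exact: subset_closure.
rewrite /= in_itv/= => /andP[h1 h2]; move: hs; rewrite leNgt ltr_norml h1 h2//.
Qed.

Lemma norm2_ge0 (n : int * int) : 0 <= norm2 n :> R.
Proof. exact: sqrtr_ge0. Qed.

Lemma LP_symbol_lt psi (N : nat) n : cutoff psi -> (0 < N)%N ->
  LP_symbol psi N%:R n != 0 -> norm2 n < 2 * N%:R :> R.
Proof.
move=> cut N0; have NR : 0 < N%:R :> R by rewrite ltr0n.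
rewrite ltNge; apply: contra => h.
have n0 := norm2_ge0 n; rewrite /LP_symbol; case: ifPn => [/eqP N1|_].
  by rewrite (cutoff_eq0 cut)// ger0_norm//; move: h; rewrite N1; lra.
have q1 : 2 <= `|norm2 n / N%:R| :> R by rewrite ger0_norm ?divr_ge0// ler_pdivlMr//.
have q2 : 2 <= `|2 * norm2 n / N%:R| :> R.
  by rewrite ger0_norm ?divr_ge0 ?mulr_ge0// ler_pdivlMr//; lra.
by rewrite (cutoff_eq0 cut q1) (cutoff_eq0 cut q2) subrr.
Qed.

(** When 2|n| <= N both values of [psi] in the symbol are 1 and cancel. *)
Lemma LP_symbol_gt psi (N : nat) n : cutoff psi -> (1 < N)%N ->
  LP_symbol psi N%:R n != 0 -> N%:R ^+ 2 <= 4 * (n.1%:~R ^+ 2 + n.2%:~R ^+ 2) :> R.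
Proof.
move=> [_ _ _ _ one] N1; have NR : 1 < N%:R :> R by rewrite ltr1n.
have n0 := norm2_ge0 n.
have nE : norm2 n ^+ 2 = n.1%:~R ^+ 2 + n.2%:~R ^+ 2 :> R.
  by rewrite sqr_sqrtr// addr_ge0 ?sqr_ge0.
have Nn1 : (N%:R == 1 :> R) = false by rewrite gt_eqF.
rewrite -nE /LP_symbol Nn1 => nz; rewrite leNgt; apply/negP => h.
move: nz; apply/negP; rewrite negbK; apply/eqP.
have h2 : 2 * norm2 n <= N%:R :> R.
  rewrite -(@ler_pXn2r _ 2) ?nnegrE ?mulr_ge0//; first by rewrite exprMn; lra.
have NR0 : 0 < N%:R :> R by lra.
have q1 : `|norm2 n / N%:R| <= 1 :> R by rewrite ger0_norm ?divr_ge0 ?(ltW NR0)// ler_pdivrMr//; lra.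
have q2 : `|2 * norm2 n / N%:R| <= 1 :> R.
  by rewrite ger0_norm ?divr_ge0 ?mulr_ge0 ?(ltW NR0)// ler_pdivrMr//; lra.
by rewrite (one _ q1) (one _ q2) subrr.
Qed.

Definition LP_coef psi (N : nat) (f : R * R -> R[i]) (n : boxT N) : R[i] :=
  Complex (LP_symbol psi N%:R (freq n)) 0 * fourier f (freq n).

Lemma norm2_lt_box N (n : int * int) : norm2 n < 2 * N%:R :> R -> exists p : boxT N, freq p = n.
Proof.
move=> h.
have n0 := norm2_ge0 n.
have nE : norm2 n ^+ 2 = n.1%:~R ^+ 2 + n.2%:~R ^+ 2 :> R.
  by rewrite sqr_sqrtr// addr_ge0 ?sqr_ge0.
have bd (z : int) : z%:~R ^+ 2 <= norm2 n ^+ 2 :> R -> (absz z <= 2 * N)%N.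
  move=> hz; rewrite -(ler_nat R) natr_absz intr_norm natrM.
  apply: le_trans (ltW h).
  by rewrite -(@ler_pXn2r _ 2) ?nnegrE// real_normK// num_real.
have b1 : (absz n.1 <= 2 * N)%N by apply: bd; rewrite nE lerDl sqr_ge0.
have b2 : (absz n.2 <= 2 * N)%N by apply: bd; rewrite nE lerDr sqr_ge0.
have o1 : (absz (n.1 + (2 * N)%N%:Z)%R < (2 * (2 * N)).+1)%N by lia.
have o2 : (absz (n.2 + (2 * N)%N%:Z)%R < (2 * (2 * N)).+1)%N by lia.
exists (Ordinal o1, Ordinal o2); rewrite /freq /=.
by case: n b1 b2 {o1 o2 nE bd n0 h} => u v /= b1 b2; congr pair; lia.
Qed.

Lemma LP_evol psi (N : nat) (f : R * R -> R[i]) x : cutoff psi -> (0 < N)%N ->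
  LP psi N%:R f x = \sum_(n : boxT N) LP_coef psi f n * expi (dot (freq n) x).
Proof.
move=> cut N0; rewrite /LP (@fsbigE _ _ _ _ _ (map (@freq N) (enum {: boxT N})))//.
- by rewrite big_map big_enum_cond/=; apply: eq_bigl => n; rewrite in_setT.
- by rewrite map_inj_uniq ?enum_uniq//; exact: freq_inj.
- move=> n _ nin; have [->|nz] := eqVneq (LP_symbol psi N%:R n) 0.
    by rewrite mul0r mul0r.
  exfalso; have [p pn] := norm2_lt_box (LP_symbol_lt cut N0 nz).
  by move: nin; rewrite -pn map_f// mem_enum.
Qed.

Lemma LP_coef_supp psi (N : nat) f (n : boxT N) : cutoff psi -> (1 < N)%N -> LP_coef psi f n != 0 ->
  N%:R ^+ 2 <= 4 * ((freq n).1%:~R ^+ 2 + (freq n).2%:~R ^+ 2) :> R.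
Proof.
move=> cut N1; rewrite /LP_coef => nz; apply: (LP_symbol_gt cut N1).
by apply: contra_neq nz => ->; rewrite mul0r.
Qed.

Lemma L2norm_LP psi (N : nat) f : cutoff psi -> (0 < N)%N ->
  L2norm leb2 torus (LP psi N%:R f) = (Num.sqrt (\sum_(n : boxT N) nc (LP_coef psi f n) ^+ 2))%:E.
Proof.
move=> cut N0; rewrite /L2norm.
under eq_integral do rewrite LP_evol//.
rewrite plancherel.
have -> : \sum_(p : boxT N) \sum_(p' : boxT N | freq p' == freq p) complex.Re (LP_coef psi f p * (LP_coef psi f p')^*%C) = \sum_(n : boxT N) nc (LP_coef psi f n) ^+ 2.
  apply: eq_bigr => n _; rewrite (big_pred1 n) ?nc_sqrE//.
  by move=> n' /=; rewrite (inj_eq (@freq_inj N)).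
by rewrite poweR_EFin powR12_sqrt//; apply: sumr_ge0 => n _; exact: sqr_ge0.
Qed.

End LittlewoodPaley.

(** * Fourier coefficients of sums in L^2(T^2) *)

Section FourierL2.
Context {R : realType}.
Implicit Types (g h : R * R -> R[i]) (n : int * int) (om : R[i]).

Lemma leb2_torus : leb2 torus = 1%:E :> \bar R.
Proof.
rewrite /leb2 /torus product_measure1E//= lebesgue_measure_itv/= lte_fin ltr01 -EFinB subr0.
by rewrite mule1.
Qed.

(* [om] is 1 or -i: the pairing gives the real or the imaginary part of the
   integrand of the Fourier coefficient. *)
Definition pairing om n (f : R * R -> R[i]) (x : R * R) : R :=
  complex.Re (om * (expi (- dot n x) * f x)).

Lemma pairing_le om n f x : nc om = 1 -> `|pairing om n f x| <= nc (f x).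
Proof.
by move=> o1; apply: le_trans (Re_le_nc _) _; rewrite !ncM o1 nc_expi !mul1r.
Qed.

Lemma measurable_pairing om n f (D : set (R * R)) :
  measurable_fun D (fun x => complex.Re (f x)) -> measurable_fun D (fun x => complex.Im (f x)) ->
  measurable_fun D (pairing om n f).
Proof.
move=> mRe mIm.
have -> : pairing om n f = (fun x => complex.Re (om * expi (- dot n x)) * complex.Re (f x) - complex.Im (om * expi (- dot n x)) * complex.Im (f x)).
  by apply/funext => x; rewrite /pairing mulrA; case: (om * _) => a b; case: (f x).
have md : measurable_fun D (fun x : R * R => - dot n x).
  by apply: measurable_funTS; apply: measurable_funN; exact: measurable_dot.
have m1 := measurable_Re_trig (I := unit) xpredT (fun _ => om) (fun _ => measurable_funN (measurable_dot n)).
have m2 := measurable_Im_trig (I := unit) xpredT (fun _ => om) (fun _ => measurable_funN (measurable_dot n)).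
apply: measurable_funB; apply: measurable_funM => //; apply: measurable_funTS.
  by move: m1; congr (measurable_fun _ _); apply/funext => x; rewrite (big_pred1 tt)//; case.
by move: m2; congr (measurable_fun _ _); apply/funext => x; rewrite (big_pred1 tt)//; case.
Qed.

Lemma integral_sq_le h (s : R) : (L2norm leb2 torus h < s%:E)%E ->
  (\int[leb2]_(x in torus) (nc (h x) ^+ 2)%:E <= (s ^+ 2)%:E)%E.
Proof.
rewrite /L2norm; set X := (\int[leb2]_(x in torus) _)%E.
have X0 : (0 <= X)%E by apply: integral_ge0 => x _; rewrite lee_fin sqr_ge0.
clearbody X; case: X X0 => [r||] //; last first.
  by move=> _; rewrite poweRyr ?invr_eq0 ?pnatr_eq0// ltNge leey.
rewrite !lee_fin poweR_EFin lte_fin => r0; rewrite powR12_sqrt// => rs.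
have sq0 := sqrtr_ge0 r.
rewrite -(sqr_sqrtr r0) ler_pXn2r// ?nnegrE ltW//; exact: le_lt_trans rs.
Qed.

Lemma pairing_integrable om n h : nc om = 1 -> inL2 leb2 torus h ->
  leb2.-integrable torus (EFin \o pairing om n h).
Proof.
move=> o1 [mRe mIm hL2].
have [s hs] : exists s : R, (L2norm leb2 torus h < s%:E)%E.
  have l0 : (0 <= L2norm leb2 torus h)%E by exact: poweR_ge0.
  by move: l0 hL2; case: (L2norm leb2 torus h) => [r| |]// _ _; exists (r + 1); rewrite lte_fin ltrDl.
have Hs := integral_sq_le hs.
have mnc : measurable_fun torus (fun x => nc (h x) ^+ 2).
  under eq_fun do rewrite nc_sqr.
  by apply: measurable_funD; exact: measurable_funX.
apply: (@le_integrable _ _ _ leb2 torus measurable_torus _ (EFin \o (fun x => 1 + nc (h x) ^+ 2))).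
- by apply/measurable_EFinP; exact: measurable_pairing.
- move=> x _; rewrite /= lee_fin [leRHS]ger0_norm ?addr_ge0 ?sqr_ge0//.
  apply: le_trans (pairing_le _ _ _ o1) _.
  have := sqr_ge0 (nc (h x) - 2^-1); rewrite sqrrB; have := nc_ge0 (h x); lra.
apply/integrableP; split; first by apply/measurable_EFinP; exact: measurable_funD.
have -> : (\int[leb2]_(x in torus) `|(EFin \o (fun x => 1 + nc (h x) ^+ 2)%R) x| = \int[leb2]_(x in torus) (1%:E + (nc (h x) ^+ 2)%:E))%E.
  by apply: eq_integral => x _; rewrite /= ger0_norm ?addr_ge0 ?sqr_ge0.
rewrite ge0_integralD//; last 3 first.
- exact: measurable_torus.
- by move=> x _; rewrite lee_fin sqr_ge0.
- exact/measurable_EFinP.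
rewrite integral_cst//; last exact: measurable_torus.
rewrite [X in (_ * X + _)%E]leb2_torus mule1; apply: le_lt_trans (leeD2l _ Hs) _.
by rewrite -EFinD ltry.
Qed.

(** Cauchy-Schwarz in pointwise form: |h| <= s/2 + |h|^2 / (2s), and the torus has measure 1. *)
Lemma pairing_small om n h (s : R) : nc om = 1 -> inL2 leb2 torus h -> 0 < s ->
  (L2norm leb2 torus h < s%:E)%E ->
  `|\int[leb2]_(x in torus) pairing om n h x| <= s.
Proof.
move=> o1 hL2 s0 hs.
have Hs := integral_sq_le hs.
have I := pairing_integrable n o1 hL2.
have [mRe mIm _] := hL2.
have mnc : measurable_fun torus (fun x => nc (h x) ^+ 2).
  under eq_fun do rewrite nc_sqr.
  by apply: measurable_funD; exact: measurable_funX.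
have le1 := @le_normr_Rintegral _ (measurableTypeR R * measurableTypeR R)%type R leb2 torus (pairing om n h) measurable_torus I.
apply: (le_trans le1).
have key : (\int[leb2]_(x in torus) (`|pairing om n h x|)%:E <= s%:E)%E.
  apply: (@le_trans _ _ (\int[leb2]_(x in torus) ((s / 2)%:E + ((2 * s)^-1 * nc (h x) ^+ 2)%:E))%E).
    apply: ge0_le_integral_nonmeasurable => x.
    - by rewrite lee_fin.
    - rewrite -EFinD lee_fin addr_ge0 ?divr_ge0 ?(ltW s0)//.
      by rewrite mulr_ge0 ?sqr_ge0// invr_ge0 mulr_ge0// (ltW s0).
    move=> Dx; split => //; rewrite -EFinD lee_fin; apply: le_trans (pairing_le _ _ _ o1) _.
    have e : s / 2 + (2 * s)^-1 * nc (h x) ^+ 2 = nc (h x) + (2 * s)^-1 * (nc (h x) - s) ^+ 2.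
      by field; rewrite gt_eqF.
    by rewrite e lerDl mulr_ge0 ?sqr_ge0// invr_ge0 mulr_ge0// (ltW s0).
  have i0 : 0 <= (2 * s)^-1 by rewrite invr_ge0 mulr_ge0// (ltW s0).
  rewrite ge0_integralD//; last 4 first.
  - exact: measurable_torus.
  - by move=> x _; rewrite lee_fin divr_ge0// ltW.
  - by move=> x _; rewrite lee_fin mulr_ge0 ?sqr_ge0.
  - by apply/measurable_EFinP; exact: measurable_funM.
  rewrite integral_cst//; last exact: measurable_torus.
  rewrite [X in (_ * X + _)%E]leb2_torus mule1.
  under eq_integral do rewrite EFinM.
  rewrite ge0_integralZl_EFin//; last 3 first.
  - exact: measurable_torus.
  - by move=> x _; rewrite lee_fin sqr_ge0.
  - exact/measurable_EFinP.
  have i0E : (0 <= ((2 * s)^-1)%:E)%E by rewrite lee_fin.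
  apply: le_trans (leeD2l _ (lee_wpmul2l i0E Hs)) _.
  rewrite -EFinM -EFinD lee_fin le_eqVlt; apply/orP; left; apply/eqP; field.
  by rewrite gt_eqF.
have k0 : (0 <= \int[leb2]_(x in torus) (`|pairing om n h x|)%:E)%E.
  by apply: integral_ge0 => x _; rewrite lee_fin.
rewrite /Rintegral; move: key k0; case: (\int[leb2]_(x in torus) _)%E => [r||]//=.
Qed.

Lemma integral_pairing_trig om n (I : finType) (b : I -> R[i]) (nu : I -> int * int) :
  leb2.-integrable torus (EFin \o pairing om n (fun x => \sum_p b p * expi (dot (nu p) x))) ->
  \int[leb2]_(x in torus) pairing om n (fun x => \sum_p b p * expi (dot (nu p) x)) x =
  \sum_(p | nu p == n) complex.Re (om * b p).
Proof.
move=> Ip.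
(* [integral_torus_cos] wants a nonnegative integrand, so the constant K is added as one more term,
   of frequency 0, and removed after integration. *)
pose J := (unit + I * bool)%type.
pose K := nc om * \sum_p nc (b p).
pose ka (q : J) : R := if q is inr (p, c) then if c then complex.Im (om * b p) else complex.Re (om * b p) else K.
pose th (q : J) : R := if q is inr (p, true) then pi / 2 else 0.
pose m (q : J) : int := if q is inr (p, c) then (nu p).1 - n.1 else 0.
pose l (q : J) : int := if q is inr (p, c) then (nu p).2 - n.2 else 0.
have E x : K + pairing om n (fun x => \sum_p b p * expi (dot (nu p) x)) x =
   \sum_q ka q * cos (2 * pi * ((m q)%:~R * x.1 + (l q)%:~R * x.2) + th q).
  rewrite big_sumType /= (big_pred1 tt)//= !mul0r !addr0 mulr0 cos0 mulr1; congr (_ + _).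
  transitivity (\sum_p \sum_c ka (inr (p, c)) * cos (2 * pi * ((m (inr (p, c)))%:~R * x.1 + (l (inr (p, c)))%:~R * x.2) + th (inr (p, c)))); last first.
    by rewrite pair_bigA; apply: eq_bigr => -[p c] _.
  rewrite /pairing !mulr_sumr Re_sum; apply: eq_bigr => p _; rewrite big_bool /ka /th /m /l /=.
  have -> : om * (expi (- dot n x) * (b p * expi (dot (nu p) x))) =
    (om * b p) * expi (((nu p).1 - n.1)%:~R * x.1 + ((nu p).2 - n.2)%:~R * x.2).
    have <- : expi (- dot n x) * expi (dot (nu p) x) = expi (((nu p).1 - n.1)%:~R * x.1 + ((nu p).2 - n.2)%:~R * x.2).
      by rewrite -expiD; congr expi; rewrite /dot !rmorphB/=; ring.
    ring.
  rewrite addr0 cosDpihalf; case: (om * b p) => u v; rewrite /expi /=; ring.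
have pos x : 0 <= K + pairing om n (fun x => \sum_p b p * expi (dot (nu p) x)) x.
  suff : `|pairing om n (fun x => \sum_p b p * expi (dot (nu p) x)) x| <= K by rewrite ler_norml; lra.
  apply: le_trans (Re_le_nc _) _; rewrite !ncM nc_expi mul1r ler_wpM2l ?nc_ge0//.
  apply: le_trans (nc_sum _ _ _) _; rewrite ler_sum// => p _.
  by rewrite ncM nc_expi mulr1.
have Ic : leb2.-integrable torus (EFin \o (fun=> K) : R * R -> \bar R).
  apply/integrableP; split; first exact/measurable_EFinP.
  rewrite /= integral_cst//; last exact: measurable_torus.
  by rewrite [X in (_ * X)%E]leb2_torus mule1 ltry.
have := @RintegralD _ (measurableTypeR R * measurableTypeR R)%type R leb2 torus (fun=> K) _ measurable_torus Ic Ip.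
rewrite Rintegral_cst; last exact: measurable_torus.
rewrite [X in K * fine X + _]leb2_torus mulr1 => /eqP; rewrite addrC -subr_eq => /eqP <-.
rewrite {1}/Rintegral; under eq_integral do rewrite E.
rewrite integral_torus_cos; last by move=> x; rewrite -E.
rewrite /= big_sumType /= (big_pred1 tt)//= cos0 mulr1 [K + _]addrC addrK.
rewrite [LHS](_ : _ = \sum_p \sum_c if ((nu p).1 - n.1 == 0) && ((nu p).2 - n.2 == 0) then ka (inr (p, c)) * cos (th (inr (p, c))) else 0); last first.
  by rewrite pair_bigA big_mkcond/=; apply: eq_bigr => -[p c] _.
rewrite [RHS]big_mkcond; apply: eq_bigr => p _.
rewrite big_bool /ka /th /= cos_pihalf cos0 mulr0 mulr1 !subr_eq0 -pair_eqE/=.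
by case: ifP; rewrite ?add0r// addr0.
Qed.

Lemma inL2_trig (I : finType) (b : I -> R[i]) (nu : I -> int * int) :
  inL2 leb2 torus (fun x => \sum_p b p * expi (dot (nu p) x)).
Proof.
split; last by rewrite /L2norm plancherel poweR_lty// ltry.
- by apply: measurable_funTS; apply: (measurable_Re_trig xpredT) => p; exact: measurable_dot.
- by apply: measurable_funTS; apply: (measurable_Im_trig xpredT) => p; exact: measurable_dot.
Qed.

(** Pairing is continuous for the L^2 norm. A finite set of frequencies giving error below s is
    enlarged to contain n; its sum then pairs exactly to c n and the remainder to at most s. *)
Lemma integral_pairing_L2_sum om n (c : int * int -> R[i]) g : nc om = 1 ->
  L2_sum leb2 torus (fun m x => c m * expi (dot m x)) g ->
  \int[leb2]_(x in torus) pairing om n g x = complex.Re (om * c n).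
Proof.
move=> o1 [g2 cv]; apply/eqP; rewrite -subr_eq0 -normr_le0.
apply/ler_addgt0Pr => s s0; rewrite add0r.
have nb : nbhs (0%E : \bar R) [set y | (y < s%:E)%E] by apply: open_ereal_lt'; rewrite lte_fin.
have [A _ HA] := cv _ nb.
pose B := (n |` A)%fset.
pose h x := g x - \sum_(m <- B) c m * expi (dot m x).
have hs : (L2norm leb2 torus h < s%:E)%E by apply: HA; rewrite /= fsubsetUr.
pose P x := \sum_(p : B) c (val p) * expi (dot (val p) x).
have PE x : \sum_(m <- B) c m * expi (dot m x) = P x by rewrite /P big_seq_fsetE.
have P2 : inL2 leb2 torus P by exact: inL2_trig.
have h2 : inL2 leb2 torus h.
  have [gRe gIm _] := g2; have [pRe pIm _] := P2; split; last exact: lt_trans hs (ltry _).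
  - have -> : (fun x => complex.Re (h x)) = (fun x => complex.Re (g x) - complex.Re (P x)).
      by apply/funext => x; rewrite /h PE; case: (g x) (P x) => u v [].
    exact: measurable_funB.
  - have -> : (fun x => complex.Im (h x)) = (fun x => complex.Im (g x) - complex.Im (P x)).
      by apply/funext => x; rewrite /h PE; case: (g x) (P x) => u v [].
    exact: measurable_funB.
have Ih := pairing_integrable n o1 h2.
have IP := pairing_integrable n o1 P2.
have -> : \int[leb2]_(x in torus) pairing om n g x = \int[leb2]_(x in torus) pairing om n h x + \int[leb2]_(x in torus) pairing om n P x.
  rewrite -(@RintegralD _ (measurableTypeR R * measurableTypeR R)%type R leb2 torus _ _ measurable_torus Ih IP).
  apply: eq_Rintegral => x _; rewrite /pairing /h PE -raddfD -mulrDr -mulrDr subrK//.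
rewrite integral_pairing_trig//.
have nB : n \in B by rewrite fset1U1.
rewrite (big_pred1 [` nB]%fset) => [|p]; last by rewrite /= -val_eqE.
by rewrite addrK; exact: pairing_small.
Qed.

Lemma fourier_L2_sum (c : int * int -> R[i]) g n :
  L2_sum leb2 torus (fun m x => c m * expi (dot m x)) g -> fourier g n = c n.
Proof.
move=> hs.
have re := @integral_pairing_L2_sum 1 n c g (@nc1 R) hs.
have ni1 : nc (Complex 0 (-1) : R[i]) = 1 by rewrite /= expr0n/= add0r sqrrN expr1n sqrtr1.
have im := @integral_pairing_L2_sum (Complex 0 (-1)) n c g ni1 hs.
have -> : c n = Complex (complex.Re (c n)) (complex.Im (c n)) by case: (c n).
rewrite /fourier; congr Complex.
  by rewrite mul1r in re; rewrite -re; apply: eq_Rintegral => x _; rewrite /pairing mul1r.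
have iE (z : R[i]) : complex.Re (Complex 0 (-1) * z) = complex.Im z by case: z => u v /=; ring.
by rewrite iE in im; rewrite -im; apply: eq_Rintegral => x _; rewrite /pairing iE.
Qed.

Lemma fourier_schrodinger (a1 a2 t : R) f :
  schrodinger a1 a2 t f = (fun=> 0) \/
  forall n, fourier (schrodinger a1 a2 t f) n = fourier f n * expi (Q a1 a2 n * t).
Proof.
rewrite /schrodinger; case: xgetP => [g _ hg|_]; [right => n|by left].
apply: (@fourier_L2_sum (fun n => fourier f n * expi (Q a1 a2 n * t))).
move: hg; rewrite /=; congr (L2_sum _ _ _ _); apply/funext => m; apply/funext => x.
by rewrite -mulrA -expiD [_ + dot _ _]addrC.
Qed.

End FourierL2.

Section Assembly.
Context {R : realType}.

Lemma fourier0 n : fourier (fun=> 0) n = 0 :> R[i].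
Proof.
rewrite /fourier.
have z (F : R * R -> R) : (forall x, F x = 0) -> \int[leb2]_(x in torus) F x = 0.
  move=> F0; rewrite (@eq_Rintegral _ _ _ _ _ (fun=> 0)) => [|x _]; last exact: F0.
  by rewrite Rintegral_cst ?mul0r//; exact: measurable_torus.
by rewrite !z// => x; rewrite mulr0.
Qed.

(** Equality when the sum defining the evolution exists; the default value 0 is covered by the
    inequality. *)
Lemma LP_schrodinger_le psi (N : nat) f (a1 a2 t : R) x : cutoff psi -> (0 < N)%N ->
  nc (LP psi N%:R (schrodinger a1 a2 t f) x) <= nc (evol a1 a2 (@LP_coef R psi N f) t x).
Proof.
move=> cut N0; rewrite LP_evol//; have [->|E] := fourier_schrodinger a1 a2 t f.
  rewrite big1 ?nc0 ?nc_ge0// => n _.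
  by rewrite /LP_coef fourier0 mulr0 mul0r.
rewrite /evol le_eqVlt; apply/orP; left; apply/eqP; congr nc; apply: eq_bigr => n _.
by rewrite /LP_coef E /wave expiD; ring.
Qed.

Lemma sqrtr_prod I (r : seq I) (P : pred I) (f : I -> R) : (forall i, 0 <= f i) ->
  Num.sqrt (\prod_(i <- r | P i) f i) = \prod_(i <- r | P i) Num.sqrt (f i).
Proof.
move=> f0; suff : 0 <= \prod_(i <- r | P i) f i /\ Num.sqrt (\prod_(i <- r | P i) f i) = \prod_(i <- r | P i) Num.sqrt (f i) by case.
apply: (big_ind2 (fun x y => 0 <= x /\ Num.sqrt x = y)) => //; first by rewrite sqrtr1.
by move=> x1 x2 y1 y2 [x0 <-] [y0 <-]; rewrite mulr_ge0// sqrtrM.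
Qed.

Lemma sqrtr_powR (x a : R) : Num.sqrt (x `^ (2 * a)) = x `^ a.
Proof. by rewrite -powR12_sqrt ?powR_ge0// -powRrM mulrAC divff// mul1r. Qed.

End Assembly.

Theorem proposition3p3 (R : realType) (C : R) (hC : 1 < C)
    (psi : R -> R) (hpsi : cutoff psi)
    (k : nat) (hk : (3 <= k)%N)
    (tau0 : interval R) (htau0 : [set` tau0] `<=` `[0, 1]) :
  exists delta c : R, [/\ 0 < delta, 0 < c &
    forall a1 a2 : R, C^-1 < a1 < C -> C^-1 < a2 < C ->
    forall phi : 'I_k.+1 -> R * R -> R[i],
      (forall j, inL2 leb2 torus (phi j)) ->
    forall N : 'I_k.+1 -> R,
      (forall j, dyadic (N j)) ->
      (forall i j : 'I_k.+1, (i <= j)%N -> N j <= N i) ->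
    (L2norm leb3 ([set` tau0] `*` torus)
       (fun tx : R * (R * R) =>
          (\prod_(j < k.+1)
             LP psi (N j) (schrodinger a1 a2 tx.1 (phi j)) tx.2)%R)
     <= (c * ((N ord_max / N ord0 + (N (inord 1))^-1) `^ delta))%:E
        * L2norm leb2 torus (LP psi (N ord0) (phi ord0))
        * \prod_(j < k.+1 | j != ord0)
            ((N j `^ (1 - k%:R^-1))%:E
             * L2norm leb2 torus (LP psi (N j) (phi j))))%E].
Proof.
have [K [K0 HK]] := multilinear hC hk.
(* [multilinear] bounds the squared norm: square roots halve the exponent 1/(10k) and turn N_j^(2 -
   2/k) into N_j^(1 - 1/k). *)
exists (20 * k%:R)^-1, (Num.sqrt K).
have k0 : 0 < k%:R :> R by rewrite ltr0n; lia.
split; [by rewrite invr_gt0 mulr_gt0|by rewrite sqrtr_gt0|].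
move=> a1 a2 ha1 ha2 phi _ N dy mono.
have /choice[m mE] := dy.
pose n (j : 'I_k.+1) := (2 ^ m j)%N.
have -> : N = (fun j => (n j)%:R).
  by apply/funext => j; rewrite mE /n natrX.
have n0 j : (0 < n j)%N by rewrite /n expn_gt0.
have nmono (i j : 'I_k.+1) : (i <= j)%N -> (n j <= n i)%N.
  by move=> /mono; rewrite !mE -!natrX ler_nat.
pose b j := @LP_coef R psi (n j) (phi j).
have {HK} := HK a1 a2 n b ha1 ha2 n0 nmono (fun n1 p => LP_coef_supp hpsi n1).
set B := fun j => \sum_p nc (b j p) ^+ 2.
set X : R := (_ `^ (10 * _)^-1); move=> HK.
have B0 j : 0 <= B j by apply: sumr_ge0 => p _; exact: sqr_ge0.
have X0 : 0 <= X by exact: powR_ge0.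
have L j : L2norm leb2 torus (LP psi (n j)%:R (phi j)) = (Num.sqrt (B j))%:E by exact: L2norm_LP.
rewrite L; under eq_bigr do rewrite L -EFinM; rewrite prodEFin -!EFinM.
have I0 : (0 <= \int[leb3]_(z in [set` tau0] `*` torus) (nc (\prod_(j < k.+1) LP psi (n j)%:R (schrodinger a1 a2 z.1 (phi j)) z.2) ^+ 2)%:E)%E.
  by apply: integral_ge0 => z _; rewrite lee_fin sqr_ge0.
pose Y := K * X * B ord0 * \prod_(j < k.+1 | j != ord0) ((n j)%:R `^ (2 - 2 / k%:R) * B j).
have le : (\int[leb3]_(z in [set` tau0] `*` torus) (nc (\prod_(j < k.+1) LP psi (n j)%:R (schrodinger a1 a2 z.1 (phi j)) z.2) ^+ 2)%:E <= Y%:E)%E.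
  (* The time interval is enlarged to [0,1], so the constants are uniform in [tau0]. *)
  apply: le_trans HK; apply: ge0_le_integral_nonmeasurable => z.
  - by rewrite lee_fin sqr_ge0.
  - by rewrite lee_fin prodr_ge0// => j _; rewrite sqr_ge0.
  move=> [z1 z2]; split; first by split => //; exact: htau0.
  rewrite lee_fin nc_prod -prodrXl; apply: ler_prod => j _.
  rewrite sqr_ge0 ler_pXn2r ?nnegrE ?nc_ge0//; exact: LP_schrodinger_le.
have Y0 : 0 <= Y by rewrite -lee_fin; exact: le_trans le.
have h0 : 0 <= 2^-1 :> R by rewrite invr_ge0.
have := gt0_ler_poweR h0 _ _ le.
rewrite !in_itv/= !leey !andbT => /(_ I0) {}le.
apply: le_trans (le _) _; first by rewrite lee_fin.
rewrite [leLHS]poweR_EFin powR12_sqrt// /Y lee_fin le_eqVlt; apply/orP; left; apply/eqP.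
have W j : Num.sqrt ((n j)%:R `^ (2 - 2 / k%:R) * B j) = (n j)%:R `^ (1 - k%:R^-1) * Num.sqrt (B j).
  rewrite sqrtrM ?powR_ge0//; congr (_ * _).
  by rewrite -[in RHS]sqrtr_powR mulrBr mulr1.
rewrite sqrtrM; last by rewrite !mulr_ge0// (ltW K0).
rewrite sqrtrM; last by rewrite mulr_ge0// (ltW K0).
rewrite sqrtrM; last exact: ltW.
rewrite sqrtr_prod => [|j]; last by rewrite mulr_ge0// powR_ge0.
under eq_bigr do rewrite W.
congr (_ * _ * _ * _); rewrite -[in RHS]sqrtr_powR /X; congr (Num.sqrt (_ `^ _)).
by field; rewrite gt_eqF.
Qed.
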